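(* There exists a constant $C>0$ such that $$\left|(1-x^2)^{1/4}\,g_n^{(\alpha,\beta)}(x)\right|\le C\,(2n+\alpha+\beta+1)^{-1/4}$$ for all $x\in[-1,1]$, all real numbers $\alpha,\beta\ge 0$ and all non-negative integers $n$.
   Context: For real $\alpha,\beta>-1$ and an integer $n\ge 0$, $P_n^{(\alpha,\beta)}$ denotes the Jacobi polynomial with the standard normalization, $$P_n^{(\alpha,\beta)}(x)=\frac{\Gamma(n+\alpha+1)}{\Gamma(\alpha+1)\Gamma(n+1)}\;{}_2F_1\!\left(-n,n+\alpha+\beta+1;\alpha+1;\tfrac{1-x}{2}\right).$$ For $x\in[-1,1]$, real $\alpha,\beta\ge 0$ and an integer $n\ge0$ define $$g_n^{(\alpha,\beta)}(x)=\left(\frac{\Gamma(n+1)\,\Gamma(n+\alpha+\beta+1)}{\Gamma(n+\alpha+1)\Gamma(n+\beta+1)}\right)^{1/2}\left(\frac{1-x}2\right)^{\alpha/2}\left(\frac{1+x}2\right)^{\beta/2}P_n^{(\alpha,\beta)}(x).$$ *)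

(* Defs.v *)
From mathcomp Require Import all_boot all_order all_algebra.
From mathcomp Require Import all_classical all_reals all_analysis.

Set Implicit Arguments.
Unset Strict Implicit.
Unset Printing Implicit Defensive.

Import Order.TTheory GRing.Theory Num.Theory.
Import numFieldNormedType.Exports.

Local Open Scope classical_set_scope.
Local Open Scope ring_scope.

(* Euler's integral; it is Gamma(s) only for s > 0 (for s <= 0 the integral
   diverges and [Rintegral] yields the junk value 0). *)
Definition Gamma (R : realType) (s : R) : R :=
  \int[lebesgue_measure]_(t in `]0, +oo[%classic) (t `^ (s - 1) * expR (- t)).

Definition pochhammer (R : realType) (a : R) (k : nat) : R :=
  \prod_(0 <= i < k) (a + i%:R).

(* Gauss' series 2F1(a, b; c; z), meaningful when it converges and c is not a
   non-positive integer. For a = - n%:R its terms of index > n vanish, so it is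
   a polynomial in z. *)
Definition hypergeometric2F1 (R : realType) (a b c z : R) : R :=
  limn (series (fun k : nat =>
    pochhammer a k * pochhammer b k / (pochhammer c k * k`!%:R) * z ^+ k)).

Definition jacobi (R : realType) (n : nat) (a b x : R) : R :=
  Gamma (n%:R + a + 1) / (Gamma (a + 1) * Gamma (n%:R + 1)) *
  hypergeometric2F1 (- n%:R) (n%:R + a + b + 1) (a + 1) ((1 - x) / 2).

(* [powR] satisfies 0 `^ 0 = 1 and 0 `^ r = 0 for r != 0, which is the
   convention needed at the endpoints x = 1 and x = -1. *)
Definition jacobi_g (R : realType) (n : nat) (a b x : R) : R :=
  (Gamma (n%:R + 1) * Gamma (n%:R + a + b + 1) /
     (Gamma (n%:R + a + 1) * Gamma (n%:R + b + 1))) `^ (1 / 2) *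
  ((1 - x) / 2) `^ (a / 2) * ((1 + x) / 2) `^ (b / 2) * jacobi n a b x.

(* Main.v *)
(* Write p = 1 - x^2, N = 2n + a + b + 1, y = g_n and v = p y'. Then
   v' = - W y / p with W = Wh - p / 4 and Wh = N^2/4 (Rr^2 - (x - x0)^2), a concave
   parabola, and the total mass T of y^2 on [-1, 1] is O(1/N). The claim
   p y^4 = O(1/N) follows from p y^4 = O(T^2 N), which uses only this equation
   and v = - a y at 1, v = b y at -1.

   Look at a maximum point x1 of p y^4 lying, by symmetry, to the right of x0.
   For a multiplier f the energy
     I = f (v^2 + W y^2) - p f' y v + p (p f')' y^2 / 2
   vanishes at both ends and I' = G y^2 with
     G = 2 f' W + f W' + (p (p f')')' / 2.
   Let s be the signed distance to the right turning point x0 + Rr. For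
     f = (x - x0) (s + sqrt (s^2 + del^2))^(-1/2)
   one gets G <= K = O(N^2 Rr^(3/2)) everywhere, and G - K is at most
   - c N^2 Rr^2 del^(-1/2) where s <= del. So the set {s <= del} carries at most
   O(sqrt (del / Rr)) of the mass. With L of order sqrt (p(x1) / N):
   - if Rr = O(L), or if x1 is within L of the turning point, then y is
     comparable with y(x1) on an interval next to x1, whose mass is bounded by T
     or by the previous estimate;
   - otherwise v^2 + W y^2, whose derivative is W' y^2, is controlled at x1 by the
     mass to the right of x1.

   T is reduced to a beta integral by (n, a, b) -> (n-1, a+1, b+1). The ratio of
   the beta integral to Gamma(a+1) Gamma(b+1) / Gamma(a+b+2) is 1-periodic in a
   and in b, so it is enough to bound it for a and b in [0, 1]. *)

Require Import Defs.
From mathcomp Require Import all_boot all_order all_algebra.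
From mathcomp Require Import all_classical all_reals all_analysis.
From mathcomp Require Import ring lra.

Set Implicit Arguments.
Unset Strict Implicit.
Unset Printing Implicit Defensive.

Import Order.TTheory GRing.Theory Num.Theory.
Import numFieldNormedType.Exports.

Local Open Scope classical_set_scope.
Local Open Scope ring_scope.

(** * Calculus on closed intervals *)

Section Calculus.
Context {R : realType}.
Implicit Types (f g : R -> R) (x a b : R).

(** With [f = W^(-1/2)] the expression [2 f' W + f W'] would vanish, but this [f] is singular at the
    turning points. The multiplier keeps only the singularity [s^(-1/2)] of the right turning point,
    smoothed at width [del]. The factor [x - x0] has the sign opposite to [Wh'], so [f Wh'] is a
    negative term that penalises mass. Smoothing by [s + sqrt (s^2 + del^2)], which is at most
    [4 del] wherever [s <= del], keeps that penalty from fading beyond the turning point.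

    The obstacle is uniformity: [Rr] ranges from [1/N] to [1], the turning points may touch the end
    points, and [p] varies. The scale [L] is chosen so that [Rr] drops out. Near the turning point
    [W] is of size [om^2 = N^2 Rr L] and [y] keeps its size over a length [p / om], so a mass
    [sqrt (L / Rr) T] gives [p^2 y^4 = O(N^2 L^2 T^2)], which is [O(p N T^2)] exactly when [L^2] is
    of order [p / N]. If [Rr] exceeds [L], this [L] is also above the width [(p^2 / (N^2 Rr))^(1/3)]
    below which the third-order term of [G] could no longer be absorbed. *)

Definition contI a b f := {within `[a, b], continuous f}.

Lemma deriv_add f g x (df dg : R) : is_derive x 1 f df -> is_derive x 1 g dg ->
  is_derive x 1 (fun z => f z + g z) (df + dg).
Proof. by move=> hf hg; exact: is_deriveD. Qed.

Lemma deriv_opp f x (df : R) : is_derive x 1 f df ->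
  is_derive x 1 (fun z => - f z) (- df).
Proof. by move=> hf; exact: is_deriveN. Qed.

Lemma deriv_mul f g x (df dg : R) : is_derive x 1 f df -> is_derive x 1 g dg ->
  is_derive x 1 (fun z => f z * g z) (f x * dg + g x * df).
Proof. by move=> hf hg; exact: is_deriveM. Qed.

Lemma deriv_exp f n x (df : R) : is_derive x 1 f df ->
  is_derive x 1 (fun z => f z ^+ n) (n%:R * f x ^+ n.-1 * df).
Proof.
move=> hf; elim: n => [|n ih].
  by rewrite !mul0r; apply: (is_derive_eq (is_derive_cst _ _ _)).
have -> : (fun z => f z ^+ n.+1) = (fun z => f z * f z ^+ n).
  by apply/funext => z; rewrite exprS.
apply: (is_derive_eq (deriv_mul hf ih)).
case: n {ih} => [|n] /=; first by rewrite !mul0r mulr0 add0r expr0 !mul1r.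
by rewrite exprS -[in RHS]natr1; ring.
Qed.

Lemma deriv_cst (c x : R) : is_derive x 1 (fun _ : R => c) 0.
Proof. exact: is_derive_cst. Qed.

Lemma deriv_id x : is_derive x 1 (fun z : R => z) 1.
Proof. exact: is_derive_id. Qed.

Lemma deriv_comp (h f : R -> R) x (dh df : R) :
  is_derive x 1 f df -> is_derive (f x) 1 h dh ->
  is_derive x 1 (fun z => h (f z)) (df * dh).
Proof. by move=> hf hh; apply: (is_derive_eq (is_derive1_comp hh hf)); rewrite mulrC. Qed.

Lemma deriv_inv f x (df : R) : f x != 0 -> is_derive x 1 f df ->
  is_derive x 1 (fun z => (f z)^-1) (- df / f x ^+ 2).
Proof.
move=> f0 hf; apply: (is_derive_eq (is_deriveV _ _)) => //.
by rewrite /GRing.scale /= mulNr mulrC mulNr.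
Qed.

Lemma deriv_sqrt f x (df : R) : 0 < f x -> is_derive x 1 f df ->
  is_derive x 1 (fun z => Num.sqrt (f z)) (df / (2 * Num.sqrt (f x))).
Proof.
move=> f0 hf; apply: (is_derive_eq (deriv_comp hf (is_derive1_sqrt f0))) => //.
Qed.

Lemma deriv_cont f x (df : R) : is_derive x 1 f df -> {for x, continuous f}.
Proof. by move=> [hf _]; apply: differentiable_continuous; exact/derivable1_diffP. Qed.

Lemma contI_deriv a b f : (forall x, a <= x <= b -> exists df : R, is_derive x 1 f df) ->
  contI a b f.
Proof.
move=> h; apply: continuous_in_subspaceT => x; rewrite inE/= in_itv/= => /h[df hx].
exact: deriv_cont hx.
Qed.

Lemma contI_add a b f g : contI a b f -> contI a b g -> contI a b (fun z => f z + g z).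
Proof. by move=> hf hg x; apply: cvgD; [exact: hf|exact: hg]. Qed.

Lemma contI_mul a b f g : contI a b f -> contI a b g -> contI a b (fun z => f z * g z).
Proof. by move=> hf hg x; apply: cvgM; [exact: hf|exact: hg]. Qed.

Lemma contI_opp a b f : contI a b f -> contI a b (fun z => - f z).
Proof. by move=> hf x; apply: cvgN; exact: hf. Qed.

Lemma contI_exp a b f n : contI a b f -> contI a b (fun z => f z ^+ n).
Proof.
move=> hf; elim: n => [|n ih]; first by move=> x; exact: cvg_cst.
by under eq_fun do rewrite exprS; exact: contI_mul.
Qed.

Lemma contI_cst a b (c : R) : contI a b (fun _ => c).
Proof. by move=> x; exact: cvg_cst. Qed.

Lemma contI_id a b : contI a b (fun z : R => z).
Proof. by apply: continuous_subspaceT => x; exact: cvg_id. Qed.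

Lemma contI_sub (a b c d : R) f : contI a b f -> a <= c -> d <= b -> contI c d f.
Proof.
move=> hf ac db; apply: (continuous_subspaceW _ hf).
by move=> x /=; rewrite !in_itv/= => /andP[cx xd]; rewrite (le_trans ac)// (le_trans xd).
Qed.

Lemma contIP (a b : R) f : contI a b f <->
  forall x, a <= x <= b -> f @ within `[a, b] (nbhs x) --> f x.
Proof.
split=> [/subspace_continuousP h x xab|h].
  by apply: h; rewrite /= in_itv.
by apply/subspace_continuousP => x; rewrite /= in_itv/=; exact: h.
Qed.

Lemma contI_comp (a b c d : R) f g : (forall x, a <= x <= b -> c <= g x <= d) ->
  contI a b g -> contI c d f -> contI a b (fun z => f (g z)).
Proof.
move=> hg /contIP cg /contIP cf; apply/contIP => x xab.
apply: (cvg_comp _ _ (G := within `[c, d] (nbhs (g x)))); last exact: cf (hg _ xab).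
move=> P hP; have := cg _ xab _ hP; rewrite /nbhs /= /within /=.
by apply: filterS => z hz zab; apply: hz => //; rewrite in_itv/=; apply: hg; rewrite in_itv/= in zab.
Qed.

Lemma le_of_deriv f (df : R -> R) a b : a <= b -> contI a b f ->
  (forall x, a < x < b -> is_derive x 1 f (df x)) ->
  (forall x, a < x < b -> 0 <= df x) -> f a <= f b.
Proof.
move=> ab cf hd h0; have [ab'|] := ltP a b; last first.
  by move=> ba; rewrite (le_anti (introT andP (conj ab ba))).
have hd' x : x \in `]a, b[ -> is_derive x 1 f (df x) by rewrite in_itv/=; exact: hd.
have [c + e] := MVT ab' hd' cf.
by rewrite in_itv/= -subr_ge0 e => hc; rewrite mulr_ge0 ?h0// subr_ge0.
Qed.

Lemma mean_value f (df : R -> R) a b (K : R) : a <= b -> contI a b f ->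
  (forall x, a < x < b -> is_derive x 1 f (df x)) ->
  (forall x, a < x < b -> `|df x| <= K) -> `|f b - f a| <= K * (b - a).
Proof.
move=> ab cf hd hK; have [ab'|] := ltP a b; last first.
  by move=> ba; rewrite (le_anti (introT andP (conj ab ba))) !subrr normr0 mulr0.
have hd' x : x \in `]a, b[ -> is_derive x 1 f (df x) by rewrite in_itv/=; exact: hd.
have [c + e] := MVT ab' hd' cf.
rewrite in_itv/= e => hc; rewrite normrM (ger0_norm (x:=b - a)) ?subr_ge0//.
by rewrite ler_wpM2r ?subr_ge0// hK.
Qed.

Lemma max_deriv0 f (df : R -> R) a b x : a < x < b ->
  (forall z, a < z < b -> is_derive z 1 f (df z)) ->
  (forall z, a < z < b -> f z <= f x) -> df x = 0.
Proof.
move=> axb hf hmax; have ab : a <= b by case/andP: axb => ax /(lt_trans ax)/ltW.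
have [] := @derive1_at_max R f a b x ab.
- by move=> t; rewrite in_itv/= => /hf[].
- by rewrite in_itv.
- by move=> t; rewrite in_itv/= => /hmax.
by move=> _ <-; case: (hf _ axb) => _ ->.
Qed.

End Calculus.

Ltac pos := repeat first
  [ assumption | (apply: ltW; assumption) | exact: sqr_ge0 | apply: mulr_ge0 | apply: exprn_ge0 | apply: addr_ge0
  | (rewrite invr_ge0) | exact: ler0n | exact: ler01 | exact: normr_ge0 ].

(** * Algebraic bounds for the multiplier *)

Section MultiplierBounds.
Context {R : realType}.
Implicit Types (x xi g q c e P : R).

Lemma norm_le_add (x y A B : R) : `|x| <= A -> `|y| <= B -> `|x + y| <= A + B.
Proof. by move=> hA hB; rewrite (le_trans (ler_normD _ _))// lerD. Qed.

Lemma norm_le_mul (x y A B : R) : `|x| <= A -> `|y| <= B -> `|x * y| <= A * B.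
Proof. by move=> hA hB; rewrite normrM ler_pM. Qed.

(* [E] is the part of [G] coming from the third-order term, from the [- p / 4] in
   [W] and from its derivative, with [c = s / rho], [e = xi / rho], [P = p / rho]
   and [rho = sqrt (s^2 + del^2)]. *)
Lemma multiplier_error (x xi g c e P p E : R) :
  `|x| <= 1 -> `|xi| <= 2 -> 0 <= p <= 1 -> 0 <= P -> 0 <= g -> `|c| <= 1 ->
  E = g * (2^-1 * (P ^+ 2 * (3/4 + 3/2 * c + e * (- (3/8) + 3/4 * c + 3/2 * c ^+ 2))
      - 6 * x * P * (1 + e * (1/4 + c/2)) + (6 * x ^+ 2 - 2) * (1 + e / 2))
      - p * (1 + e / 2) / 2 + x * xi / 2) ->
  `|E| <= 5 * g * (1 + `|e|) * (1 + P ^+ 2).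
Proof.
move=> hx hxi hp hP hg hc ->.
set u := `|e|; have hu : `|e| <= u by []. have u0 : 0 <= u by exact: normr_ge0.
have c1 (t : R) : 0 <= t -> `|t| <= t by move=> h; rewrite ger0_norm.
have hc2 : `|c ^+ 2| <= 1 by rewrite normrX exprn_ile1.
have hx2 : `|6 * x ^+ 2 - 2| <= 4.
  by rewrite ler_norml; have := ler_normlP _ _ hx => -[h1 h2]; apply/andP; split; nra.
have A1 : `|3/4 + 3/2 * c + e * (- (3/8) + 3/4 * c + 3/2 * c ^+ 2)| <= 3/4 + 3/2 * 1 + u * (3/8 + 3/4 * 1 + 3/2 * 1).
  apply: norm_le_add; first by apply: norm_le_add; [apply: c1; lra|apply: norm_le_mul => //; apply: c1; lra].
  apply: norm_le_mul => //; apply: norm_le_add; last by apply: norm_le_mul => //; apply: c1; lra.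
  by apply: norm_le_add; [rewrite normrN; apply: c1; lra|apply: norm_le_mul => //; apply: c1; lra].
have A2 : `|1 + e * (1/4 + c/2)| <= 1 + u * (1/4 + 1 / 2).
  apply: norm_le_add; first by apply: c1; lra.
  apply: norm_le_mul => //; apply: norm_le_add; first by apply: c1; lra.
  by apply: norm_le_mul => //; apply: c1; lra.
have A3 : `|1 + e / 2| <= 1 + u / 2.
  apply: norm_le_add; first by apply: c1; lra.
  by apply: norm_le_mul => //; apply: c1; lra.
have B : `|2^-1 * (P ^+ 2 * (3/4 + 3/2 * c + e * (- (3/8) + 3/4 * c + 3/2 * c ^+ 2))
      - 6 * x * P * (1 + e * (1/4 + c/2)) + (6 * x ^+ 2 - 2) * (1 + e / 2))
      - p * (1 + e / 2) / 2 + x * xi / 2| <=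
   2^-1 * (P ^+ 2 * (3/4 + 3/2 * 1 + u * (3/8 + 3/4 * 1 + 3/2 * 1))
      + 6 * 1 * P * (1 + u * (1/4 + 1/2)) + 4 * (1 + u / 2))
      + 1 * (1 + u / 2) / 2 + 1 * 2 / 2.
  apply: norm_le_add; last first.
    by apply: norm_le_mul; [apply: norm_le_mul|apply: c1; lra].
  apply: norm_le_add; last first.
    rewrite normrN; apply: norm_le_mul; last by apply: c1; lra.
    by apply: norm_le_mul => //; rewrite ger0_norm; lra.
  apply: norm_le_mul; first by apply: c1; lra.
  apply: norm_le_add; last by apply: norm_le_mul.
  apply: norm_le_add.
    by apply: norm_le_mul => //; apply: c1; nra.
  rewrite normrN; apply: norm_le_mul => //.
  by apply: norm_le_mul; [apply: norm_le_mul => //; apply: c1; lra|apply: c1].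
have -> : 5 * g * (1 + u) * (1 + P ^+ 2) = g * (5 * (1 + u) * (1 + P ^+ 2)) by ring.
rewrite normrM (ger0_norm hg) ler_wpM2l//.
apply: (le_trans B).
have h1 : 0 <= (P - 1) ^+ 2 by exact: sqr_ge0.
have h2 : 0 <= u * (P - 1) ^+ 2 by rewrite mulr_ge0.
have h3 : 0 <= u * P ^+ 2 by rewrite mulr_ge0 ?sqr_ge0.
have h4 : 0 <= P ^+ 2 by exact: sqr_ge0.
nra.
Qed.

(* Here [xi = x - x0], [q = 1 / rho], [r = sqrt Rr], [d = sqrt del]; [p1] and [s1]
   are the values of [p] and [s] at the maximum point, and [G = M + E] where [M]
   carries the factor [Lam = N^2/4]. *)
Record mult_ctx (Lam N Rr r del d xi s rho q g p p1 s1 M E : R) : Prop := MultCtx {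
  mcLam : Lam = N ^+ 2 / 4; mcN : 1 <= N; mcR : 0 < Rr; mcr0 : 0 < r; mcr : r ^+ 2 = Rr;
  mcNR : 1 <= N * Rr; mcdel : 0 < del; mcd0 : 0 < d; mcd : d ^+ 2 = del; mcdelR : 2 * del <= Rr;
  mcs : s = Rr - xi; mcrho : 0 < rho; mcrho2 : rho ^+ 2 = s ^+ 2 + del ^+ 2;
  mcq : q * rho = 1; mcg0 : 0 < g; mcg : g ^+ 2 * (s + rho) = 1;
  mcp1 : 0 <= p1; mcp0 : 0 <= p; mcp : p <= p1 + 2 * `|s - s1|; mcs1 : `|s1| <= 2 * del;
  mcH2 : 24 * 1000 * p1 ^+ 2 <= Lam * Rr * del ^+ 3; mcH3 : 24 * 1000 <= Lam * Rr * del;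
  mcH4 : 24 * 1000 <= N * (Lam * Rr * del ^+ 2);
  mcM : M = Lam * g * (2 * (1 + xi * q / 2) * (s * (Rr + xi)) - 2 * xi ^+ 2);
  mcE : `|E| <= 5 * g * (1 + `|xi * q|) * (1 + (p * q) ^+ 2) }.

Lemma mc_facts Lam N Rr r del d xi s rho q g p p1 s1 M E : mult_ctx Lam N Rr r del d xi s rho q g p p1 s1 M E ->
  [/\ 0 < Lam, 0 < q, s ^+ 2 * q ^+ 2 + del ^+ 2 * q ^+ 2 = 1 & 1 <= 4 * (Lam * Rr ^+ 2)] /\
  [/\ del <= rho, `|s| <= rho, del * q <= 1 & `|s * q| <= 1].
Proof.
move=> c; have hrho := mcrho c; have hdel := mcdel c; have hrho2 := mcrho2 c.
have hq := mcq c; have N0 : 0 < N by apply: lt_le_trans (mcN c).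
have q0 : 0 < q by rewrite -(pmulr_lgt0 _ hrho) hq.
have srho : `|s| <= rho.
  rewrite -(@ler_pXn2r _ 2)// ?nnegrE ?normr_ge0 ?(ltW hrho)//.
  by rewrite hrho2 -normrX ger0_norm ?sqr_ge0// lerDl sqr_ge0.
have delrho : del <= rho.
  by rewrite -(@ler_pXn2r _ 2)// ?nnegrE ?(ltW hdel) ?(ltW hrho)// hrho2 lerDr sqr_ge0.
split; split => //.
- by rewrite (mcLam c) divr_gt0// exprn_gt0.
- by rewrite -mulrDl -hrho2 -exprMn mulrC hq expr1n.
- have -> : 4 * (Lam * Rr ^+ 2) = (N * Rr) ^+ 2 by rewrite (mcLam c); field.
  by rewrite exprn_ege1 ?(mcNR c).
- by rewrite -hq mulrC ler_wpM2l// ltW.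
- by rewrite normrM (gtr0_norm q0) -hq [leRHS]mulrC ler_wpM2r// ltW.
Qed.

(** Since [|s - s1| <= |s| + 2 del <= 3 rho], the local value [p] is at most [p1 + 6 rho], hence
    [p q <= p1 q + 6]; the constant [365] absorbs this [6]. From here on the error depends on the
    maximum point only through [p1]. *)
Lemma error_bound Lam N Rr r del d xi s rho q g p p1 s1 M E : mult_ctx Lam N Rr r del d xi s rho q g p p1 s1 M E ->
  `|E| <= 365 * g * (1 + `|xi * q|) * (1 + (p1 * q) ^+ 2).
Proof.
move=> c; have [[_ q0 _ _] [delrho srho _ _]] := mc_facts c.
apply: (le_trans (mcE c)).
have hpq : p * q <= p1 * q + 6.
  have h2 : p <= p1 + 6 * rho.
    apply: (le_trans (mcp c)); rewrite lerD2l.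
    have := ler_normB s s1; have := mcs1 c; move: srho delrho; clear; lra.
  have : p * q <= (p1 + 6 * rho) * q by rewrite ler_wpM2r// ltW.
  by rewrite mulrDl -mulrA (mulrC rho) (mcq c) mulr1.
have pq0 : 0 <= p * q by rewrite mulr_ge0 ?(mcp0 c)// ltW.
have p1q0 : 0 <= p1 * q by rewrite mulr_ge0 ?(mcp1 c)// ltW.
have h : (p * q) ^+ 2 <= (p1 * q + 6) ^+ 2 by rewrite ler_pXn2r// nnegrE addr_ge0.
have h' : 5 * (1 + (p * q) ^+ 2) <= 365 * (1 + (p1 * q) ^+ 2).
  have := sqr_ge0 (p1 * q - 6); move: h; clear; nra.
have h0 : 0 <= g * (1 + `|xi * q|) by rewrite mulr_ge0 ?addr_ge0// ltW ?(mcg0 c).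
have := ler_wpM2l h0 h'; clear; lra.
Qed.

Lemma g_s_le Lam N Rr r del d xi s rho q g p p1 s1 M E : mult_ctx Lam N Rr r del d xi s rho q g p p1 s1 M E ->
  0 <= s -> s <= Rr -> g * s <= r.
Proof.
move=> c s0 sR; have hg0 := ltW (mcg0 c); have hr0 := ltW (mcr0 c).
rewrite -(@ler_pXn2r _ 2)// ?nnegrE ?mulr_ge0//.
have h : g ^+ 2 * s <= 1.
  by rewrite -(mcg c) ler_wpM2l ?sqr_ge0// lerDl (ltW (mcrho c)).
rewrite (mcr c) exprMn (expr2 s) mulrA; apply: (le_trans _ sR).
by rewrite ler_piMl.
Qed.

(** The form used near the right turning point: the first term is [O(Lam Rr^(3/2))] from above, and
    the second is the penalty. The factor [1 - s q] switches it on: it is close to [0] for [s] far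
    above [del] and at least [1/4] for [s <= del]. *)
Lemma multiplier_main_eq Lam N Rr r del d xi s rho q g p p1 s1 M E : mult_ctx Lam N Rr r del d xi s rho q g p p1 s1 M E ->
  M = 2 * Lam * g * (s * (Rr + 3/2 * xi)) - Lam * g * (xi * (Rr + xi)) * (1 - s * q).
Proof. by move=> c; rewrite (mcM c) (mcs c); field. Qed.

Lemma multiplier_far_main Lam N Rr r del d xi s rho q g p p1 s1 M E : mult_ctx Lam N Rr r del d xi s rho q g p p1 s1 M E ->
  2 * xi <= Rr -> M <= Lam * g * (8 * Rr ^+ 2).
Proof.
move=> c hxi; have [[Lam0 q0 _ _] [_ srho _ c_le1]] := mc_facts c.
have hR := mcR c; have hs := mcs c.
rewrite (mcM c) ler_wpM2l ?mulr_ge0 ?(ltW Lam0) ?(ltW (mcg0 c))//.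
have s0 : Rr <= 2 * s by rewrite hs; move: hxi; clear; lra.
have -> : 2 * (1 + xi * q / 2) * (s * (Rr + xi)) - 2 * xi ^+ 2 =
   2 * (s * (Rr + xi)) - 2 * xi ^+ 2 + xi * (Rr + xi) * (s * q) by field.
move: (s * q) c_le1 => cc; rewrite ler_norml => /andP[c1 c2].
(* Beyond the left turning point [xi] is not bounded by [Rr]; there [- 2 xi^2] outweighs
   [xi (Rr + xi)] and the whole expression is negative. *)
have [h|h] := leP xi (- Rr).
  have h1 : s * (Rr + xi) <= 0 by rewrite mulr_ge0_le0//; move: s0 h hR; clear; lra.
  have h2 : 0 <= xi * (Rr + xi) by rewrite mulr_le0//; move: h hR; clear; lra.
  have h3 : xi * (Rr + xi) * cc <= xi * (Rr + xi) by rewrite ler_piMr.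
  have h4 : 0 <= Rr ^+ 2 by exact: sqr_ge0.
  have h5 : 0 <= xi ^+ 2 by exact: sqr_ge0.
  have h6 : xi * Rr <= 0 by rewrite mulr_le0_ge0//; move: h hR; clear; lra.
  move: h1 h3 h4 h5 h6; clear; lra.
have h0 : 0 <= Rr + xi by move: h; clear; lra.
have h1 : s * (Rr + xi) <= (2 * Rr) * (3/2 * Rr).
  by apply: ler_pM => //; move: s0 h0 hxi h hR; rewrite hs; clear; lra.
have h2 : `|xi * (Rr + xi) * cc| <= Rr * (2 * Rr) * 1.
  apply: norm_le_mul; last by rewrite ler_norml c1.
  by apply: norm_le_mul; rewrite ler_norml; apply/andP; split; move: h hxi hR; clear; lra.
have := le_trans (ler_norm _) h2; have := sqr_ge0 xi; have := sqr_ge0 Rr.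
move: h1; clear; lra.
Qed.

(** Here [s >= Rr / 2], so [g] and [q] are at most of order [Rr^(-1/2)] and [Rr^(-1)], and main part
    and error are both [O(Lam g Rr^2)]. The constant [3300] is [8 + 9 * 365] rounded up. *)
Lemma multiplier_far Lam N Rr r del d xi s rho q g p p1 s1 M E : mult_ctx Lam N Rr r del d xi s rho q g p p1 s1 M E ->
  2 * xi <= Rr -> M + E <= 3300 * Lam * r ^+ 3.
Proof.
move=> c hxi; have [[Lam0 q0 _ LR2] [_ srho _ _]] := mc_facts c.
have hMb := multiplier_far_main c hxi.
have hR := mcR c; have hs := mcs c; have hg0 := ltW (mcg0 c); have hr0 := ltW (mcr0 c).
have Lam0' := ltW Lam0; have hp1 := mcp1 c; have hdel := ltW (mcdel c).
have s0 : Rr <= 2 * s by rewrite hs; move: hxi; clear; lra.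
have rho0 : Rr <= 2 * rho by have := ler_norm s; move: srho s0; clear; lra.
have qR : q * Rr <= 2.
  have := ler_wpM2l (ltW q0) rho0; have := mcq c; clear; lra.
have gr : g * r <= 1.
  rewrite -(@ler_pXn2r _ 2)// ?nnegrE ?mulr_ge0// expr1n exprMn (mcr c) -(mcg c).
  by rewrite ler_wpM2l ?sqr_ge0//; move: s0 rho0; clear; lra.
have he : `|xi * q| <= 1.
  rewrite normrM (gtr0_norm q0) -(mcq c) [leRHS]mulrC ler_wpM2r ?(ltW q0)//.
  apply: (le_trans _ (le_trans (ler_norm s) srho)).
  by rewrite ler_norml hs; apply/andP; split; move: hxi hR; clear; lra.
have hEb : E <= Lam * g * (3285 * Rr ^+ 2).
  apply: (le_trans (ler_norm _)); apply: (le_trans (error_bound c)).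
  have h1 : (p1 * q) ^+ 2 <= Lam * Rr ^+ 2 / 2.
    have h2 : 24 * 1000 * p1 ^+ 2 <= Lam * Rr ^+ 4 / 8.
      apply: (le_trans (mcH2 c)).
      have : del ^+ 3 <= (Rr / 2) ^+ 3.
        rewrite ler_pXn2r// ?nnegrE ?divr_ge0 ?(ltW hR)//.
        by have := mcdelR c; clear; lra.
      have -> : (Rr / 2) ^+ 3 = Rr ^+ 3 / 8 by field.
      move=> /(ler_wpM2l (x := Lam * Rr)); rewrite mulr_ge0 ?(ltW hR)// => /(_ isT) h3.
      by apply: (le_trans h3); rewrite le_eqVlt; apply/orP; left; apply/eqP; field.
    have h3 : p1 ^+ 2 <= Lam * Rr ^+ 4 / 8.
      apply: (le_trans _ h2); rewrite ler_peMl ?sqr_ge0//; clear; lra.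
    have h4 : (p1 * q) ^+ 2 * Rr ^+ 2 <= Lam * Rr ^+ 4 / 8 * 4.
      have -> : (p1 * q) ^+ 2 * Rr ^+ 2 = p1 ^+ 2 * (q * Rr) ^+ 2 by ring.
      apply: ler_pM; rewrite ?sqr_ge0//.
      have -> : (4 : R) = 2 ^+ 2 by ring.
      by rewrite ler_pXn2r// ?nnegrE// ?mulr_ge0// ltW.
    rewrite -(@ler_pM2r _ (Rr ^+ 2)) ?exprn_gt0//.
    by apply: (le_trans h4); rewrite le_eqVlt; apply/orP; left; apply/eqP; field.
  have h2 : 1 + (p1 * q) ^+ 2 <= 9/2 * (Lam * Rr ^+ 2) by move: h1 LR2; clear; lra.
  have h3 : (1 + `|xi * q|) * (1 + (p1 * q) ^+ 2) <= 2 * (9/2 * (Lam * Rr ^+ 2)).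
    apply: ler_pM => //; rewrite ?addr_ge0 ?sqr_ge0//; move: he; clear; lra.
  have h4 := ler_wpM2l hg0 h3; move: h4; clear; lra.
have h1 : M + E <= 3293 * Lam * (g * Rr ^+ 2) by move: hMb hEb; clear; lra.
apply: (le_trans h1).
have h2 : g * Rr ^+ 2 <= r ^+ 3.
  have -> : g * Rr ^+ 2 = (g * r) * r ^+ 3 by rewrite -(mcr c); ring.
  by rewrite ler_piMl// exprn_ge0.
have h3 := ler_wpM2l Lam0' h2.
have K0 : 0 <= Lam * r ^+ 3 by rewrite mulr_ge0 ?exprn_ge0.
by move: h3 K0; clear; lra.
Qed.

Lemma multiplier_near_main Lam N Rr r del d xi s rho q g p p1 s1 M E : mult_ctx Lam N Rr r del d xi s rho q g p p1 s1 M E ->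
  Rr <= 2 * xi -> M <= 5 * Lam * r ^+ 3 - Lam * g * (xi * (Rr + xi)) * (1 - s * q).
Proof.
move=> c hxi; have [[Lam0 q0 _ _] _] := mc_facts c.
have hR := mcR c; have hs := mcs c; have hr0 := ltW (mcr0 c).
rewrite (multiplier_main_eq c) lerD2r.
have -> : 2 * Lam * g * (s * (Rr + 3/2 * xi)) = 2 * Lam * (g * s * (Rr + 3/2 * xi)) by ring.
have -> : 5 * Lam * r ^+ 3 = 2 * Lam * (r * (5/2 * Rr)) by rewrite -(mcr c); field.
rewrite ler_wpM2l ?mulr_ge0 ?(ltW Lam0)//.
have xi0 : 0 <= Rr + 3/2 * xi by move: hR hxi; clear; lra.
have [s0|s0] := leP 0 s.
  apply: ler_pM => //; rewrite ?mulr_ge0 ?(ltW (mcg0 c))//.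
    by apply: (g_s_le c) => //; rewrite hs; move: hR hxi; clear; lra.
  by move: s0; rewrite hs; clear; lra.
apply: (@le_trans _ _ 0); last by rewrite !mulr_ge0 ?(ltW hR).
by rewrite mulr_le0_ge0// mulr_ge0_le0 ?(ltW s0) ?(ltW (mcg0 c)).
Qed.

(** Although [1 - s q] may be small here, it is at least [del^2 q^2 / 2]. Half of the resulting
    penalty absorbs the part of the error that carries [p1]; the other half is reserved for the part
    without [p1]. *)
Lemma multiplier_mid Lam N Rr r del d xi s rho q g p p1 s1 M E : mult_ctx Lam N Rr r del d xi s rho q g p p1 s1 M E ->
  Rr <= 2 * xi -> del <= s -> M + E <= 3300 * Lam * r ^+ 3.
Proof.
move=> c hxi hsd; have [[Lam0 q0 sq1 LR2] [delrho srho delq c_le1]] := mc_facts c.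
have hMb := multiplier_near_main c hxi.
have hR := mcR c; have hs := mcs c; have hg0 := ltW (mcg0 c); have hr0 := ltW (mcr0 c).
have Lam0' := ltW Lam0; have hp1 := mcp1 c; have hdel := mcdel c; have q0' := ltW q0.
have s0 : 0 < s := lt_le_trans hdel hsd.
set t := del ^+ 2 * q ^+ 2.
have t0 : 0 <= t by rewrite mulr_ge0 ?sqr_ge0.
have c1 : t / 2 <= 1 - s * q.
  have sq0 : 0 <= s * q by rewrite mulr_ge0// ltW.
  have sq2 : s * q <= 1 by rewrite (le_trans (ler_norm _)).
  have : t = 1 - (s * q) ^+ 2 by rewrite -sq1 exprMn /t; ring.
  by move=> ->; move: sq0 sq2; clear; nra.
have neg : Lam * g * (3/4 * Rr ^+ 2) * (t / 2) <= Lam * g * (xi * (Rr + xi)) * (1 - s * q).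
  have h1 : (1/2 * Rr) * (3/2 * Rr) <= xi * (Rr + xi) by apply: ler_pM; move: hR hxi; clear; lra.
  have h2 : 3/4 * Rr ^+ 2 * (t / 2) <= xi * (Rr + xi) * (1 - s * q).
    by apply: ler_pM => //; [move: (sqr_ge0 Rr)|move: t0|move: h1]; clear; lra.
  by have := ler_wpM2l (mulr_ge0 Lam0' hg0) h2; rewrite !mulrA.
have Rq1 : 1 <= Rr * q.
  rewrite -(mcq c) mulrC ler_wpM2r//.
  rewrite -(@ler_pXn2r _ 2)// ?nnegrE ?(ltW hR) ?(ltW (mcrho c))// (mcrho2 c).
  have hs2 : 2 * s <= Rr by rewrite hs; move: hxi; clear; lra.
  have h1 : s ^+ 2 <= (Rr / 2) ^+ 2 by rewrite ler_pXn2r// ?nnegrE ?divr_ge0 ?(ltW hR) ?(ltW s0)//; move: hs2; clear; lra.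
  have h2 : del ^+ 2 <= s ^+ 2 by rewrite ler_pXn2r// ?nnegrE ?ltW.
  by move: h1 h2 (sqr_ge0 Rr); clear; lra.
have hEb : E <= 730 * (g * (Rr * q)) + 730 * (g * (Rr * q) * (p1 * q) ^+ 2).
  apply: (le_trans (ler_norm _)); apply: (le_trans (error_bound c)).
  have h1 : 1 + `|xi * q| <= 2 * (Rr * q).
    have : `|xi * q| <= Rr * q.
      rewrite normrM (gtr0_norm q0) ler_wpM2r// ler_norml; apply/andP; split.
        by move: hR hxi; clear; lra.
      by move: s0; rewrite hs; clear; lra.
    by move: Rq1; clear; lra.
  have h2 : 0 <= g * (1 + (p1 * q) ^+ 2) by rewrite mulr_ge0 ?addr_ge0 ?sqr_ge0.
  by have := ler_wpM2l h2 h1; clear; lra.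
have hE2 : 730 * (g * (Rr * q) * (p1 * q) ^+ 2) <= Lam * g * (3/16 * Rr ^+ 2) * t.
  have h1 : p1 ^+ 2 * q <= Lam * Rr * del ^+ 2 / (24 * 1000).
    rewrite -(@ler_pM2l _ (24 * 1000)); last by clear; lra.
    have -> : 24 * 1000 * (Lam * Rr * del ^+ 2 / (24 * 1000)) = Lam * Rr * del ^+ 2 by field.
    rewrite mulrA; apply: (le_trans (ler_wpM2r q0' (mcH2 c))).
    have -> : Lam * Rr * del ^+ 3 * q = Lam * Rr * del ^+ 2 * (del * q) by ring.
    by rewrite ler_piMr//; pos.
  have h0 : 0 <= g * Rr * q ^+ 2 by pos.
  have := ler_wpM2l h0 h1; rewrite /t.
  have : 0 <= Lam * g * Rr ^+ 2 * (del ^+ 2 * q ^+ 2) by pos.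
  by clear; lra.
have K0 : 0 <= Lam * r ^+ 3 by rewrite mulr_ge0 ?exprn_ge0.
(* Either the reserved half of the penalty absorbs the remaining error, or its failure forces
   [q <= N]; then [g^2 <= q] and [N Rr >= 1] bound that error directly by a multiple of
   [N^2 Rr^(3/2)]. *)
have [h|h] := leP (730 * (g * (Rr * q))) (Lam * g * (3/16 * Rr ^+ 2) * t).
  by move: hMb neg hEb hE2 h K0; clear; lra.
have qN : q <= N.
  have h1 : Lam * Rr * del ^+ 2 * q <= 24 * 1000.
    have h2 : 0 < g * Rr * q by rewrite !mulr_gt0 ?(mcg0 c).
    have h3 : (g * Rr * q) * (3/16 * (Lam * Rr * del ^+ 2 * q)) < (g * Rr * q) * 730.
      by move: h; rewrite /t; clear; lra.
    by move: h3; rewrite ltr_pM2l//; clear; lra.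
  have h4 : 0 < Lam * Rr * del ^+ 2 by rewrite !mulr_gt0 ?exprn_gt0.
  rewrite -(@ler_pM2l _ (Lam * Rr * del ^+ 2))//; apply: (le_trans h1).
  by rewrite [leRHS]mulrC; exact: mcH4 c.
have N0 : 0 <= N by apply: le_trans (mcN c).
have gRq : g * (Rr * q) <= N ^+ 2 * r ^+ 3.
  rewrite -(@ler_pXn2r _ 2)// ?nnegrE ?mulr_ge0 ?exprn_ge0 ?(ltW hR)//.
  have g2 : g ^+ 2 <= q.
    have : g ^+ 2 * rho <= 1.
      by rewrite -(mcg c) ler_wpM2l ?sqr_ge0// lerDr ltW.
    by move/(ler_wpM2r q0'); rewrite -mulrA (mulrC rho) (mcq c) mulr1 mul1r.
  have -> : (g * (Rr * q)) ^+ 2 = Rr ^+ 2 * (g ^+ 2 * q ^+ 2) by ring.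
  have -> : (N ^+ 2 * r ^+ 3) ^+ 2 = Rr ^+ 2 * ((N ^+ 3) * (N * Rr)).
    by rewrite -(mcr c); ring.
  rewrite ler_wpM2l ?sqr_ge0//; apply: (@le_trans _ _ (q * q ^+ 2)).
    by rewrite ler_wpM2r ?sqr_ge0.
  rewrite -exprS; apply: (@le_trans _ _ (N ^+ 3)); first by rewrite ler_pXn2r// nnegrE.
  by rewrite ler_peMr ?(mcNR c)// exprn_ge0.
have -> : 3300 * Lam * r ^+ 3 = 3300 * (N ^+ 2 * r ^+ 3) / 4 by rewrite (mcLam c); field.
have neg' : 0 <= Lam * g * (3/16 * Rr ^+ 2) * t by pos.
move: hMb neg hEb hE2 gRq neg' K0; rewrite (mcLam c); clear; lra.
Qed.

(** The penalty is at least [Lam g xi^2 / 4] because [1 - s q >= 1/4]. The error takes half of it,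
    and [s + rho <= 4 del], that is [g >= 1 / (2 d)], turns the other half into the stated term. The
    factor [xi^2] is kept because [xi] may be much larger than [Rr] beyond the turning point. *)
Lemma multiplier_near Lam N Rr r del d xi s rho q g p p1 s1 M E : mult_ctx Lam N Rr r del d xi s rho q g p p1 s1 M E ->
  Rr <= 2 * xi -> s <= del -> M + E <= 3300 * Lam * r ^+ 3 - Lam * xi ^+ 2 / (16 * d).
Proof.
move=> c hxi hsd; have [[Lam0 q0 sq1 LR2] [delrho srho delq c_le1]] := mc_facts c.
have hMb := multiplier_near_main c hxi.
have hR := mcR c; have hs := mcs c; have hg0 := ltW (mcg0 c); have hr0 := ltW (mcr0 c).
have Lam0' := ltW Lam0; have hp1 := mcp1 c; have hdel := mcdel c; have q0' := ltW q0.
have xi0 : 0 < xi by move: hR hxi; clear; lra.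
have hd0 := mcd0 c.
have c1 : 1/4 <= 1 - s * q.
  have [s0|s0] := leP 0 s; last first.
    have : s * q <= 0 by rewrite mulr_le0_ge0// ltW.
    by clear; lra.
  have h2 : s ^+ 2 * q ^+ 2 <= del ^+ 2 * q ^+ 2.
    by rewrite ler_wpM2r ?sqr_ge0// ler_pXn2r// nnegrE ltW.
  have sq0 : 0 <= s * q by rewrite mulr_ge0.
  by move: h2 sq1 sq0; rewrite -exprMn; clear; nra.
have neg : Lam * g * (xi ^+ 2) * (1/4) <= Lam * g * (xi * (Rr + xi)) * (1 - s * q).
  have xi0' := ltW xi0.
  have h1 : xi ^+ 2 <= xi * (Rr + xi) by rewrite expr2 ler_wpM2l// lerDr ltW.
  have h2 : xi ^+ 2 * (1/4) <= xi * (Rr + xi) * (1 - s * q).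
    by apply: ler_pM => //; exact: sqr_ge0.
  by have := ler_wpM2l (mulr_ge0 Lam0' hg0) h2; rewrite !mulrA.
have hEb : E <= Lam * g * xi ^+ 2 / 8.
  apply: (le_trans (ler_norm _)); apply: (le_trans (error_bound c)).
  have h0 : q <= del^-1 by rewrite -[leRHS]mul1r ler_pdivlMr// mulrC.
  have d1 : 1 <= xi / del.
    by rewrite ler_pdivlMr// mul1r; have := mcdelR c; move: hxi; clear; lra.
  have h1 : 1 + `|xi * q| <= 2 * (xi / del).
    have : `|xi * q| <= xi / del by rewrite normrM (gtr0_norm q0) (gtr0_norm xi0) ler_wpM2l// ltW.
    by move: d1; clear; lra.
  have h2 : (p1 * q) ^+ 2 <= p1 ^+ 2 / del ^+ 2.
    by rewrite exprMn -exprVn ler_wpM2l ?sqr_ge0// ler_pXn2r// nnegrE invr_ge0 ltW.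
  (* [5840] is [8 * 2 * 365]. Two conditions are added and [Rr <= 2 xi] is used, so each needs a
     constant of at least [4 * 5840]; this is the origin of [24 * 1000]. *)
  have h3 : 5840 * (1 + p1 ^+ 2 / del ^+ 2) <= Lam * xi * del.
    have a1 : Lam * Rr * del <= 2 * (Lam * xi * del).
      have : Lam * del * Rr <= Lam * del * (2 * xi) by rewrite ler_wpM2l// mulr_ge0// ltW.
      by clear; lra.
    have a2 : 24 * 1000 * (p1 ^+ 2 / del ^+ 2) <= Lam * Rr * del.
      rewrite mulrA ler_pdivrMr ?exprn_gt0//.
      have -> : Lam * Rr * del * del ^+ 2 = Lam * Rr * del ^+ 3 by ring.
      exact: mcH2 c.
    by move: a1 a2 (mcH3 c); clear; lra.
  have h4 : (1 + `|xi * q|) * (1 + (p1 * q) ^+ 2) <= 2 * (xi / del) * (1 + p1 ^+ 2 / del ^+ 2).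
    by apply: ler_pM; rewrite ?addr_ge0 ?sqr_ge0// lerD2l.
  have h5 : 0 <= xi / del by rewrite divr_ge0 ?ltW.
  have h6 := ler_wpM2l h5 h3.
  have e1 : xi / del * (Lam * xi * del) = Lam * xi ^+ 2 by field; rewrite gt_eqF.
  rewrite e1 in h6.
  have h7 : 365 * ((1 + `|xi * q|) * (1 + (p1 * q) ^+ 2)) <= Lam * xi ^+ 2 / 8.
    by move: h4 h6; clear; lra.
  by have := ler_wpM2l hg0 h7; clear; lra.
have gd : (2 * d)^-1 <= g.
  rewrite -[leLHS]mul1r ler_pdivrMr ?mulr_gt0//.
  rewrite -(@ler_pXn2r _ 2)// ?nnegrE ?mulr_ge0 ?(ltW hd0)// expr1n -{1}(mcg c).
  rewrite !exprMn (mcd c) ler_wpM2l ?sqr_ge0//.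
  have [s0|s0] := leP s 0.
    have : rho <= `|s| + del.
      rewrite -(@ler_pXn2r _ 2)// ?nnegrE ?addr_ge0 ?(ltW hdel) ?(ltW (mcrho c))//.
      rewrite (mcrho2 c) -(real_normK (num_real s)).
      have : 0 <= `|s| * del by rewrite mulr_ge0// ltW.
      by clear; lra.
    by rewrite ler0_norm//; move: hdel; clear; lra.
  have : rho <= 2 * del.
    rewrite -(@ler_pXn2r _ 2)// ?nnegrE ?mulr_ge0 ?(ltW hdel) ?(ltW (mcrho c))//.
    have : s ^+ 2 <= del ^+ 2 by rewrite ler_pXn2r// nnegrE ltW.
    by rewrite (mcrho2 c) => h; have := sqr_ge0 del; move: h; clear; lra.
  by move: hsd hdel; clear; lra.
have h1 : Lam * xi ^+ 2 / (16 * d) <= Lam * g * xi ^+ 2 / 8.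
  have -> : Lam * xi ^+ 2 / (16 * d) = Lam * xi ^+ 2 / 8 * (2 * d)^-1.
    by field; rewrite gt_eqF.
  have h0 : 0 <= Lam * xi ^+ 2 / 8 by pos.
  have := ler_wpM2l h0 gd.
  by clear; lra.
have K0 : 0 <= Lam * r ^+ 3 by rewrite mulr_ge0 ?exprn_ge0.
by move: hMb neg hEb h1 K0; clear; lra.
Qed.

End MultiplierBounds.

Ltac der_step := match goal with
  | |- is_derive _ _ (fun z => @?f z + @?g z) _ => eapply deriv_add
  | |- is_derive _ _ (fun z => - (@?f z)) _ => eapply deriv_opp
  | |- is_derive _ _ (fun z => (@?f z) ^+ ?n) _ => eapply deriv_exp
  | |- is_derive _ _ (fun z => @?f z * @?g z) _ => eapply deriv_mul
  | |- is_derive ?x ?v (GRing.add ?c) ?l => change (is_derive x v (fun z => c + z) l)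
  | |- is_derive ?x ?v (GRing.mul ?c) ?l => change (is_derive x v (fun z => c * z) l)
  | |- is_derive ?x ?v (@GRing.opp ?T) ?l => change (is_derive x v (fun z : T => - z) l)
  | |- is_derive _ _ (fun z => z) _ => exact: deriv_id
  | |- is_derive _ _ (fun z => ?c) _ => exact: deriv_cst
  | |- _ => eassumption
  end.
Ltac der := eapply is_derive_eq; [repeat der_step | ].
Ltac ctn_step := match goal with
  | |- contI _ _ (fun z => @?f z + @?g z) => apply: contI_add
  | |- contI _ _ (fun z => - (@?f z)) => apply: contI_opp
  | |- contI _ _ (fun z => (@?f z) ^+ ?n) => apply: contI_exp
  | |- contI _ _ (fun z => @?f z * @?g z) => apply: contI_mul
  | |- contI ?a ?b (GRing.add ?c) => change (contI a b (fun z => c + z))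
  | |- contI ?a ?b (GRing.mul ?c) => change (contI a b (fun z => c * z))
  | |- contI ?a ?b (@GRing.opp ?T) => change (contI a b (fun z : T => - z))
  | |- contI _ _ (fun z => z) => exact: contI_id
  | |- contI _ _ (fun z => ?c) => exact: contI_cst
  | |- _ => assumption
  end.
Ltac ctn := repeat ctn_step.

(** * The differential equation and the maximum point *)

Section JacobiEquation.
Context {R : realType}.

(** The end values [- a^2] at [1] and [- b^2] at [-1] match the boundary values of [v], so that
    [v^2 + Wt y^2] vanishes at both ends. *)
Definition Wh (a b N x : R) :=
  N ^+ 2 / 4 * (1 - x ^+ 2) - a ^+ 2 * ((1 + x) / 2) - b ^+ 2 * ((1 - x) / 2).
(* [Wt = p V] when the equation is written [(p y')' + V y = 0]. *)
Definition Wt (a b N x : R) := Wh a b N x - (1 - x ^+ 2) / 4.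

(* [v] stands for [p y'] and [Y] for an antiderivative of [y^2]; the point of [v] is
   that it stays continuous at the end points. *)
Record jsol (a b N : R) (y v Y : R -> R) : Prop := JSol {
  js_a : 0 <= a; js_b : 0 <= b; js_N : a + b + 1 <= N;
  js_cy : contI (-1) 1 y; js_cv : contI (-1) 1 v; js_cY : contI (-1) 1 Y;
  js_dy : forall x : R, -1 < x < 1 -> is_derive x 1 y (v x / (1 - x ^+ 2));
  js_dv : forall x : R, -1 < x < 1 -> is_derive x 1 v (- Wt a b N x * y x / (1 - x ^+ 2));
  js_dY : forall x : R, -1 < x < 1 -> is_derive x 1 Y (y x ^+ 2);
  js_v1 : v 1 = - a * y 1; js_vm1 : v (-1) = b * y (-1) }.

Lemma p_gt0 (x : R) : -1 < x < 1 -> 0 < 1 - x ^+ 2.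
Proof.
move=> /andP[h1 h2]; have : 0 < (1 - x) * (1 + x).
  by rewrite mulr_gt0//; move: h1 h2; clear; lra.
by clear; lra.
Qed.

Lemma contI_opp_arg f : contI (-1) 1 f -> contI (-1) 1 (fun x : R => f (- x)).
Proof.
apply: contI_comp; last by apply: contI_opp; exact: contI_id.
by move=> x; clear; lra.
Qed.

Lemma deriv_opp_arg f (x df : R) : is_derive (- x) 1 f df ->
  is_derive x 1 (fun z => f (- z)) (- df).
Proof.
move=> h; apply: (is_derive_eq (deriv_comp (deriv_opp (deriv_id x)) h)).
by rewrite mulN1r.
Qed.

(** Differentiating [f (v^2 + Wt y^2)] leaves the unwanted term [f' v^2]. The second summand cancels
    it at the price of [- (p f')' y v], and the third cancels that one, so only a multiple of [y^2]
    survives. *)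
Lemma energy_deriv a b N y v Y (f f1 f2 f3 : R -> R) (x : R) : jsol a b N y v Y ->
  -1 < x < 1 ->
  is_derive x 1 f (f1 x) -> is_derive x 1 f1 (f2 x) -> is_derive x 1 f2 (f3 x) ->
  is_derive x 1 (fun x => f x * (v x ^+ 2 + Wt a b N x * y x ^+ 2)
     - (1 - x ^+ 2) * f1 x * (y x * v x)
     + 1 / 2 * ((1 - x ^+ 2) * ((1 - x ^+ 2) * f2 x - 2 * x * f1 x)) * y x ^+ 2)
   ((2 * f1 x * Wt a b N x + f x * (- (N ^+ 2 / 2) * x - a ^+ 2 / 2 + b ^+ 2 / 2 + x / 2)
     + 1 / 2 * ((1 - x ^+ 2) ^+ 2 * f3 x - 6 * x * (1 - x ^+ 2) * f2 x + (6 * x ^+ 2 - 2) * f1 x))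
     * y x ^+ 2).
Proof.
move=> S hx hf hf1 hf2; have hy := js_dy S hx; have hv := js_dv S hx.
have p0 := p_gt0 hx; rewrite /Wt /Wh in hv *.
der; rewrite /=.
by field; rewrite gt_eqF.
Qed.

Lemma deriv_ext (f g : R -> R) (x df : R) : f =1 g -> is_derive x 1 f df -> is_derive x 1 g df.
Proof. by move=> /funext ->. Qed.

Lemma Wt_mirror a b N x : Wt b a N x = Wt a b N (- x).
Proof. by rewrite /Wt /Wh; field. Qed.

Lemma jsol_mirror a b N y v Y : jsol a b N y v Y ->
  jsol b a N (fun x => y (- x)) (fun x => - v (- x)) (fun x => - Y (- x)).
Proof.
move=> S; have hx (x : R) : -1 < x < 1 -> -1 < - x < 1 by clear; lra.
have hD (f df : R -> R) (x : R) :
  (forall x : R, -1 < x < 1 -> is_derive x 1 f (df x)) ->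
  -1 < x < 1 -> is_derive x 1 (fun z => f (- z)) (- df (- x)).
  by move=> h /hx /h; exact: deriv_opp_arg.
split; rewrite ?(js_a S) ?(js_b S)//.
- by rewrite (addrC b) (js_N S).
- exact: contI_opp_arg (js_cy S).
- by ctn; exact: contI_opp_arg (js_cv S).
- by ctn; exact: contI_opp_arg (js_cY S).
- move=> x x1; apply: (is_derive_eq (hD _ _ _ (js_dy S) x1)).
  by rewrite sqrrN mulNr.
- move=> x x1; apply: (is_derive_eq (deriv_opp (hD _ _ _ (js_dv S) x1))).
  by rewrite opprK [in RHS]Wt_mirror sqrrN.
- move=> x x1; apply: (is_derive_eq (deriv_opp (hD _ _ _ (js_dY S) x1))).
  by rewrite opprK.
- by rewrite (js_vm1 S) mulNr.
- by rewrite opprK (js_v1 S) mulNr opprK.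
Qed.

Definition centre (a b N x0 Rr : R) :=
  [/\ 0 < Rr, Rr <= 1, 1 <= N * Rr, Rr <= 1 - x0 & Rr <= 1 + x0] /\
  forall x, Wh a b N x = N ^+ 2 / 4 * (Rr ^+ 2 - (x - x0) ^+ 2).

(** Completing the square in the parabola [Wh], with [S / N^4] the square of its half-width. From
    [N - (a + b) >= 1] one gets [S >= N^2], which is [N Rr >= 1]; and [Wh <= 0] at [1] and [-1]
    keeps both turning points inside [[-1, 1]]. *)
Lemma centre_exists a b N : 0 <= a -> 0 <= b -> a + b + 1 <= N ->
  exists x0 Rr, centre a b N x0 Rr.
Proof.
move=> a0 b0 hN; have N0 : 0 < N by move: a0 b0 hN; clear; lra.
set S := (N ^+ 2 - (a + b) ^+ 2) * (N ^+ 2 - (a - b) ^+ 2).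
have h1 : N <= N ^+ 2 - (a + b) ^+ 2.
  have : N * 1 <= (N + (a + b)) * (N - (a + b)).
    by apply: ler_pM; move: a0 b0 hN; clear; lra.
  by clear; lra.
have h2 : N ^+ 2 - (a + b) ^+ 2 <= N ^+ 2 - (a - b) ^+ 2.
  by have : 0 <= a * b := mulr_ge0 a0 b0; clear; lra.
have S0 : N ^+ 2 <= S.
  by rewrite /S expr2; apply: ler_pM; rewrite ?(ltW N0)// (le_trans h1).
have Sp : 0 < S by apply: lt_le_trans S0; rewrite exprn_gt0.
pose x0 := - (a ^+ 2 - b ^+ 2) / N ^+ 2; pose Rr := Num.sqrt S / N ^+ 2.
have Rr2 : Rr ^+ 2 = S / N ^+ 4.
  by rewrite /Rr exprMn sqr_sqrtr ?(ltW Sp)//; field; rewrite gt_eqF.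
have R0 : 0 < Rr by rewrite divr_gt0 ?sqrtr_gt0 ?exprn_gt0.
have hW x : Wh a b N x = N ^+ 2 / 4 * (Rr ^+ 2 - (x - x0) ^+ 2).
  by rewrite Rr2 /S /x0 /Wh; field; rewrite gt_eqF.
have N2 : 0 < N ^+ 2 / 4 by rewrite divr_gt0 ?exprn_gt0.
have Wneg x : Wh a b N x <= 0 -> Rr <= `|x - x0|.
  rewrite hW pmulr_rle0// subr_le0 => h.
  by rewrite -(@ler_pXn2r _ 2)// ?nnegrE ?(ltW R0)// real_normK ?num_real.
have x0b : -1 <= x0 <= 1.
  have hb : b ^+ 2 <= N ^+ 2 by rewrite ler_pXn2r ?nnegrE ?(ltW N0)//; move: a0 hN; clear; lra.
  have ha : a ^+ 2 <= N ^+ 2 by rewrite ler_pXn2r ?nnegrE ?(ltW N0)//; move: b0 hN; clear; lra.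
  rewrite /x0 ler_pdivlMr ?exprn_gt0// ler_pdivrMr ?exprn_gt0//.
  by move: ha hb (sqr_ge0 a) (sqr_ge0 b); clear; lra.
have r1 : Rr <= 1 - x0.
  rewrite -[leRHS]ger0_norm; last by move: x0b; clear; lra.
  by apply: Wneg; rewrite /Wh; have := sqr_ge0 a; clear; lra.
have r2 : Rr <= 1 + x0.
  have : Rr <= `|-1 - x0|.
    by apply: Wneg; rewrite /Wh; have := sqr_ge0 b; clear; lra.
  by rewrite ler0_norm; move: x0b; clear; lra.
exists x0, Rr; split=> //; split=> //; first by move: r1 r2; clear; lra.
have NR0 : 0 <= N * Rr by rewrite mulr_ge0 ?ltW.
rewrite -(expr_ge1 (n := 2) _ NR0)// exprMn Rr2.
have -> : N ^+ 2 * (S / N ^+ 4) = S / N ^+ 2 by field; rewrite gt_eqF.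
by rewrite ler_pdivlMr ?exprn_gt0// mul1r.
Qed.

Lemma centre_mirror a b N x0 Rr : centre a b N x0 Rr -> centre b a N (- x0) Rr.
Proof.
move=> [[h1 h2 h3 h4 h5] hW]; split; first by split=> //; rewrite opprK.
move=> x; have := hW (- x); rewrite sqrrB sqrrB !sqrrN; rewrite /Wh sqrrN => h.
have <- : N ^+ 2 / 4 * (Rr ^+ 2 - (x ^+ 2 - - x * x0 *+ 2 + x0 ^+ 2)) =
  N ^+ 2 / 4 * (Rr ^+ 2 - (x ^+ 2 - x * - x0 *+ 2 + x0 ^+ 2)) by rewrite mulrN mulNr.
by rewrite -h; ring.
Qed.

(* [p y^4] is the fourth power of the quantity to be bounded. *)
Definition maxpt (y : R -> R) (x1 : R) := [/\ -1 < x1 < 1, y x1 != 0 &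
  forall x, -1 <= x <= 1 -> (1 - x ^+ 2) * y x ^+ 4 <= (1 - x1 ^+ 2) * y x1 ^+ 4].

Lemma maxpt_exists a b N y v Y : jsol a b N y v Y ->
  (exists x1, maxpt y x1) \/ (forall x, -1 <= x <= 1 -> (1 - x ^+ 2) * y x ^+ 4 <= 0).
Proof.
move=> S; have cy := js_cy S.
have ch : contI (-1) 1 (fun x => (1 - x ^+ 2) * y x ^+ 4) by ctn.
have le11 : (-1 : R) <= 1 by clear; lra.
have [c + hc] := EVT_max le11 ch; rewrite in_itv/= => cI.
have hc' x : -1 <= x <= 1 -> (1 - x ^+ 2) * y x ^+ 4 <= (1 - c ^+ 2) * y c ^+ 4.
  by move=> xI; apply: hc; rewrite in_itv.
have [h|h] := leP ((1 - c ^+ 2) * y c ^+ 4) 0.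
  by right => x /hc' hx; exact: le_trans hx h.
left; exists c; split=> //.
  move: cI => /andP[]; rewrite !le_eqVlt => /predU1P[e|->].
    by move: h; rewrite -e sqrrN expr1n subrr mul0r ltxx.
  case/predU1P => [e|->//].
  by move: h; rewrite e expr1n subrr mul0r !ltxx.
by apply/eqP => e; move: h; rewrite e expr0n/= mulr0 ltxx.
Qed.

Lemma maxpt_crit a b N y v Y x1 : jsol a b N y v Y -> maxpt y x1 -> v x1 = x1 * y x1 / 2.
Proof.
move=> S [x1I y0 hmax].
have hD (x : R) : -1 < x < 1 -> is_derive x 1 (fun x => (1 - x ^+ 2) * y x ^+ 4)
    (2 * y x ^+ 3 * (2 * v x - x * y x)).
  move=> xI; have hy := js_dy S xI; have p0 := p_gt0 xI.
  by der; rewrite /=; field; rewrite gt_eqF.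
have := max_deriv0 x1I hD _ => /(_ _)/eqP.
have h : forall z, -1 < z < 1 -> (1 - z ^+ 2) * y z ^+ 4 <= (1 - x1 ^+ 2) * y x1 ^+ 4.
  by move=> z /andP[/ltW z1 /ltW z2]; apply: hmax; rewrite z1.
move=> /(_ h); rewrite mulf_eq0 mulf_eq0 expf_eq0 (negbTE y0) pnatr_eq0/= subr_eq0 => /eqP e.
by rewrite -e; field.
Qed.

(* If [Wh x1 < - 1/4] then [y (4 v - 2 x y)] increases from [0] to the right of
   [x1]; it has the sign of [(p y^4)'], so [p y^4] could not drop to [0] at [1]. *)
Lemma maxpt_Wh a b N y v Y x0 Rr x1 : jsol a b N y v Y -> centre a b N x0 Rr ->
  maxpt y x1 -> x0 <= x1 -> - (1/4) <= Wh a b N x1.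
Proof.
move=> S [[R0 _ _ _ _] hW] M x01; have hv := maxpt_crit S M; case: M => x1I y0 hmax.
rewrite leNgt; apply/negP => hneg.
have hWx x : x1 <= x -> Wh a b N x <= Wh a b N x1.
  move=> xx1; rewrite !hW ler_wpM2l ?divr_ge0 ?sqr_ge0// lerD2l lerN2.
  by rewrite ler_pXn2r// ?nnegrE; move: xx1 x01; clear; lra.
case/andP: (x1I) => x1a x1b.
have sub x : x1 < x < 1 -> -1 < x < 1.
  by move=> /andP[h ->]; rewrite (lt_trans x1a h).
have cy := contI_sub (js_cy S) (ltW x1a) (lexx _).
have cv := contI_sub (js_cv S) (ltW x1a) (lexx _).
pose k x := 4 * v x - 2 * x * y x.
have yk x : x1 <= x <= 1 -> 0 <= y x * k x.
  move=> /andP[xx1 x1x].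
  have -> : 0 = y x1 * k x1 by rewrite /k hv; field.
  apply: (@le_of_deriv _ (fun x => y x * k x)
     (fun x => k x ^+ 2 / (4 * (1 - x ^+ 2)) - y x ^+ 2 / (1 - x ^+ 2) * (4 * Wh a b N x + 1))) => //.
  - by rewrite /k; apply: (@contI_sub _ x1 1) => //; ctn.
  - move=> z /andP[z1 zx]; have zI : -1 < z < 1 by apply: sub; rewrite z1 (lt_le_trans zx).
    have hy := js_dy S zI; have hv' := js_dv S zI; have p0 := p_gt0 zI.
    by rewrite /k; der; rewrite /= /Wt; field; rewrite gt_eqF.
  - move=> z /andP[z1 zx]; have zI : -1 < z < 1 by apply: sub; rewrite z1 (lt_le_trans zx).
    have p0 := p_gt0 zI; have := hWx _ (ltW z1) => hz.
    have h1 : 0 <= k z ^+ 2 / (4 * (1 - z ^+ 2)).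
      by rewrite divr_ge0 ?sqr_ge0// mulr_ge0// ltW.
    have h2 : y z ^+ 2 / (1 - z ^+ 2) * (4 * Wh a b N z + 1) <= 0.
      rewrite mulr_ge0_le0// ?divr_ge0 ?sqr_ge0 ?(ltW p0)//.
      by move: hz hneg; clear; lra.
    by move: h1 h2; clear; lra.
have : (1 - x1 ^+ 2) * y x1 ^+ 4 <= (1 - 1 ^+ 2) * y 1 ^+ 4.
  apply: (@le_of_deriv _ (fun x => (1 - x ^+ 2) * y x ^+ 4)
     (fun x => y x ^+ 2 * (y x * k x))) => //; first exact: ltW.
  - by ctn.
  - move=> z zI; have hy := js_dy S (sub _ zI); have p0 := p_gt0 (sub _ zI).
    by rewrite /k; der; rewrite /=; field; rewrite gt_eqF.
  - by move=> z /andP[z1 z2]; rewrite mulr_ge0 ?sqr_ge0// yk// !ltW.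
rewrite expr1n subrr mul0r leNgt => /negP; apply.
rewrite mulr_gt0 ?p_gt0//.
by rewrite -[4%N]/(2 * 2)%N exprM exprn_even_gt0//= expf_eq0.
Qed.

End JacobiEquation.

(** * Distance of the maximum point from the end, and the mass next to it *)

Section MaximumPoint.
Context {R : realType}.

(* If [x1] were closer to [1] then [y (v - mu (1 - x) y)] would be nondecreasing on
   [x1, 1], although it is positive at [x1] and equal to [- a y^2] at [1]. *)
Lemma maxpt_p_lower (a b N : R) y v Y x0 Rr x1 : jsol a b N y v Y -> centre a b N x0 Rr ->
  maxpt y x1 -> x0 <= x1 -> 1 <= 2 * ((1 - x1 ^+ 2) * N ^+ 2 * Rr).
Proof.
move=> S C M x01; have hv := maxpt_crit S M.
case: C => [[R0 R1 NR r1 r2] hW]; case: M => x1I y0 _.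
have p0 := p_gt0 x1I; case/andP: (x1I) => x1a x1b.
have N1 : 1 <= N by have := js_N S; have := js_a S; have := js_b S; clear; lra.
have N2R : 1 <= N ^+ 2 * Rr.
  by rewrite expr2 -mulrA (le_trans NR)// ler_peMl// (le_trans _ NR).
have [xl|xl] := ltP x1 (-1/2).
  have h1 : Rr <= 1 - x1 ^+ 2.
    have : 1 * (1 + x0) <= (1 - x1) * (1 + x1) by apply: ler_pM; move: R0 r2 xl x01; clear; lra.
    by move: r2; clear; lra.
  have h2 : Rr * (N ^+ 2 * Rr) <= (1 - x1 ^+ 2) * (N ^+ 2 * Rr).
    by rewrite ler_wpM2r// mulr_ge0 ?sqr_ge0 ?ltW.
  have h3 : 1 <= (N * Rr) ^+ 2 by rewrite exprn_ege1.
  by move: h2 h3; clear; lra.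
have [xm|xm] := leP x1 (1/2).
  have h1 : 3/4 <= 1 - x1 ^+ 2 by move: xl xm; clear; nra.
  have h2 : 3/4 * 1 <= (1 - x1 ^+ 2) * (N ^+ 2 * Rr).
    by apply: ler_pM => //; clear; lra.
  by move: h2; clear; lra.
rewrite leNgt; apply/negP => hneg.
have m0 : 0 < 1 - x1 by move: x1b; clear; lra.
(* With this [mu], [y D] equals [y^2 (x1/2 - 1/8) > 0] at [x1]. The derivative is nonnegative
   because [mu (1 - z^2) >= 3/2 mu (1 - z)], the square costs [1/8 mu (1 - z)], and the negated
   claim bounds [Wt] by the remaining [11/8 mu (1 - z)]. *)
pose mu := (8 * (1 - x1))^-1.
have mu0 : 0 < mu by rewrite invr_gt0 mulr_gt0.
have mu1 : mu * (1 - x1) = 1 / 8 by rewrite /mu; field; rewrite gt_eqF.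
have muR : N ^+ 2 / 2 * Rr <= 11/8 * mu.
  have h : N ^+ 2 * Rr * ((1 - x1) * (1 + x1)) < 1/2 by move: hneg; clear; lra.
  have h2 : N ^+ 2 * Rr * ((1 - x1) * (3/2)) < 1/2.
    apply: le_lt_trans h; rewrite ler_wpM2l//; first by rewrite mulr_ge0 ?sqr_ge0 ?ltW.
    by rewrite ler_wpM2l ?(ltW m0)//; move: xm; clear; lra.
  rewrite -(@ler_pM2r _ (1 - x1))// -[leRHS]mulrA mu1.
  by move: h2; clear; lra.
pose D x := v x - mu * (1 - x) * y x.
have cy := contI_sub (js_cy S) (ltW x1a) (lexx _).
have cv := contI_sub (js_cv S) (ltW x1a) (lexx _).
have : y x1 * D x1 <= y 1 * D 1.
  apply: (@le_of_deriv _ (fun x => y x * D x)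
     (fun x => (D x ^+ 2 + y x ^+ 2 * (mu * (1 - x ^+ 2) - (mu * (1 - x)) ^+ 2 - Wt a b N x)) / (1 - x ^+ 2))).
  - exact: ltW.
  - by rewrite /D; ctn.
  - move=> z /andP[z1 zx]; have zI : -1 < z < 1 by rewrite (lt_trans x1a z1).
    have hy := js_dy S zI; have hv' := js_dv S zI; have pz := p_gt0 zI.
    by rewrite /D; der; rewrite /=; field; rewrite gt_eqF.
  - move=> z /andP[z1 zx]; have zI : -1 < z < 1 by rewrite (lt_trans x1a z1).
    have pz := p_gt0 zI; rewrite divr_ge0 ?(ltW pz)// addr_ge0 ?sqr_ge0// mulr_ge0 ?sqr_ge0//.
    have z0 : 0 < 1 - z by move: zx; clear; lra.
    have h1 : Wt a b N z <= N ^+ 2 / 2 * Rr * (1 - z).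
      apply: (@le_trans _ _ (Wh a b N z)); first by rewrite /Wt gerBl divr_ge0// ltW.
      rewrite hW.
      have -> : N ^+ 2 / 4 * (Rr ^+ 2 - (z - x0) ^+ 2) = N ^+ 2 / 2 * ((Rr - (z - x0)) * ((Rr + (z - x0)) / 2)) by field.
      have -> : N ^+ 2 / 2 * Rr * (1 - z) = N ^+ 2 / 2 * ((1 - z) * Rr) by ring.
      rewrite ler_wpM2l ?divr_ge0 ?sqr_ge0//.
      have [h|h] := leP (Rr - (z - x0)) 0.
        apply: (@le_trans _ _ 0); last by rewrite mulr_ge0 ?ltW.
        by rewrite mulr_le0_ge0//; move: h R0; clear; lra.
      by apply: ler_pM; move: h r1 z1 x01 R0; clear; lra.
    have h2 : (mu * (1 - z)) ^+ 2 <= mu * (1 - z) * (1/8).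
      have h0 : mu * (1 - z) <= 1/8.
        by rewrite -mu1 ler_wpM2l ?(ltW mu0)//; move: z1; clear; lra.
      by rewrite expr2 ler_wpM2l// mulr_ge0// ltW.
    have h3 : N ^+ 2 / 2 * Rr * (1 - z) <= 11/8 * mu * (1 - z) by rewrite ler_wpM2r// ltW.
    have h4 : mu * (1 - z) * (3/2) <= mu * (1 - z) * (1 + z).
      by rewrite ler_wpM2l// ?mulr_ge0 ?(ltW mu0) ?(ltW z0)//; move: xm z1; clear; lra.
    by move: h1 h2 h3 h4; clear; lra.
have -> : y 1 * D 1 = - (a * y 1 ^+ 2) by rewrite /D (js_v1 S); ring.
have -> : y x1 * D x1 = y x1 ^+ 2 * (x1 / 2 - 1 / 8) by rewrite /D hv mu1; field.
have h1 : 0 <= a * y 1 ^+ 2 by rewrite mulr_ge0 ?sqr_ge0 ?(js_a S).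
have h2 : 0 < y x1 ^+ 2 * (x1 / 2 - 1/8).
  by rewrite mulr_gt0 ?exprn_even_gt0//; move: xm; clear; lra.
by move: h1 h2; clear; lra.
Qed.

(** Maximality of [p y^4] gives [|y| <= 3/2 |y x1|] in advance wherever [p >= p1 / 2]. Then
    [v' = - Wt y / p] and the critical value of [v] keep [|v|] below [(1/2 + 3/8) om |y x1|], and
    [y' = v / p] lets [y] drop by at most [7/32 |y x1|]. So [y^2] is at least half its value at [x1]
    over a length [p1 / (8 om)]. *)
Lemma local_mass (a b N : R) y v Y x1 om : jsol a b N y v Y -> maxpt y x1 -> 1 <= om ->
  (forall x, x1 - (1 - x1 ^+ 2) / (8 * om) <= x <= x1 -> `|Wt a b N x| <= om ^+ 2) ->
  -1 < x1 - (1 - x1 ^+ 2) / (8 * om) /\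
  (1 - x1 ^+ 2) / (16 * om) * y x1 ^+ 2 <= Y x1 - Y (x1 - (1 - x1 ^+ 2) / (8 * om)).
Proof.
move=> S M om1 hWt; have hv1 := maxpt_crit S M; case: M => x1I y0 hmax.
have p0 := p_gt0 x1I; case/andP: (x1I) => x1a x1b.
set p1 := 1 - x1 ^+ 2 in p0 hmax hWt *.
have om0 : 0 < om by apply: lt_le_trans om1.
set len := p1 / (8 * om) in hWt *.
have len0 : 0 < len by rewrite divr_gt0// mulr_gt0.
have lenom : len * om = p1 / 8 by rewrite /len; field; rewrite gt_eqF.
have len8 : len <= p1 / 8 by rewrite -lenom ler_peMr// ltW.
have xl : -1 < x1 - len.
  have : p1 <= (1 + x1) * 2.
    have -> : p1 = (1 + x1) * (1 - x1) by rewrite /p1; ring.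
    by rewrite ler_wpM2l; move: x1a; clear; lra.
  by move: len8 x1a; clear; lra.
split=> //.
have y10 : 0 < `|y x1| by rewrite normr_gt0.
have inI x : x1 - len <= x <= x1 -> -1 < x < 1.
  by move=> /andP[h1 h2]; rewrite (lt_le_trans xl h1) (le_lt_trans h2 x1b).
have hp x : x1 - len <= x <= x1 -> p1 / 2 <= 1 - x ^+ 2.
  move=> hx; have := inI x hx; move: hx => /andP[h1 h2] /andP[h3 h4].
  have : (x1 - x) * (x1 + x) <= (x1 - x) * 2.
    by rewrite ler_wpM2l; move: h1 h2 h3 h4 x1a x1b; clear; lra.
  have : (x1 - x) * (-2) <= (x1 - x) * (x1 + x).
    by rewrite ler_wpM2l; move: h1 h2 h3 h4 x1a x1b; clear; lra.
  by rewrite /p1 in len8 p0 *; move: len8 p0 h1 h2; clear; lra.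
have hy x : x1 - len <= x <= x1 -> `|y x| <= 3/2 * `|y x1|.
  move=> hx; have hpx := hp x hx; have /andP[/ltW xa /ltW xb] := inI x hx.
  have hm := hmax x; rewrite xa xb in hm; move: (hm isT) => {hm}hm.
  rewrite -(@ler_pXn2r _ 4)// ?nnegrE ?mulr_ge0//.
  rewrite exprMn -!normrX !ger0_norm ?exprn_even_ge0//.
  have h1 : p1 / 2 * y x ^+ 4 <= p1 * y x1 ^+ 4.
    by apply: le_trans hm; rewrite ler_wpM2r// exprn_even_ge0.
  have h2 : p1 * y x ^+ 4 <= p1 * (2 * y x1 ^+ 4) by move: h1; clear; lra.
  have h3 : y x ^+ 4 <= 2 * y x1 ^+ 4 by rewrite -(ler_pM2l p0).
  have h4 : 0 <= y x1 ^+ 4 by rewrite exprn_even_ge0.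
  by move: h3 h4; clear; lra.
have sub x : x1 - len <= x <= x1 -> (-1 <= x /\ x1 <= 1).
  by move=> /inI /andP[/ltW h1 _]; rewrite (ltW x1b).
have hv x : x1 - len <= x <= x1 -> `|v x| <= 7/8 * om * `|y x1|.
  move=> hx; have [xa xb] := sub x hx; case/andP: (hx) => hx1 hx2.
  have hK : `|v x1 - v x| <= 3 * om ^+ 2 * `|y x1| / p1 * (x1 - x).
    apply: (@mean_value _ v (fun x => - Wt a b N x * y x / (1 - x ^+ 2))) => //.
    - exact: contI_sub (js_cv S) xa xb.
    - move=> z /andP[z1 z2]; apply: (js_dv S).
      by apply: inI; rewrite (le_trans hx1 (ltW z1)) ltW.
    - move=> z /andP[z1 z2].
      have hz : x1 - len <= z <= x1 by rewrite (le_trans hx1 (ltW z1)) ltW.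
      have pz : 0 < 1 - z ^+ 2 by apply: p_gt0; apply: inI.
      rewrite normrM normrM normrN normfV (gtr0_norm pz) ler_pdivrMr//.
      apply: (@le_trans _ _ (om ^+ 2 * (3/2 * `|y x1|))).
        by apply: ler_pM => //; [exact: hWt|exact: hy].
      have h1 : 0 <= 3 * om ^+ 2 * `|y x1| / p1 by pos.
      have := ler_wpM2l h1 (hp z hz).
      have -> : 3 * om ^+ 2 * `|y x1| / p1 * (p1 / 2) = om ^+ 2 * (3/2 * `|y x1|).
        by field; rewrite gt_eqF.
      by [].
  have hK' : 3 * om ^+ 2 * `|y x1| / p1 * (x1 - x) <= 3/8 * om * `|y x1|.
    have h1 : 0 <= 3 * om ^+ 2 * `|y x1| / p1 by pos.
    have h2 : x1 - x <= len by move: hx1; clear; lra.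
    apply: (le_trans (ler_wpM2l h1 h2)); rewrite le_eqVlt; apply/orP; left; apply/eqP.
    by rewrite /len; field; rewrite !gt_eqF.
  have h3 : `|v x1| <= 1/2 * om * `|y x1|.
    have -> : v x1 = x1 / 2 * y x1 by rewrite hv1; field.
    rewrite normrM ler_wpM2r// ler_norml; apply/andP; split; move: x1a x1b om1; clear; lra.
  have -> : v x = v x1 - (v x1 - v x) by rewrite opprB addrC subrK.
  apply: (le_trans (ler_normB _ _)).
  by move: (le_trans hK hK') h3; clear; lra.
have hyl x : x1 - len <= x <= x1 -> 3/4 * `|y x1| <= `|y x|.
  move=> hx; have [xa xb] := sub x hx; case/andP: (hx) => hx1 hx2.
  have hK : `|y x1 - y x| <= 7/4 * om * `|y x1| / p1 * (x1 - x).
    apply: (@mean_value _ y (fun x => v x / (1 - x ^+ 2))) => //.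
    - exact: contI_sub (js_cy S) xa xb.
    - move=> z /andP[z1 z2]; apply: (js_dy S).
      by apply: inI; rewrite (le_trans hx1 (ltW z1)) ltW.
    - move=> z /andP[z1 z2].
      have hz : x1 - len <= z <= x1 by rewrite (le_trans hx1 (ltW z1)) ltW.
      have pz : 0 < 1 - z ^+ 2 by apply: p_gt0; apply: inI.
      rewrite normrM normfV (gtr0_norm pz) ler_pdivrMr//.
      apply: (le_trans (hv z hz)).
      have h1 : 0 <= 7/4 * om * `|y x1| / p1 by pos.
      have := ler_wpM2l h1 (hp z hz).
      have -> : 7/4 * om * `|y x1| / p1 * (p1 / 2) = 7/8 * om * `|y x1|.
        by field; rewrite gt_eqF.
      by [].
  have hK' : 7/4 * om * `|y x1| / p1 * (x1 - x) <= 7/32 * `|y x1|.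
    have h1 : 0 <= 7/4 * om * `|y x1| / p1 by pos.
    have h2 : x1 - x <= len by move: hx1; clear; lra.
    apply: (le_trans (ler_wpM2l h1 h2)); rewrite le_eqVlt; apply/orP; left; apply/eqP.
    by rewrite /len; field; rewrite !gt_eqF.
  have := ler_normD (y x) (y x1 - y x); rewrite addrC subrK.
  by move: (le_trans hK hK') y10; clear; lra.
have : (p1 / (16 * om) * y x1 ^+ 2) <= (Y x1 - y x1 ^+ 2 / 2 * x1) - (Y (x1 - len) - y x1 ^+ 2 / 2 * (x1 - len)) + p1 / (16 * om) * y x1 ^+ 2.
  rewrite lerDr subr_ge0.
  apply: (@le_of_deriv _ (fun x => Y x - y x1 ^+ 2 / 2 * x) (fun x => y x ^+ 2 - y x1 ^+ 2 / 2)).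
  - by move: len0; clear; lra.
  - have cY := contI_sub (js_cY S) (ltW xl) (ltW x1b).
    by ctn.
  - move=> z /andP[z1 z2]; have hY : is_derive z 1 Y (y z ^+ 2).
      by apply: (js_dY S); apply: inI; rewrite !ltW.
    by der; rewrite /=; ring.
  - move=> z /andP[z1 z2]; have h : 3/4 * `|y x1| <= `|y z| by apply: hyl; rewrite !ltW.
    have : (3/4 * `|y x1|) ^+ 2 <= `|y z| ^+ 2 by rewrite ler_pXn2r// nnegrE mulr_ge0.
    by rewrite exprMn !real_normK ?num_real//; move: (sqr_ge0 (y x1)); clear; lra.
have -> : Y x1 - y x1 ^+ 2 / 2 * x1 - (Y (x1 - len) - y x1 ^+ 2 / 2 * (x1 - len)) + p1 / (16 * om) * y x1 ^+ 2 = Y x1 - Y (x1 - len).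
  by rewrite /len; field; rewrite gt_eqF.
by [].
Qed.

End MaximumPoint.

(** * The multiplier *)

Section Multiplier.
Context {R : realType}.

Definition mrho (c del x : R) := Num.sqrt ((c - x) ^+ 2 + del ^+ 2).
Definition mq (c del x : R) := (mrho c del x)^-1.
Definition mg (c del x : R) := (Num.sqrt (c - x + mrho c del x))^-1.

Lemma mrho_sqr (c del x : R) : 0 < del -> mrho c del x ^+ 2 = (c - x) ^+ 2 + del ^+ 2.
Proof. move=> del0; by rewrite sqr_sqrtr// addr_ge0 ?sqr_ge0. Qed.

Lemma mrho_gt0 (c del x : R) : 0 < del -> 0 < mrho c del x.
Proof. move=> del0; by rewrite sqrtr_gt0 ltr_wpDl ?sqr_ge0// exprn_gt0. Qed.

Lemma mrho_gt (c del x : R) : 0 < del -> 0 < c - x + mrho c del x.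
Proof.
move=> del0; have h : `|c - x| < mrho c del x.
  rewrite -(@ltr_pXn2r _ 2)// ?nnegrE ?(ltW (mrho_gt0 c x del0))//.
  by rewrite real_normK ?num_real// mrho_sqr// ltrDl exprn_gt0.
by move: h; rewrite ltr_norml => /andP[]; rewrite ltrNl -subr_gt0 opprK addrC.
Qed.

Lemma mg_gt0 (c del x : R) : 0 < del -> 0 < mg c del x.
Proof. move=> del0; by rewrite invr_gt0 sqrtr_gt0 mrho_gt. Qed.

Lemma mg_sqr (c del x : R) : 0 < del -> mg c del x ^+ 2 * (c - x + mrho c del x) = 1.
Proof.
move=> del0; have h := mrho_gt c x del0.
by rewrite exprVn sqr_sqrtr ?(ltW h)// mulVf// gt_eqF.
Qed.

Lemma mq_mrho (c del x : R) : 0 < del -> mq c del x * mrho c del x = 1.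
Proof. move=> del0; by rewrite mulVf// gt_eqF//; exact: mrho_gt0. Qed.

Lemma deriv_mrho (c del x : R) : 0 < del -> is_derive x 1 (mrho c del) (- ((c - x) * mq c del x)).
Proof.
move=> del0; have h : is_derive x 1 (fun x => (c - x) ^+ 2 + del ^+ 2) (- (2 * (c - x))).
  by der; rewrite /=; ring.
have h0 : 0 < (c - x) ^+ 2 + del ^+ 2 by rewrite ltr_wpDl ?sqr_ge0// exprn_gt0.
have D : is_derive x 1 (mrho c del) (- (2 * (c - x)) / (2 * mrho c del x)).
  exact: (@deriv_sqrt _ (fun x => (c - x) ^+ 2 + del ^+ 2) x _ h0 h).
apply: (is_derive_eq D); rewrite /mq.
by field; rewrite gt_eqF//; exact: mrho_gt0.
Qed.

Lemma deriv_mq (c del x : R) : 0 < del -> is_derive x 1 (mq c del) ((c - x) * mq c del x ^+ 3).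
Proof.
move=> del0; have h0 := mrho_gt0 c x del0.
have h1 : mrho c del x != 0 by rewrite gt_eqF.
have D : is_derive x 1 (mq c del) (- - ((c - x) * mq c del x) / mrho c del x ^+ 2).
  exact: (deriv_inv h1 (deriv_mrho c x del0)).
apply: (is_derive_eq D).
by rewrite /mq; field; rewrite gt_eqF.
Qed.

(** The logarithmic derivative of [s + rho] is exactly [- 1 / rho]. Together with [mq' = s mq^3]
    this keeps every derivative of the multiplier equal to [mg] times a polynomial in [x - x0], [s]
    and [mq]. *)
Lemma deriv_mg (c del x : R) : 0 < del -> is_derive x 1 (mg c del) (mg c del x * mq c del x / 2).
Proof.
move=> del0; have h := deriv_mrho c x del0; have h1 : is_derive x 1 (fun x => c - x + mrho c del x) (- ((c - x + mrho c del x) * mq c del x)).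
  by have e := mq_mrho c x del0; der; rewrite /=; move: e; clear; lra.
have h0 := mrho_gt c x del0; have h2 : 0 < Num.sqrt (c - x + mrho c del x) by rewrite sqrtr_gt0.
have h3 : Num.sqrt (c - x + mrho c del x) != 0 by rewrite gt_eqF.
set w := Num.sqrt (c - x + mrho c del x) in h2 h3.
have D : is_derive x 1 (mg c del) (- (- ((c - x + mrho c del x) * mq c del x) / (2 * w)) / w ^+ 2).
  exact: (@deriv_inv _ (fun x => Num.sqrt (c - x + mrho c del x)) x _ h3 (@deriv_sqrt _ (fun x => c - x + mrho c del x) x _ h0 h1)).
apply: (is_derive_eq D).
have e : c - x + mrho c del x = w ^+ 2 by rewrite sqr_sqrtr// ltW.
by rewrite e /mg -/w; field; rewrite gt_eqF.
Qed.



Lemma multiplier_exists (a b N : R) y v Y x0 Rr x1 del d r :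
  jsol a b N y v Y -> centre a b N x0 Rr -> -1 < x1 < 1 ->
  0 < del -> 0 < d -> d ^+ 2 = del -> 0 < r -> r ^+ 2 = Rr -> 2 * del <= Rr ->
  `|x0 + Rr - x1| <= 2 * del ->
  24 * 1000 * (1 - x1 ^+ 2) ^+ 2 <= N ^+ 2 / 4 * Rr * del ^+ 3 ->
  24 * 1000 <= N ^+ 2 / 4 * Rr * del ->
  24 * 1000 <= N * (N ^+ 2 / 4 * Rr * del ^+ 2) ->
  exists I G : R -> R,
  [/\ contI (-1) 1 I, I (-1) = 0, I 1 = 0 &
      forall x : R, -1 < x < 1 -> is_derive x 1 I (G x * y x ^+ 2)] /\
  forall x, -1 < x < 1 -> G x <= 3300 * (N ^+ 2 / 4) * r ^+ 3 /\
    (x0 + Rr - del <= x ->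
     G x <= 3300 * (N ^+ 2 / 4) * r ^+ 3 - N ^+ 2 / 4 * (x - x0) ^+ 2 / (16 * d)).
Proof.
move=> S C x1I del0 d0 hd r0 hr hdR hs1 H2 H3 H4.
case: (C) => [[R0 R1 NR r1 r2] hW].
pose c := x0 + Rr; pose g := mg c del; pose q := mq c del.
pose f x := (x - x0) * g x.
pose f1 x := g x + (x - x0) * (g x * q x / 2).
pose f2 x := g x * q x + (x - x0) * (g x * (q x ^+ 2 / 4 + (c - x) * q x ^+ 3 / 2)).
pose f3 x := g x * (3/4 * q x ^+ 2 + 3/2 * (c - x) * q x ^+ 3)
   + (x - x0) * (g x * (- (3/8) * q x ^+ 3 + 3/4 * (c - x) * q x ^+ 4 + 3/2 * (c - x) ^+ 2 * q x ^+ 5)).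
have dg (x : R) : is_derive x 1 g (g x * q x / 2) := deriv_mg c x del0.
have dq (x : R) : is_derive x 1 q ((c - x) * q x ^+ 3) := deriv_mq c x del0.
have df (x : R) : is_derive x 1 f (f1 x).
  by have h := dg x; have h' := dq x; rewrite /f; der; rewrite /f1 /=; field.
have df1 (x : R) : is_derive x 1 f1 (f2 x).
  by have h := dg x; have h' := dq x; rewrite /f1; der; rewrite /f2 /=; field.
have df2 (x : R) : is_derive x 1 f2 (f3 x).
  by have h := dg x; have h' := dq x; rewrite /f2; der; rewrite /f3 /=; field.
have cf : contI (-1) 1 f by apply: contI_deriv => x _; exists (f1 x); exact: df.
have cf1 : contI (-1) 1 f1 by apply: contI_deriv => x _; exists (f2 x); exact: df1.
have cf2 : contI (-1) 1 f2 by apply: contI_deriv => x _; exists (f3 x); exact: df2.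
exists (fun x => f x * (v x ^+ 2 + Wt a b N x * y x ^+ 2)
  - (1 - x ^+ 2) * f1 x * (y x * v x)
  + 1 / 2 * ((1 - x ^+ 2) * ((1 - x ^+ 2) * f2 x - 2 * x * f1 x)) * y x ^+ 2).
exists (fun x => 2 * f1 x * Wt a b N x + f x * (- (N ^+ 2 / 2) * x - a ^+ 2 / 2 + b ^+ 2 / 2 + x / 2)
  + 1 / 2 * ((1 - x ^+ 2) ^+ 2 * f3 x - 6 * x * (1 - x ^+ 2) * f2 x + (6 * x ^+ 2 - 2) * f1 x)).
split; first split.
- by have cy := js_cy S; have cv := js_cv S; rewrite /Wt /Wh; ctn.
- by rewrite (js_vm1 S) /Wt /Wh; field.
- by rewrite (js_v1 S) /Wt /Wh; field.
- by move=> x xI; exact: (energy_deriv S xI (df x) (df1 x) (df2 x)).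
move=> x xI /=; have p0 := p_gt0 xI; case/andP: (xI) => xa xb.
set G := (X in X <= _).
pose s := c - x; pose rho := mrho c del x.
pose M := N ^+ 2 / 4 * g x * (2 * (1 + (x - x0) * q x / 2) * (s * (Rr + (x - x0))) - 2 * (x - x0) ^+ 2).
have q0 : 0 < q x by rewrite invr_gt0 mrho_gt0.
have g0 : 0 < g x by exact: mg_gt0.
have hsrho : `|s * q x| <= 1.
  rewrite normrM (gtr0_norm q0) -(mq_mrho c x del0) [leRHS]mulrC ler_wpM2r ?(ltW q0)//.
  rewrite -(@ler_pXn2r _ 2)// ?nnegrE ?(ltW (mrho_gt0 c x del0))//.
  by rewrite real_normK ?num_real// mrho_sqr// lerDl sqr_ge0.
have hE : `|G - M| <= 5 * g x * (1 + `|(x - x0) * q x|) * (1 + ((1 - x ^+ 2) * q x) ^+ 2).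
  apply: (@multiplier_error _ x (x - x0) (g x) (s * q x) ((x - x0) * q x) ((1 - x ^+ 2) * q x) (1 - x ^+ 2)) => //.
  - by rewrite ler_norml !ltW.
  - by rewrite ler_norml; apply/andP; split; move: xa xb r1 r2 R0; clear; lra.
  - by rewrite (ltW p0) gerBl sqr_ge0.
  - by rewrite mulr_ge0 ?ltW.
  - exact: ltW.
  - rewrite /G /M /Wt hW /f /f1 /f2 /f3 /s /c.
    (* Comparing the two forms of [Wh] at [1] and [-1] gives [b^2 - a^2 = N^2 x0]. *)
    have -> : - (N ^+ 2 / 2) * x - a ^+ 2 / 2 + b ^+ 2 / 2 + x / 2 = - (N ^+ 2 / 2) * (x - x0) + x / 2.
      have := hW 1; have := hW (-1); rewrite /Wh.
      have -> : N ^+ 2 / 4 * (Rr ^+ 2 - (1 - x0) ^+ 2) = N ^+ 2 / 4 * (Rr ^+ 2 - (-1 - x0) ^+ 2) + N ^+ 2 * x0 by field.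
      by move=> <- h; move: h; clear; lra.
    by field.
have ctx : mult_ctx (N ^+ 2 / 4) N Rr r del d (x - x0) s rho (q x) (g x) (1 - x ^+ 2) (1 - x1 ^+ 2) (c - x1) M (G - M).
  split=> //.
  - by have := js_N S; have := js_a S; have := js_b S; clear; lra.
  - by rewrite /s /c; ring.
  - exact: mrho_gt0.
  - exact: mrho_sqr.
  - exact: mq_mrho.
  - exact: mg_sqr.
  - exact: ltW (p_gt0 x1I).
  - exact: ltW.
  - case/andP: x1I => x1a x1b.
    have -> : s - (c - x1) = x1 - x by rewrite /s; ring.
    have : (x1 - x) * (x1 + x) <= `|x1 - x| * 2.
      apply: (le_trans (ler_norm _)); rewrite normrM ler_wpM2l//.
      by rewrite ler_norml; apply/andP; split; move: x1a x1b xa xb; clear; lra.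
    by clear; lra.
have eG : G = M + (G - M) by rewrite addrC subrK.
have near (h : Rr <= 2 * (x - x0)) : s <= del -> _ := multiplier_near ctx h.
have Kpos : 0 <= N ^+ 2 / 4 * (x - x0) ^+ 2 / (16 * d) by pos.
split=> [|hx]; rewrite -/G eG.
  have [h|h] := leP (2 * (x - x0)) Rr; first exact: multiplier_far ctx h.
  have [h'|h'] := leP del s; first exact: multiplier_mid ctx (ltW h) h'.
  apply: (le_trans (near (ltW h) (ltW h'))).
  by rewrite gerBl.
apply: near; first by move: hx hdR; clear; lra.
by rewrite /s /c; move: hx; clear; lra.
Qed.

End Multiplier.

(** * Estimates at the maximum point *)

Section Estimates.
Context {R : realType}.

Lemma jsol_N1 (a b N : R) y v Y : jsol a b N y v Y -> 1 <= N.
Proof. by move=> S; have := js_N S; have := js_a S; have := js_b S; clear; lra. Qed.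

Lemma mass_mono (a b N : R) y v Y x z : jsol a b N y v Y -> -1 <= x -> x <= z -> z <= 1 ->
  Y x <= Y z.
Proof.
move=> S h1 h2 h3; apply: (@le_of_deriv _ Y (fun x => y x ^+ 2)) => //.
- exact: contI_sub (js_cY S) h1 h3.
- by move=> t /andP[t1 t2]; apply: (js_dY S); rewrite (le_lt_trans h1 t1) (lt_le_trans t2 h3).
- by move=> t _; exact: sqr_ge0.
Qed.

Lemma energy0_deriv (a b N : R) y v Y x0 Rr (x : R) : jsol a b N y v Y -> centre a b N x0 Rr ->
  -1 < x < 1 ->
  is_derive x 1 (fun x => v x ^+ 2 + Wt a b N x * y x ^+ 2)
    ((- (N ^+ 2 / 2) * (x - x0) + x / 2) * y x ^+ 2).
Proof.
move=> S [_ hW] hx; have hy := js_dy S hx; have hv := js_dv S hx.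
have -> : - (N ^+ 2 / 2) * (x - x0) + x / 2 = - (N ^+ 2 / 2) * x - a ^+ 2 / 2 + b ^+ 2 / 2 + x / 2.
  have := hW 1; have := hW (-1); rewrite /Wh.
  have -> : N ^+ 2 / 4 * (Rr ^+ 2 - (1 - x0) ^+ 2) = N ^+ 2 / 4 * (Rr ^+ 2 - (-1 - x0) ^+ 2) + N ^+ 2 * x0 by field.
  by move=> <- h; move: h; clear; lra.
have p0 := p_gt0 hx; rewrite /Wt /Wh in hv *.
by der; rewrite /=; field; rewrite gt_eqF.
Qed.

(** Both parts rest on [I] vanishing at the ends, that is, on the integral of [G y^2] being [0],
    while [G <= K]: the penalty on the tail can then cost at most [K] times the total mass. The
    second part adds a multiple of [K Y - I] to [v^2 + Wt y^2], which vanishes at [1]. The mass of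
    the tail alone would not do there, since the derivative carries the factor [x - x0], which is
    not bounded by [Rr]. *)
Lemma multiplier_consequences (a b N : R) y v Y x0 Rr x1 del d r :
  jsol a b N y v Y -> centre a b N x0 Rr -> -1 < x1 < 1 ->
  0 < del -> 0 < d -> d ^+ 2 = del -> 0 < r -> r ^+ 2 = Rr -> 2 * del <= Rr ->
  `|x0 + Rr - x1| <= 2 * del ->
  24 * 1000 * (1 - x1 ^+ 2) ^+ 2 <= N ^+ 2 / 4 * Rr * del ^+ 3 ->
  24 * 1000 <= N ^+ 2 / 4 * Rr * del ->
  24 * 1000 <= N * (N ^+ 2 / 4 * Rr * del ^+ 2) ->
  Y 1 - Y (x0 + Rr - del) <= 64 * 3300 * d / r * (Y 1 - Y (-1)) /\
  forall x2, x0 + Rr - del <= x2 < 1 ->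
    v x2 ^+ 2 + Wt a b N x2 * y x2 ^+ 2 <= 192 * 3300 * (N ^+ 2 / 4) * d * r * (Y 1 - Y (-1)).
Proof.
move=> S C x1I del0 d0 hd r0 hr hdR hs1 H2 H3 H4.
have [I [G [[cI Im1 I1 dI] hG]]] := multiplier_exists S C x1I del0 d0 hd r0 hr hdR hs1 H2 H3 H4.
clear hs1 H2 H3 H4 x1I.
have [[R0 R1 NR q1 q2] hW] := C; have N1 := jsol_N1 S.
have N0 : 0 < N := lt_le_trans ltr01 N1.
have [K eK] : exists K, K = 3300 * (N ^+ 2 / 4) * r ^+ 3 by eexists; reflexivity.
rewrite -eK in hG; set xd := x0 + Rr - del in hG *.
have xd1 : -1 < xd by move: q2 hdR del0 R0; rewrite /xd; clear; lra.
have xd2 : xd < 1 by move: q1 del0; rewrite /xd; clear; lra.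
have IK x : -1 <= x -> x < 1 -> I x <= K * (Y x - Y (-1)).
  move=> h1 h2; have h3 := ltW h2.
  have : K * Y (-1) - I (-1) <= K * Y x - I x.
    apply: (@le_of_deriv _ (fun x => K * Y x - I x) (fun x => (K - G x) * y x ^+ 2)) => //.
    - apply: (@contI_sub _ (-1) 1) => //; have cY := js_cY S.
      by ctn.
    - move=> z /andP[z1 z2]; have zI : -1 < z < 1 by rewrite z1 (lt_trans z2).
      have hY := js_dY S zI; have hI := dI z zI.
      by der; rewrite /=; ring.
    - move=> z /andP[z1 z2]; have zI : -1 < z < 1 by rewrite z1 (lt_trans z2).
      by rewrite mulr_ge0 ?sqr_ge0// subr_ge0; case: (hG z zI).
  by rewrite Im1; clear; lra.
have Gtail x : xd <= x -> x < 1 -> G x <= K - N ^+ 2 / 4 * (x - x0) ^+ 2 / (16 * d).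
  move=> h1 h2; have xI : -1 < x < 1 by rewrite (lt_le_trans xd1).
  by have [_] := hG x xI; exact.
have xih x : xd <= x -> Rr <= 2 * (x - x0) by rewrite /xd; move: hdR; clear; lra.
split.
  (* A lower bound for [K - G] on the tail, obtained from [x - x0 >= Rr / 2]. *)
  pose ka := N ^+ 2 / 4 * Rr ^+ 2 / (64 * d).
  have ka0 : 0 < ka by rewrite divr_gt0 ?mulr_gt0 ?exprn_gt0.
  have h : (K - ka) * Y xd - I xd <= (K - ka) * Y 1 - I 1.
    apply: (@le_of_deriv _ (fun x => (K - ka) * Y x - I x) (fun x => (K - ka - G x) * y x ^+ 2)).
    - exact: ltW.
    - apply: (@contI_sub _ (-1) 1 xd) => //; last exact: ltW.
      by have cY := js_cY S; ctn.
    - move=> z /andP[z1 z2]; have zI : -1 < z < 1 by rewrite z2 (lt_trans xd1).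
      have hY := js_dY S zI; have hI := dI z zI.
      by der; rewrite /=; ring.
    - move=> z /andP[z1 z2].
      rewrite mulr_ge0 ?sqr_ge0//; have h1 := Gtail z (ltW z1) z2; have h2 := xih z (ltW z1).
      have h3 : Rr ^+ 2 <= 4 * (z - x0) ^+ 2.
        have -> : 4 * (z - x0) ^+ 2 = (2 * (z - x0)) ^+ 2 by ring.
        rewrite ler_pXn2r// nnegrE; first exact: ltW.
        exact: le_trans (ltW R0) h2.
      have h4 : ka <= N ^+ 2 / 4 * (z - x0) ^+ 2 / (16 * d).
        have -> : ka = N ^+ 2 / 4 * (Rr ^+ 2 / 4) / (16 * d) by rewrite /ka; field; rewrite gt_eqF.
        rewrite ler_wpM2r ?invr_ge0 ?mulr_ge0 ?(ltW d0)// ler_wpM2l ?divr_ge0 ?sqr_ge0//.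
        by move: h3; clear; lra.
      by move: h1 h4; clear; lra.
  have h1 := IK xd (ltW xd1) xd2.
  have h2 : ka * (Y 1 - Y xd) <= K * (Y 1 - Y (-1)) by move: h h1; rewrite I1; clear; lra.
  rewrite -(ler_pM2l ka0); apply: (le_trans h2); rewrite le_eqVlt; apply/orP; left; apply/eqP.
  by rewrite /ka eK -hr; field; rewrite !gt_eqF.
move=> x2 /andP[x2a x2b]; have x2c : -1 < x2 := lt_le_trans xd1 x2a.
(* With this factor [A (K - G) >= 12 Lam (x - x0)^2 / Rr >= 6 Lam (x - x0)], where [Lam = N^2 / 4].
   This outweighs the derivative [- 2 Lam (x - x0)], and the surplus covers [x / 2] because
   [N^2 Rr >= 1]. *)
pose A := 192 * d / Rr.
have A0 : 0 < A by apply: divr_gt0; [apply: mulr_gt0; [rewrite ltr0n|exact: d0]|exact: R0].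
have h : v x2 ^+ 2 + Wt a b N x2 * y x2 ^+ 2 + A * (K * Y x2 - I x2) <=
         v 1 ^+ 2 + Wt a b N 1 * y 1 ^+ 2 + A * (K * Y 1 - I 1).
  apply: (@le_of_deriv _ (fun x => v x ^+ 2 + Wt a b N x * y x ^+ 2 + A * (K * Y x - I x))
    (fun x => (- (N ^+ 2 / 2) * (x - x0) + x / 2 + A * (K - G x)) * y x ^+ 2)).
  - exact: ltW.
  - apply: (@contI_sub _ (-1) 1 x2) => //; last exact: ltW.
    by have cY := js_cY S; have cy := js_cy S; have cv := js_cv S; rewrite /Wt /Wh; ctn.
  - move=> z /andP[z1 z2]; have zI : -1 < z < 1 by rewrite z2 (lt_trans x2c).
    have hY := js_dY S zI; have hI := dI z zI; have hF := energy0_deriv S C zI.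
    have hYI : is_derive z 1 (fun x => A * (K * Y x - I x)) (A * (K - G z) * y z ^+ 2).
      by der; rewrite /=; ring.
    by apply: (is_derive_eq (deriv_add hF hYI)); ring.
  - move=> z /andP[z1 z2]; have zxd := le_trans x2a (ltW z1).
    rewrite mulr_ge0 ?sqr_ge0//; have h1 := Gtail z zxd z2; have h2 := xih z zxd.
    have h3 : A * (N ^+ 2 / 4 * (z - x0) ^+ 2 / (16 * d)) <= A * (K - G z).
      by rewrite ler_wpM2l ?(ltW A0)//; move: h1; clear; lra.
    have e3 : A * (N ^+ 2 / 4 * (z - x0) ^+ 2 / (16 * d)) = 12 * (N ^+ 2 / 4) * ((z - x0) ^+ 2 / Rr).
      by rewrite /A; field; rewrite !gt_eqF.
    have h4 : (z - x0) / 2 <= (z - x0) ^+ 2 / Rr.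
      rewrite ler_pdivlMr//; have := h2; have : 0 <= z - x0 by move: h2 R0; clear; lra.
      by move: (z - x0) => t t0 ht; have := ler_wpM2l t0 ht; clear; lra.
    have h5 := ler_wpM2l (mulr_ge0 (ler0n _ 12) (divr_ge0 (sqr_ge0 N) (ler0n _ 4))) h4.
    have h6 : 1 <= N ^+ 2 * Rr by rewrite expr2 -mulrA (le_trans NR)// ler_peMl// mulr_ge0 ?ltW.
    have h7 := ler_wpM2l (sqr_ge0 N) h2.
    have zb : -1 < z by rewrite (lt_trans x2c).
    by move: h3 h5 h6 h7 zb; rewrite e3; clear; lra.
have e1 : v 1 ^+ 2 + Wt a b N 1 * y 1 ^+ 2 = 0 by rewrite (js_v1 S) /Wt /Wh; field.
have h1 := IK x2 (ltW x2c) x2b.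
have h2 := ler_wpM2l (ltW A0) h1.
have -> : 192 * 3300 * (N ^+ 2 / 4) * d * r * (Y 1 - Y (-1)) = A * (K * (Y 1 - Y (-1))).
  by rewrite /A eK -hr; field; rewrite !gt_eqF.
by move: h h2; rewrite e1 I1; clear; lra.
Qed.

(** When the whole region between the turning points has width [O(L)], [Wt] is [O(k^2 N p1)] next to
    [x1], and comparing the local mass with the total mass is already enough. *)
Lemma case_wide (a b N : R) y v Y x0 Rr x1 L k :
  jsol a b N y v Y -> centre a b N x0 Rr -> maxpt y x1 -> x0 <= x1 ->
  1 <= k -> 0 < L -> L ^+ 2 * N = k ^+ 2 * (1 - x1 ^+ 2) -> Rr <= 4 * L ->
  (1 - x1 ^+ 2) * y x1 ^+ 4 <= 64 * 32 * k ^+ 2 * (Y 1 - Y (-1)) ^+ 2 * N.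
Proof.
move=> S C M x01 k1 L0 hL hRL.
have F1 := maxpt_p_lower S C M x01; have hWm := maxpt_Wh S C M x01.
have [[R0 R1 NR q1 q2] hW] := C; have N1 := jsol_N1 S.
have N0 : 0 < N := lt_le_trans ltr01 N1.
have [x1I y0 _] := M; have p0 := p_gt0 x1I.
set p1 := 1 - x1 ^+ 2 in hL F1 p0 *.
have k0 : 0 < k := lt_le_trans ltr01 k1.
(* Inserting [Rr <= 4 L] into the lower bound for [p1] and squaring eliminates [L] and leaves a
   bound for [(N p1)^3]. It ensures [Om >= 1]. *)
have Np : 1 <= 4 * k * (N * p1).
  have h1 : 1 <= 8 * p1 * N ^+ 2 * L.
    have h : 0 <= p1 * N ^+ 2 by pos.
    by have := ler_wpM2l h hRL; move: F1; clear; lra.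
  have h2 : 1 <= 64 * k ^+ 2 * (N * p1) ^+ 3.
    have -> : 64 * k ^+ 2 * (N * p1) ^+ 3 = (8 * p1 * N ^+ 2 * L) ^+ 2.
      have -> : (8 * p1 * N ^+ 2 * L) ^+ 2 = 64 * p1 ^+ 2 * N ^+ 3 * (L ^+ 2 * N) by ring.
      by rewrite hL; ring.
    by rewrite exprn_ege1.
  rewrite -(@expr_ge1 _ 3)//; last by pos.
  apply: (le_trans h2).
  have -> : (4 * k * (N * p1)) ^+ 3 = k * (64 * k ^+ 2 * (N * p1) ^+ 3) by ring.
  by rewrite ler_peMl//; pos.
(* Half of [Om] is [N^2 / 4 * (4 L)^2], the largest value that [Wh] can reach here. *)
pose Om := 8 * k ^+ 2 * (N * p1); have Om2k : 2 * k <= Om.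
  have := ler_wpM2l (ltW k0) Np; rewrite /Om; clear; lra.
have Om1 : 1 <= Om by move: Om2k k1; clear; lra.
have Om0 : 0 < Om := lt_le_trans ltr01 Om1.
pose om := Num.sqrt Om; have om2 : om ^+ 2 = Om by rewrite sqr_sqrtr// ltW.
have om0 : 0 < om by rewrite sqrtr_gt0.
have om1 : 1 <= om by rewrite -(@expr_ge1 _ 2)// ?om2// ltW.
have k2 : 1 <= k ^+ 2 by rewrite exprn_ege1.
have hWt x : x1 - p1 / (8 * om) <= x <= x1 -> `|Wt a b N x| <= om ^+ 2.
  move=> /andP[xa xb]; rewrite om2 /Wt.
  have len2 : N ^+ 2 / 4 * (p1 / (8 * om)) ^+ 2 <= Om / 4.
    have -> : N ^+ 2 / 4 * (p1 / (8 * om)) ^+ 2 = N * p1 / (64 * 32 * k ^+ 2).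
      by rewrite !exprMn exprVn exprMn om2 /Om; field; rewrite !gt_eqF.
    rewrite ler_pdivrMr; last by pos; rewrite mulr_gt0// exprn_gt0.
    rewrite /Om; have h : 0 <= N * p1 by pos.
    have := ler_wpM2l h (mulr_ege1 k2 k2); move: h; clear; lra.
  have xp : `|x| <= 1 -> 0 <= 1 - x ^+ 2 <= 1.
    by move=> hx; rewrite gerBl sqr_ge0 subr_ge0 -real_normK ?num_real// exprn_ile1.
  have xx : `|x| <= 1.
    case/andP: x1I => x1a x1b.
    have h1 : p1 / (8 * om) <= (1 + x1).
      rewrite ler_pdivrMr ?mulr_gt0//.
      have -> : p1 = (1 + x1) * (1 - x1) by rewrite /p1; ring.
      by rewrite ler_wpM2l//; move: x1a x1b om1; clear; lra.
    by rewrite ler_norml; apply/andP; split; move: h1 xa xb x1b; clear; lra.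
  have /andP[p2 p3] := xp xx.
  have up : Wh a b N x <= Om / 2.
    rewrite hW.
    have h1 : N ^+ 2 / 4 * (Rr ^+ 2 - (x - x0) ^+ 2) <= N ^+ 2 / 4 * (4 * L) ^+ 2.
      rewrite ler_wpM2l ?divr_ge0 ?sqr_ge0//.
      apply: (@le_trans _ _ (Rr ^+ 2)); first by rewrite gerBl sqr_ge0.
      by rewrite ler_pXn2r// nnegrE ?mulr_ge0// ltW.
    have -> : Om / 2 = N ^+ 2 / 4 * (4 * L) ^+ 2.
      have -> : N ^+ 2 / 4 * (4 * L) ^+ 2 = 4 * N * (L ^+ 2 * N) by field.
      by rewrite hL /Om; field.
    exact: h1.
  have dn : - (1/4) - Om / 4 <= Wh a b N x.
    (* Either [x] is no farther from the centre than [x1], so that [Wh x >= Wh x1], or the interval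
       has crossed the centre, and then by at most its own length. *)
    have [h|h] := leP (x0 - x) (x1 - x0).
      have : Wh a b N x1 <= Wh a b N x.
        rewrite !hW ler_wpM2l ?divr_ge0 ?sqr_ge0// lerD2l lerN2.
        have : 0 <= ((x1 - x0) - (x - x0)) * ((x1 - x0) + (x - x0)).
          by rewrite mulr_ge0//; move: h xb; clear; lra.
        by clear; lra.
      by move: hWm Om1; clear; lra.
    have : - (Om / 4) <= Wh a b N x.
      rewrite hW; apply: (@le_trans _ _ (- (N ^+ 2 / 4 * (p1 / (8 * om)) ^+ 2))); first by rewrite lerN2.
      rewrite -mulrN ler_wpM2l ?divr_ge0 ?sqr_ge0//.
      have : (x0 - x) ^+ 2 <= (p1 / (8 * om)) ^+ 2.
        rewrite ler_pXn2r// ?nnegrE; first by move: h x01 xb xa; clear; lra.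
          by move: h x01; clear; lra.
        by pos.
      by have := sqr_ge0 Rr; clear; lra.
    by clear; lra.
  by rewrite ler_norml; apply/andP; split; move: up dn p2 p3 Om1; clear; lra.
have [xl hm] := local_mass S M om1 hWt; rewrite -/p1 in xl hm.
set len := p1 / (8 * om) in xl hm.
have len0 : 0 < len by rewrite divr_gt0// mulr_gt0.
case/andP: x1I => x1a x1b.
have hT : Y x1 - Y (x1 - len) <= Y 1 - Y (-1).
  apply: lerB.
    by apply: (mass_mono S) => //; exact: ltW.
  by apply: (mass_mono S) => //; [exact: ltW|move: len0 x1b; clear; lra].
have h1 : p1 * y x1 ^+ 2 <= 16 * om * (Y 1 - Y (-1)).
  have := le_trans hm hT; rewrite mulrAC ler_pdivrMr ?mulr_gt0//.
  by rewrite [_ * (16 * om)]mulrC.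
have h2 : (p1 * y x1 ^+ 2) ^+ 2 <= (16 * om * (Y 1 - Y (-1))) ^+ 2.
  by rewrite ler_pXn2r// nnegrE ?(le_trans _ h1)// mulr_ge0 ?sqr_ge0 ?ltW.
rewrite -(ler_pM2l p0).
have -> : p1 * (p1 * y x1 ^+ 4) = (p1 * y x1 ^+ 2) ^+ 2 by ring.
apply: (le_trans h2); rewrite le_eqVlt; apply/orP; left; apply/eqP.
by rewrite !exprMn om2 /Om; ring.
Qed.

End Estimates.

(** * The scale L, the two remaining cases and the bound for p y^4 *)

Section Scales.
Context {R : realType}.

(* [k = 6 B] is large enough for all the smallness conditions on the scale [L]. *)
Lemma scale_conditions (a b N : R) y v Y x0 Rr x1 L del B k :
  jsol a b N y v Y -> centre a b N x0 Rr -> maxpt y x1 -> x0 <= x1 ->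
  1 <= B -> k = 6 * B -> 0 < L -> L ^+ 2 * N = k ^+ 2 * (1 - x1 ^+ 2) -> 4 * L <= Rr ->
  L <= del ->
  [/\ B * (1 - x1 ^+ 2) ^+ 2 <= N ^+ 2 / 4 * Rr * del ^+ 3,
      B <= N ^+ 2 / 4 * Rr * del, B <= N * (N ^+ 2 / 4 * Rr * del ^+ 2) &
      1 - x1 ^+ 2 <= N ^+ 2 / 4 * Rr * L].
Proof.
move=> S C M x01 B1 hk L0 hL hRL Ld.
have F1 := maxpt_p_lower S C M x01.
have [[R0 R1 NR q1 q2] hW] := C; have N1 := jsol_N1 S.
have N0 : 0 < N := lt_le_trans ltr01 N1.
have [x1I y0 _] := M; have p0 := p_gt0 x1I.
set p1 := 1 - x1 ^+ 2 in hL F1 p0 *.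
have B0 : 0 < B := lt_le_trans ltr01 B1.
have NR0 : 0 <= N ^+ 2 / 4 * Rr by pos.
have BB : B <= B ^+ 2 by rewrite expr2 ler_peMl// ltW.
have e1 : N ^+ 2 * L ^+ 4 = k ^+ 4 * p1 ^+ 2.
  have -> : N ^+ 2 * L ^+ 4 = (L ^+ 2 * N) ^+ 2 by ring.
  by rewrite hL; ring.
split.
- apply: (@le_trans _ _ (N ^+ 2 / 4 * Rr * L ^+ 3)); last first.
    by rewrite ler_wpM2l// ler_pXn2r// nnegrE ?ltW// (lt_le_trans L0).
  have h : N ^+ 2 / 4 * L ^+ 3 * (4 * L) <= N ^+ 2 / 4 * L ^+ 3 * Rr.
    by rewrite ler_wpM2l//; pos.
  have h2 : N ^+ 2 / 4 * L ^+ 3 * (4 * L) = k ^+ 4 * p1 ^+ 2 by rewrite -e1; field.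
  have h3 : B * p1 ^+ 2 <= k ^+ 4 * p1 ^+ 2.
    rewrite ler_wpM2r ?sqr_ge0// hk exprMn.
    have : 1 <= B ^+ 2 by rewrite exprn_ege1.
    have -> : B ^+ 4 = B ^+ 2 * B ^+ 2 by ring.
    by move: BB B1; move: (B ^+ 2) => t; clear; nra.
  by move: h h3; rewrite h2; clear; lra.
- apply: (@le_trans _ _ (N ^+ 2 / 4 * Rr * L)); last by rewrite ler_wpM2l.
  have h0 : 0 <= N ^+ 2 / 4 * Rr * L by pos.
  rewrite -(@ler_pXn2r _ 2)// ?nnegrE ?(ltW B0)//.
  have e : (N ^+ 2 / 4 * Rr * L) ^+ 2 = k ^+ 2 / 16 * (p1 * N ^+ 2 * Rr) * (N * Rr).
    have -> : (N ^+ 2 / 4 * Rr * L) ^+ 2 = (L ^+ 2 * N) * N ^+ 3 * Rr ^+ 2 / 16 by field.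
    by rewrite hL; field.
  (* The square to be compared with [B^2] is at least [k^2 / 32]; this asks for [k^2 >= 32 B^2] and
     explains the factor [6]. *)
  have h1 : 1/2 * 1 <= (p1 * N ^+ 2 * Rr) * (N * Rr) by apply: ler_pM => //; move: F1; clear; lra.
  have h2 := ler_wpM2l (sqr_ge0 B) h1.
  have h3 := sqr_ge0 B; rewrite e hk; move: h2 h3; clear; lra.
- apply: (@le_trans _ _ (N * (N ^+ 2 / 4 * Rr * L ^+ 2))); last first.
    apply: ler_wpM2l; first exact: ltW.
    apply: ler_wpM2l => //; rewrite ler_pXn2r// nnegrE; first exact: ltW.
    exact: ltW (lt_le_trans L0 Ld).
  have -> : N * (N ^+ 2 / 4 * Rr * L ^+ 2) = k ^+ 2 / 4 * (p1 * N ^+ 2 * Rr).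
    have -> : N * (N ^+ 2 / 4 * Rr * L ^+ 2) = (L ^+ 2 * N) * N ^+ 2 * Rr / 4 by field.
    by rewrite hL; field.
  have h1 : 1/2 <= p1 * N ^+ 2 * Rr by move: F1; clear; lra.
  have h2 := ler_wpM2l (sqr_ge0 B) h1.
  by rewrite hk; move: h2 BB B0; clear; lra.
- have h : N ^+ 2 / 4 * L * (4 * L) <= N ^+ 2 / 4 * L * Rr by rewrite ler_wpM2l//; pos.
  have e : N ^+ 2 / 4 * L * (4 * L) = N * k ^+ 2 * p1.
    have -> : N ^+ 2 / 4 * L * (4 * L) = N * (L ^+ 2 * N) by field.
    by rewrite hL; ring.
  have k1 : 1 <= k ^+ 2 by rewrite exprn_ege1// hk; move: B1; clear; lra.
  have h1 := ler_wpM2r (ltW p0) (mulr_ege1 N1 k1).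
  by move: h h1; rewrite e; clear; lra.
Qed.

(** The local mass at [x1] is compared with the tail mass [O(sqrt (L / Rr)) T] instead of [T]. Since
    [om^2] is of order [N^2 Rr L], the product [om^2 L / Rr] is free of [Rr]; its numerical factor
    is [16^2 * 7/4 * 2 = 16 * 56]. *)
Lemma case_turning (a b N : R) y v Y x0 Rr x1 L B k :
  jsol a b N y v Y -> centre a b N x0 Rr -> maxpt y x1 -> x0 <= x1 ->
  B = 24 * 1000 -> k = 6 * B -> 0 < L -> L ^+ 2 * N = k ^+ 2 * (1 - x1 ^+ 2) -> 4 * L <= Rr ->
  x0 + Rr - x1 <= L ->
  (1 - x1 ^+ 2) * y x1 ^+ 4 <= 16 * 56 * (64 * 3300) ^+ 2 * k ^+ 2 * (Y 1 - Y (-1)) ^+ 2 * N.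
Proof.
move=> S C M x01 hB hk L0 hL hRL hs.
have hWm := maxpt_Wh S C M x01.
have B1 : 1 <= B by rewrite hB; clear; lra.
have L2 : L <= 2 * L by move: L0; clear; lra.
have [H2 H3 H4 _] := scale_conditions S C M x01 B1 hk L0 hL hRL L2.
have [G2 G3 G4 G5] := scale_conditions S C M x01 B1 hk L0 hL hRL (lexx L).
have [[R0 R1 NR q1 q2] hW] := C; have N1 := jsol_N1 S.
have N0 : 0 < N := lt_le_trans ltr01 N1.
have [x1I y0 _] := M; have p0 := p_gt0 x1I; case/andP: (x1I) => x1a x1b.
set p1 := 1 - x1 ^+ 2 in hL p0 H2 G2 G5 *.
have B0 : 0 < B := lt_le_trans ltr01 B1.
have BL : 1 <= N ^+ 2 / 4 * Rr * L := le_trans B1 G3.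
(* At a distance more than [L] beyond the turning point [Wh] would be below [- 2], whereas
   [maxpt_Wh] gives [Wh x1 >= - 1/4]. *)
have hs' : - L <= x0 + Rr - x1.
  rewrite leNgt; apply/negP => h; move: hWm; rewrite hW.
  have h1 : L * (2 * Rr) <= (x1 - x0 - Rr) * (x1 - x0 + Rr).
    by apply: ler_pM; move: h L0 R0; clear; lra.
  have h2 : 0 <= N ^+ 2 / 4 by pos.
  have h3 := ler_wpM2l h2 h1.
  by move: h3 BL; clear; lra.
(* The width is [2 L] because the interval next to [x1] reaches at most [L] further to the left, so
   that all of it lies in the tail [s <= 2 L]. *)
pose d := Num.sqrt (2 * L); have hd : d ^+ 2 = 2 * L by rewrite sqr_sqrtr// mulr_ge0// ltW.
have d0 : 0 < d by rewrite sqrtr_gt0 mulr_gt0.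
pose r := Num.sqrt Rr; have hr : r ^+ 2 = Rr by rewrite sqr_sqrtr// ltW.
have r0 : 0 < r by rewrite sqrtr_gt0.
have [] := @multiplier_consequences _ a b N y v Y x0 Rr x1 (2 * L) d r S C x1I _ d0 hd r0 hr.
- by rewrite mulr_gt0.
- by move: hRL; clear; lra.
- by rewrite ler_norml; apply/andP; split; move: hs hs' L0; clear; lra.
- by rewrite -hB.
- by rewrite -hB.
- by rewrite -hB.
move=> htail _.
(* On the interval [s] lies in [[- L, 2 L]], so [|Wh| <= N^2 / 4 * (2 L) * (3 Rr)]; the seventh unit
   covers [p / 4]. *)
pose Om := 7 * (N ^+ 2 / 4 * Rr * L); have Om1 : 1 <= Om by rewrite /Om; move: BL; clear; lra.
have Om0 : 0 < Om := lt_le_trans ltr01 Om1.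
pose om := Num.sqrt Om; have om2 : om ^+ 2 = Om by rewrite sqr_sqrtr// ltW.
have om0 : 0 < om by rewrite sqrtr_gt0.
have om1 : 1 <= om by rewrite -(@expr_ge1 _ 2)// ?om2// ltW.
have len0 : 0 < p1 / (8 * om) by rewrite divr_gt0// mulr_gt0.
have lenL : p1 / (8 * om) <= L.
  rewrite -(@ler_pXn2r _ 2)// ?nnegrE ?(ltW L0) ?(ltW len0)//.
  rewrite !exprMn exprVn exprMn om2 ler_pdivrMr; last by rewrite mulr_gt0.
  have h1 : p1 ^+ 2 <= N ^+ 2 / 4 * Rr * L ^+ 3 by apply: le_trans G2; rewrite ler_peMl// sqr_ge0.
  have h2 : 0 <= N ^+ 2 / 4 * Rr * L ^+ 3 by pos.
  by move: h1 h2; rewrite /Om; clear; lra.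
have hWt x : x1 - p1 / (8 * om) <= x <= x1 -> `|Wt a b N x| <= om ^+ 2.
  move=> /andP[xa xb]; rewrite om2 /Wt.
  have xs1 : - L <= x0 + Rr - x by move: hs' xb; clear; lra.
  have xs2 : x0 + Rr - x <= 2 * L by move: hs xa lenL; clear; lra.
  have hb : `|Wh a b N x| <= 6 * (N ^+ 2 / 4 * Rr * L).
    rewrite hW.
    have -> : N ^+ 2 / 4 * (Rr ^+ 2 - (x - x0) ^+ 2) = N ^+ 2 / 4 * ((x0 + Rr - x) * (Rr + (x - x0))) by ring.
    have -> : 6 * (N ^+ 2 / 4 * Rr * L) = N ^+ 2 / 4 * ((2 * L) * (3 * Rr)) by field.
    apply: norm_le_mul; first by rewrite ger0_norm// divr_ge0 ?sqr_ge0.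
    by apply: norm_le_mul; rewrite ler_norml; apply/andP; split; move: xs1 xs2 hRL L0; clear; lra.
  have xx : -1 <= x <= 1.
    have h1 : L <= 1 + x1 by move: hRL q2 x01 R0; clear; lra.
    by apply/andP; split; move: h1 lenL xa xb x1b; clear; lra.
  have p2 : 0 <= 1 - x ^+ 2.
    case/andP: xx => xx1 xx2; have -> : 1 - x ^+ 2 = (1 - x) * (1 + x) by ring.
    by rewrite mulr_ge0//; move: xx1 xx2; clear; lra.
  have p3 := sqr_ge0 x.
  by move: hb; rewrite !ler_norml /Om => /andP[b1 b2]; apply/andP; split; move: b1 b2 p2 p3 BL; clear; lra.
have [xl hm] := local_mass S M om1 hWt; rewrite -/p1 in xl hm.
set len := p1 / (8 * om) in xl hm len0 lenL.
have hT : Y x1 - Y (x1 - len) <= Y 1 - Y (x0 + Rr - 2 * L).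
  apply: lerB.
    by apply: (mass_mono S) => //; exact: ltW.
  apply: (mass_mono S).
  - by move: q2 R0 hRL; clear; lra.
  - by move: hs lenL; clear; lra.
  - by move: len0 x1b; clear; lra.
set T := Y 1 - Y (-1) in htail *.
have hm2 := le_trans (le_trans hm hT) htail.
have h1 : p1 * y x1 ^+ 2 <= 16 * om * (64 * 3300 * d / r * T).
  have := hm2; rewrite mulrAC ler_pdivrMr ?mulr_gt0//.
  by rewrite [_ * (16 * om)]mulrC.
have pp0 : 0 <= p1 * y x1 ^+ 2 by rewrite mulr_ge0 ?sqr_ge0 ?ltW.
have h2 : (p1 * y x1 ^+ 2) ^+ 2 <= (16 * om * (64 * 3300 * d / r * T)) ^+ 2.
  by rewrite ler_pXn2r// nnegrE (le_trans pp0 h1).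
rewrite -(ler_pM2l p0).
have -> : p1 * (p1 * y x1 ^+ 4) = (p1 * y x1 ^+ 2) ^+ 2 by ring.
apply: (le_trans h2); rewrite le_eqVlt; apply/orP; left; apply/eqP.
have -> : p1 * (16 * 56 * (64 * 3300) ^+ 2 * k ^+ 2 * T ^+ 2 * N) =
  16 * 56 * (64 * 3300) ^+ 2 * (L ^+ 2 * N) * T ^+ 2 * N by rewrite hL; ring.
have -> : (16 * om * (64 * 3300 * d / r * T)) ^+ 2 =
  16 ^+ 2 * om ^+ 2 * (64 * 3300) ^+ 2 * d ^+ 2 / r ^+ 2 * T ^+ 2 by field; rewrite gt_eqF.
by rewrite om2 hd hr /Om; field; rewrite gt_eqF.
Qed.

(** At [x1] the quantity [v^2 + Wt y^2] is [O(Lam d r T)], while [Wt] is at least [Lam d^2 r^2 / 2],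
    where [Lam = N^2 / 4]. Hence [y^2 d r = O(T)], and after squaring,
    [del Rr >= 4 L^2 = 4 k^2 p1 / N] produces the factor [p1 / N]. *)
Lemma case_inner (a b N : R) y v Y x0 Rr x1 L B k :
  jsol a b N y v Y -> centre a b N x0 Rr -> maxpt y x1 -> x0 <= x1 ->
  B = 24 * 1000 -> k = 6 * B -> 0 < L -> L ^+ 2 * N = k ^+ 2 * (1 - x1 ^+ 2) -> 4 * L <= Rr ->
  L <= x0 + Rr - x1 ->
  (1 - x1 ^+ 2) * y x1 ^+ 4 <= (192 * 3300 + 5) ^+ 2 * (Y 1 - Y (-1)) ^+ 2 * N.
Proof.
move=> S C M x01 hB hk L0 hL hRL hs.
have B1 : 1 <= B by rewrite hB; clear; lra.
have [[R0 R1 NR q1 q2] hW] := C; have N1 := jsol_N1 S.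
have N0 : 0 < N := lt_le_trans ltr01 N1.
(* The distance of [x1] from the turning point is the natural width; it is capped at [Rr / 2] to
   meet the requirement [2 del <= Rr]. *)
pose del := Num.min (x0 + Rr - x1) (Rr / 2).
have del1 : del <= x0 + Rr - x1 by rewrite ge_min lexx.
have del2 : del <= Rr / 2 by rewrite ge_min lexx orbT.
have Ld : L <= del by rewrite le_min hs; move: hRL L0; clear; lra.
have del0 : 0 < del := lt_le_trans L0 Ld.
have [H2 H3 H4 H5] := scale_conditions S C M x01 B1 hk L0 hL hRL Ld.
have [x1I y0 _] := M; have p0 := p_gt0 x1I; case/andP: (x1I) => x1a x1b.
set p1 := 1 - x1 ^+ 2 in hL p0 H2 H5 *.
pose d := Num.sqrt del; have hd : d ^+ 2 = del by rewrite sqr_sqrtr// ltW.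
have d0 : 0 < d by rewrite sqrtr_gt0.
pose r := Num.sqrt Rr; have hr : r ^+ 2 = Rr by rewrite sqr_sqrtr// ltW.
have r0 : 0 < r by rewrite sqrtr_gt0.
have [] := @multiplier_consequences _ a b N y v Y x0 Rr x1 del d r S C x1I del0 d0 hd r0 hr.
- by move: del2; clear; lra.
- have : x0 + Rr - x1 <= 2 * del.
    have [h|h] := leP (x0 + Rr - x1) (Rr / 2).
      by rewrite /del (min_idPl h); move: L0 hs; clear; lra.
    by rewrite /del (min_idPr (ltW h)); move: x01; clear; lra.
  by move=> h; rewrite ler_norml; apply/andP; split; move: h L0 hs; clear; lra.
- by rewrite -hB.
- by rewrite -hB.
- by rewrite -hB.
move=> _ hF; set T := Y 1 - Y (-1) in hF *.
have T0 : 0 <= T by rewrite subr_ge0 (mass_mono S)//; clear; lra.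
have N2R : 1 <= N ^+ 2 * Rr by rewrite expr2 -mulrA (le_trans NR)// ler_peMl// (le_trans _ NR).
have Lpos : 0 <= N ^+ 2 / 4 * d * r * T by pos.
have F1 : v x1 ^+ 2 + Wt a b N x1 * y x1 ^+ 2 <= (192 * 3300 + 5) * (N ^+ 2 / 4 * d * r * T).
  have [h|h] := leP (x0 + Rr - x1) (Rr / 2).
    have := hF x1; rewrite /del (min_idPl h).
    have -> : x0 + Rr - (x0 + Rr - x1) = x1 by ring.
    rewrite lexx x1b => /(_ isT) h1; apply: (le_trans h1).
    by move: Lpos; clear; lra.
  have ed : del = Rr / 2 by rewrite /del (min_idPr (ltW h)).
  pose xd := x0 + Rr - del.
  have xd1 : x1 <= xd by rewrite /xd ed; move: h; clear; lra.
  have xd2 : xd < 1 by rewrite /xd; move: q1 del0; clear; lra.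
  (* From [x1] to the point where the tail begins, [x - x0 <= Rr / 2], so the derivative is at least
     [- 3 Lam Rr y^2] with [Lam = N^2 / 4]. Paying this with the total mass costs only a constant,
     as [Rr <= 3/2 d r] for the capped width. *)
  have h1 : v x1 ^+ 2 + Wt a b N x1 * y x1 ^+ 2 + 3 * (N ^+ 2 / 4) * Rr * Y x1 <=
            v xd ^+ 2 + Wt a b N xd * y xd ^+ 2 + 3 * (N ^+ 2 / 4) * Rr * Y xd.
    apply: (@le_of_deriv _ (fun x => v x ^+ 2 + Wt a b N x * y x ^+ 2 + 3 * (N ^+ 2 / 4) * Rr * Y x)
     (fun x => (- (N ^+ 2 / 2) * (x - x0) + x / 2 + 3 * (N ^+ 2 / 4) * Rr) * y x ^+ 2)).
    - exact: xd1.
    - apply: (@contI_sub _ (-1) 1); [|exact: ltW|exact: ltW].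
      by have cY := js_cY S; have cy := js_cy S; have cv := js_cv S; rewrite /Wt /Wh; ctn.
    - move=> z /andP[z1 z2]; have zI : -1 < z < 1 by rewrite (lt_trans x1a z1) (lt_trans z2 xd2).
      have hY := js_dY S zI; have hf := energy0_deriv S C zI.
      have hYI : is_derive z 1 (fun x => 3 * (N ^+ 2 / 4) * Rr * Y x) (3 * (N ^+ 2 / 4) * Rr * y z ^+ 2).
        by der; rewrite /=; ring.
      by apply: (is_derive_eq (deriv_add hf hYI)); ring.
    - move=> z /andP[z1 z2]; rewrite mulr_ge0 ?sqr_ge0//.
      have zz : 2 * (z - x0) <= Rr by move: z2; rewrite /xd ed; clear; lra.
      have h2 := ler_wpM2l (sqr_ge0 N) zz; have zb := lt_trans x1a z1.
      by move: h2 N2R zb; clear; lra.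
  have h2 : v xd ^+ 2 + Wt a b N xd * y xd ^+ 2 <= 192 * 3300 * (N ^+ 2 / 4) * d * r * T.
    by apply: hF; rewrite lexx.
  have h3 : Y xd - Y x1 <= T.
    apply: lerB; apply: (mass_mono S).
    - exact: le_trans (ltW x1a) xd1.
    - exact: ltW.
    - by [].
    - by [].
    - exact: ltW.
    - exact: ltW.
  have h4 : Rr <= 3/2 * (d * r).
    have rd : r <= 3/2 * d.
      rewrite -(@ler_pXn2r _ 2)// ?nnegrE ?mulr_ge0 ?(ltW d0) ?(ltW r0)//.
      by rewrite exprMn hd hr ed; move: R0; clear; lra.
    by rewrite -hr expr2; have := ler_wpM2r (ltW r0) rd; clear; lra.
  have h5 : 0 <= 3 * (N ^+ 2 / 4) * Rr by pos.
  have h6 : 0 <= N ^+ 2 / 4 * T by pos.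
  have h7 := ler_wpM2l h5 h3; have h8 := ler_wpM2l h6 h4.
  by move: h1 h2 h7 h8 Lpos; clear; lra.
have hWl : N ^+ 2 / 4 * Rr * del / 2 <= Wt a b N x1.
  rewrite /Wt hW -/p1.
  have -> : N ^+ 2 / 4 * (Rr ^+ 2 - (x1 - x0) ^+ 2) = N ^+ 2 / 4 * ((x0 + Rr - x1) * (Rr + (x1 - x0))) by ring.
  have h1 : del * Rr <= (x0 + Rr - x1) * (Rr + (x1 - x0)).
    by apply: ler_pM => //; [exact: ltW|exact: ltW|move: x01; clear; lra].
  have h0 : 0 <= N ^+ 2 / 4 by pos.
  have h2 := ler_wpM2l h0 h1.
  have h3 : N ^+ 2 / 4 * Rr * L <= N ^+ 2 / 4 * Rr * del by rewrite ler_wpM2l//; pos.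
  by move: h2 h3 H5 p0; clear; lra.
have h1 : y x1 ^+ 2 * (d * r) <= 2 * ((192 * 3300 + 5) * T).
  have h2 := ler_wpM2r (sqr_ge0 (y x1)) hWl.
  have h3 := sqr_ge0 (v x1).
  have c0 : 0 < N ^+ 2 / 4 * d * r / 2 by rewrite !mulr_gt0 ?exprn_gt0 ?invr_gt0.
  rewrite -(ler_pM2l c0).
  move: h2; rewrite -hd -hr => h2.
  by move: h2 h3 F1; clear; lra.
have e0 : 0 <= y x1 ^+ 2 * (d * r) by pos.
have h2 : (y x1 ^+ 2 * (d * r)) ^+ 2 <= (2 * ((192 * 3300 + 5) * T)) ^+ 2.
  by rewrite ler_pXn2r// nnegrE (le_trans e0 h1).
have e1 : (y x1 ^+ 2 * (d * r)) ^+ 2 = y x1 ^+ 4 * (del * Rr) by rewrite -hd -hr; ring.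
have h3 : y x1 ^+ 4 * (L * (4 * L)) <= y x1 ^+ 4 * (del * Rr).
  rewrite ler_wpM2l ?exprn_even_ge0//; apply: ler_pM => //; first exact: ltW.
  by rewrite mulr_ge0// ltW.
have h4 : y x1 ^+ 4 * (L * (4 * L)) * N = 4 * k ^+ 2 * (p1 * y x1 ^+ 4).
  have -> : y x1 ^+ 4 * (L * (4 * L)) * N = 4 * y x1 ^+ 4 * (L ^+ 2 * N) by ring.
  by rewrite hL; ring.
have h5 : 4 * k ^+ 2 * (p1 * y x1 ^+ 4) <= (2 * ((192 * 3300 + 5) * T)) ^+ 2 * N.
  by rewrite -h4 ler_wpM2r ?(ltW N0)// (le_trans h3)// -e1.
have k1 : 1 <= k ^+ 2 by rewrite exprn_ege1// hk; move: B1; clear; lra.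
have py0 : 0 <= p1 * y x1 ^+ 4 by rewrite mulr_ge0 ?exprn_even_ge0// ltW.
have h6 := ler_wpM2r py0 k1.
by move: h5 h6; clear; lra.
Qed.

Theorem jsol_bound : exists2 C1 : R, 0 < C1 &
  forall (a b N : R) y v Y, jsol a b N y v Y -> forall x, -1 <= x <= 1 ->
  (1 - x ^+ 2) * y x ^+ 4 <= C1 * (Y 1 - Y (-1)) ^+ 2 * N.
Proof.
have [B hB] : exists B : R, B = 24 * 1000 by eexists; reflexivity.
have [k hk] : exists k : R, k = 6 * B by eexists; reflexivity.
have B1 : 1 <= B by rewrite hB; clear; lra.
have k1 : 1 <= k by rewrite hk; move: B1; clear; lra.
have k0 : 0 < k := lt_le_trans ltr01 k1.
have [c1 hc1] : exists c1 : R, c1 = 64 * 32 * k ^+ 2 by eexists; reflexivity.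
have [c2 hc2] : exists c2 : R, c2 = 16 * 56 * (64 * 3300) ^+ 2 * k ^+ 2 by eexists; reflexivity.
have [c3 hc3] : exists c3 : R, c3 = (192 * 3300 + 5) ^+ 2 by eexists; reflexivity.
have c10 : 0 < c1.
  by rewrite hc1; have := exprn_gt0 2 k0; clear; lra.
have c20 : 0 <= c2 by rewrite hc2; pos.
have c30 : 0 <= c3 by rewrite hc3; pos.
have right (a b N : R) y v Y x0 Rr x1 : jsol a b N y v Y -> centre a b N x0 Rr ->
    maxpt y x1 -> x0 <= x1 ->
    (1 - x1 ^+ 2) * y x1 ^+ 4 <= (c1 + c2 + c3) * (Y 1 - Y (-1)) ^+ 2 * N.
  move=> S C M x01; have N1 := jsol_N1 S; have N0 : 0 < N := lt_le_trans ltr01 N1.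
  have p0 : 0 < 1 - x1 ^+ 2 by case: M => /p_gt0.
  have TN : 0 <= (Y 1 - Y (-1)) ^+ 2 * N by pos.
  have c1T := mulr_ge0 (ltW c10) TN; have c2T := mulr_ge0 c20 TN; have c3T := mulr_ge0 c30 TN.
  pose L := k * Num.sqrt ((1 - x1 ^+ 2) / N).
  have L0 : 0 < L by rewrite mulr_gt0// sqrtr_gt0 divr_gt0.
  have hL : L ^+ 2 * N = k ^+ 2 * (1 - x1 ^+ 2).
    rewrite exprMn sqr_sqrtr; last by rewrite divr_ge0 ?ltW.
    by field; rewrite gt_eqF.
  have [h|/ltW h] := leP Rr (4 * L).
    have := case_wide S C M x01 k1 L0 hL h; rewrite -hc1.
    by move: c1T c2T c3T; clear; lra.
  have [h'|/ltW h'] := leP (x0 + Rr - x1) L.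
    have := case_turning S C M x01 hB hk L0 hL h h'; rewrite -hc2.
    by move: c1T c2T c3T; clear; lra.
  have := case_inner S C M x01 hB hk L0 hL h h'; rewrite -hc3.
  by move: c1T c2T c3T; clear; lra.
exists (c1 + c2 + c3); first by move: c10 c20 c30; clear; lra.
move=> a b N y v Y S x xI; have N1 := jsol_N1 S; have N0 : 0 < N := lt_le_trans ltr01 N1.
have TN : 0 <= (Y 1 - Y (-1)) ^+ 2 * N by pos.
have [[x1 M]|h] := maxpt_exists S; last first.
  apply: (le_trans (h x xI)); rewrite -mulrA mulr_ge0//.
  by move: c10 c20 c30; clear; lra.
have hx : (1 - x ^+ 2) * y x ^+ 4 <= (1 - x1 ^+ 2) * y x1 ^+ 4 by case: M => _ _; exact.
apply: (le_trans hx).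
have [x0 [Rr C]] := centre_exists (js_a S) (js_b S) (js_N S).
have [h|/ltW h] := leP x0 x1; first exact: right S C M h.
have M' : maxpt (fun x => y (- x)) (- x1).
  case: M => /andP[m1 m2] m3 m4; split.
  - by rewrite ltrNr opprK m2 ltrNl m1.
  - by rewrite opprK.
  - move=> z /andP[z1 z2]; rewrite opprK sqrrN -(sqrrN z); apply: m4.
    by rewrite lerNr opprK z2 lerNl z1.
have := right _ _ _ _ _ _ _ _ _ (jsol_mirror S) (centre_mirror C) M' _.
by rewrite lerN2 !opprK sqrrN => /(_ h); rewrite [- Y (-1) + _]addrC.
Qed.

End Scales.

(** * Gamma and beta integrals *)

Section GammaIntegral.
Context {R : realType}.
Notation mu := (@lebesgue_measure R).

Lemma antideriv_exists (a b : R) (f : R -> R) : a < b -> contI a b f ->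
  let F := fun x : R => \int[mu]_(t in `[a, x]) f t in
  contI a b F /\ forall x : R, a < x < b -> is_derive x 1 F (f x).
Proof.
move=> ab cf F.
have fi : mu.-integrable `[a, b] (EFin \o f).
  by apply: continuous_compact_integrable => //; exact: segment_compact.
split; first by apply: parameterized_integral_continuous => //; exact: ltW.
move=> x /andP[ax xb].
have cfx : {for x, continuous f}.
  by apply: (within_continuous_continuous ab cf); rewrite in_itv/= ax.
have [dF Fx] := continuous_FTC1_closed xb fi ax cfx.
by split; [exact: dF|rewrite -derive1E; exact: Fx].
Qed.

Definition gamma_fun (s t : R) := t `^ (s - 1) * expR (- t).

Lemma deriv_expN (t : R) : is_derive t 1 (fun t => expR (- t)) (- expR (- t)).
Proof.
apply: (is_derive_eq (deriv_comp (deriv_opp (deriv_id t)) (is_derive_expR (- t)))).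
by rewrite mulN1r.
Qed.

Lemma contI_powR (a b r : R) : 0 <= r -> 0 <= a -> contI a b (fun t => t `^ r).
Proof.
move=> r0 a0; apply/contIP => x /andP[ax xb].
have [->|rn0] := eqVneq r 0.
  under eq_fun do rewrite powRr0; rewrite powRr0; exact: cvg_cst.
have rp : 0 < r by rewrite lt_neqAle eq_sym rn0.
have [x0|x0] := ltP 0 x.
  by apply: cvg_within_filter; exact: (deriv_cont (is_derive1_powR r x0)).
have {x0 ax} xE : x = 0 by apply/eqP; rewrite eq_le x0 (le_trans a0 ax).
rewrite xE powR0//.
apply/cvgrPdist_lt => e e0.
have he : 0 < e `^ r^-1 by rewrite powR_gt0.
rewrite near_withinE; near=> t => tab.
rewrite sub0r normrN ger0_norm ?powR_ge0//.
have t0 : 0 <= t by move: tab; rewrite /= in_itv/= => /andP[/(le_trans a0)].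
have : t < e `^ r^-1.
  have : ball (0 : R) (e `^ r^-1) t by near: t; exact: nbhsx_ballx.
  by rewrite /ball/= sub0r normrN ger0_norm.
move=> ht; have := gt0_ltr_powR rp _ _ ht; rewrite !nnegrE t0 powR_ge0 => /(_ isT isT).
by rewrite -powRrM mulVf// powRr1// ltW.
Unshelve. all: by end_near. Qed.

(* For [s >= 1] the integrand is continuous at [0], so that [Gamma s] is the limit
   [l] at infinity of an antiderivative [A]. *)
Definition gamma_prim (s : R) (A : R -> R) (l : R) :=
  [/\ A 0 = 0, forall b, 0 < b -> contI 0 b A,
      forall t : R, 0 < t -> is_derive t 1 A (gamma_fun s t) &
      A t @[t --> +oo] --> l].

Lemma contI_gamma_fun (s a b : R) : 1 <= s -> 0 <= a -> contI a b (gamma_fun s).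
Proof.
move=> s1 a0; apply: contI_mul; first by apply: contI_powR => //; rewrite subr_ge0.
by apply: contI_deriv => x _; eexists; exact: deriv_expN.
Qed.

Lemma contI_gt0 (f : R -> R) : (forall b : R, 0 < b -> contI 0 b f) ->
  {within `[0, +oo[, continuous f}.
Proof.
move=> h; apply/continuous_within_itvcyP; split.
  move=> x; rewrite in_itv/= andbT => x0.
  have x1 : 0 < x + 1 by rewrite addr_gt0.
  by apply: (within_continuous_continuous x1 (h _ x1)); rewrite in_itv/= x0 ltrDl ltr01.
by have /(continuous_within_itvP _ ltr01)[] := h 1 ltr01.
Qed.

Lemma gamma_prim_val (s : R) A l : 1 <= s -> gamma_prim s A l -> Gamma s = l.
Proof.
move=> s1 [A0 cA dA limA].
have cf : {within `[0, +oo[, continuous (gamma_fun s)}.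
  by apply: contI_gt0 => b b0; exact: contI_gamma_fun.
have mf : @measurable_fun _ _ R R `]0, +oo[%classic (gamma_fun s).
  apply: measurable_realfun.open_continuous_measurable_fun; first exact: interval_open.
  by move/continuous_within_itvcyP : cf => [+ _] => h x; rewrite inE; exact: h.
have -> : Gamma s = \int[mu]_(t in `[0, +oo[) gamma_fun s t.
  rewrite /Gamma /Rintegral -integral_itv_obnd_cbnd//.
  exact/measurable_realfun.measurable_EFinP.
rewrite (@Rintegral_ge0_continuous_FTC2y _ _ A 0 l) ?A0 ?subr0//.
- by move=> t t0; rewrite mulr_ge0 ?powR_ge0 ?expR_ge0.
- by move=> t t0; case: (dA t t0).
- have /continuous_within_itvcyP[_] := contI_gt0 cA; by rewrite A0.
- by move=> t; rewrite in_itv/= andbT => t0; rewrite derive1E; case: (dA t t0).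
Qed.

(** For [t >= 1], [t^s <= t^(n+1)], and the term of degree [n + 2] of the exponential series leaves
    a factor [1 / t]. *)
Lemma powR_expN_cvg0 (s : R) : 1 <= s -> (t `^ s * expR (- t)) @[t --> +oo] --> (0 : R).
Proof.
move=> s1; set n := Num.truncn s.
have sn : s < n.+1%:R by rewrite truncnS_gt.
apply: (@squeeze_cvgr _ _ _ _ (fun=> 0) (fun t => (n.+2)`!%:R / t)).
- near=> t.
  have t1 : 1 <= t by near: t; apply: nbhs_pinfty_ge; exact: num_real.
  have t0 : 0 < t := lt_le_trans ltr01 t1.
  rewrite mulr_ge0 ?powR_ge0 ?expR_ge0//=.
  have h1 : t `^ s <= t ^+ n.+1.
    by rewrite -powR_mulrn ?(ltW t0)//; apply: ler_powR => //; exact: ltW.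
  have f0 : 0 < (n.+2)`!%:R :> R by rewrite ltr0n fact_gt0.
  have h2 : t ^+ n.+2 / (n.+2)`!%:R <= expR t.
    by apply: le_trans (expR_ge1Dxn n.+1 (ltW t0)); rewrite lerDr.
  rewrite expRN ler_pdivrMr ?expR_gt0//.
  apply: (le_trans h1).
  have : (n.+2)`!%:R / t * (t ^+ n.+2 / (n.+2)`!%:R) <= (n.+2)`!%:R / t * expR t.
    by rewrite ler_wpM2l// divr_ge0 ?ltW.
  by rewrite exprS; have -> : (n.+2)`!%:R / t * (t * t ^+ n.+1 / (n.+2)`!%:R) = t ^+ n.+1 by field; rewrite !gt_eqF.
- exact: cvg_cst.
- rewrite -[X in _ --> X](mulr0 ((n.+2)`!%:R)); apply: cvgM; first exact: cvg_cst.
  apply/(@gtr0_cvgV0 R _ (+oo%R) _ id); last exact: cvg_id.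
  by near=> t; near: t; apply: nbhs_pinfty_gt; exact: num_real.
Unshelve. all: by end_near. Qed.

(** Integration by parts at the level of antiderivatives; the boundary term [t^s exp (- t)] vanishes
    at [0] and at infinity. *)
Lemma gamma_prim_succ (s : R) A l : 1 <= s -> gamma_prim s A l ->
  gamma_prim (s + 1) (fun t => s * A t - t `^ s * expR (- t)) (s * l).
Proof.
move=> s1 [A0 cA dA limA]; have s0 : 0 < s := lt_le_trans ltr01 s1.
split.
- by rewrite A0 mulr0 powR0 ?mul0r ?subr0// gt_eqF.
- move=> b b0; have hA := cA b b0; apply: contI_add; first by ctn.
  apply: contI_opp; apply: contI_mul; first by apply: contI_powR => //; exact: ltW.
  by apply: contI_deriv => x _; eexists; exact: deriv_expN.
- move=> t t0; have h1 := dA t t0; have h2 := deriv_expN t.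
  have h3 : is_derive t 1 (fun t => t `^ s) (s * t `^ (s - 1)) := is_derive1_powR s t0.
  der; rewrite /gamma_fun /= addrK -(@mulr_powRB1 _ t s) ?ltW//.
  by ring.
- rewrite -[X in _ --> X](subr0 (s * l)); apply: cvgB.
    by apply: cvgM => //; exact: cvg_cst.
  exact: powR_expN_cvg0.
Qed.

(** The upper bound comes from [t^(s-1) <= 1 + t], the lower one from
    [t^(s-1) exp (- t) >= exp (- 2)] on [[1, 2]]. Convergence at infinity follows from monotonicity
    and the upper bound. *)
Lemma gamma_prim_base (s : R) : 1 <= s <= 2 ->
  exists A l, gamma_prim s A l /\ expR (-2) <= l <= 2.
Proof.
move=> /andP[s1 s2].
pose A := fun x : R => \int[mu]_(t in `[0, x]) gamma_fun s t.
have hA b : 0 < b -> contI 0 b A /\ forall x : R, 0 < x < b -> is_derive x 1 A (gamma_fun s x).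
  by move=> b0; apply: antideriv_exists => //; exact: contI_gamma_fun.
have A0 : A 0 = 0 by rewrite /A set_itv1 Rintegral_set1.
have dA (t : R) : 0 < t -> is_derive t 1 A (gamma_fun s t).
  move=> t0; have t1 : 0 < t + 1 by rewrite addr_gt0.
  by have [_] := hA _ t1; apply; rewrite t0 ltrDl ltr01.
(* The interval of integration is empty for [t < 0]. This default value makes [A] nondecreasing on
   the whole line, as the convergence argument requires. *)
have An (t : R) : t < 0 -> A t = 0.
  by move=> t0; rewrite /A set_itv_ge ?Rintegral_set0// bnd_simp -ltNge.
clearbody A.
have f0 t : 0 <= gamma_fun s t by rewrite mulr_ge0 ?powR_ge0 ?expR_ge0.
have Amono x z : 0 <= x -> x <= z -> A x <= A z.
  move=> x0 xz; apply: (@le_of_deriv _ A (gamma_fun s)) => //.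
    have z1 : 0 < z + 1 by rewrite ltr_wpDl// (le_trans x0).
    by have [h _] := hA _ z1; apply: (contI_sub h) => //; rewrite lerDl.
  by move=> t /andP[t1 _]; apply: dA; exact: le_lt_trans t1.
have Age0 x : 0 <= x -> 0 <= A x by move=> x0; rewrite -A0 Amono.
have And : {homo A : x z / x <= z}.
  move=> x z xz; have [x0|x0] := ltP x 0; last exact: Amono.
  by rewrite (An _ x0); have [z0|z0] := ltP z 0; [rewrite (An _ z0)|exact: Age0].
have Aub x : A x <= 2.
  have [x0|x0] := ltP x 0; first by rewrite (An _ x0).
  (* [2 - (2 + t) exp (- t)] is the antiderivative of [(1 + t) exp (- t)] that vanishes at [0], and
     it stays below [2]. *)
  have h : 2 - (2 + 0) * expR (- 0) - A 0 <= 2 - (2 + x) * expR (- x) - A x.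
    apply: (@le_of_deriv _ (fun t => 2 - (2 + t) * expR (- t) - A t) (fun t => (1 + t) * expR (- t) - gamma_fun s t) 0 x).
    - exact: x0.
    - have z1 : 0 < x + 1 by rewrite ltr_wpDl.
      have cAx : contI 0 x A by have [h _] := hA _ z1; apply: (contI_sub h) => //; rewrite lerDl.
      have cE : contI 0 x (fun t => expR (- t)) by apply: contI_deriv => t _; eexists; exact: deriv_expN.
      by ctn.
    - move=> t /andP[t0 _]; have h1 := dA t t0; have h2 := deriv_expN t.
      by der; rewrite /=; ring.
    - move=> t /andP[t0 _]; rewrite subr_ge0 /gamma_fun ler_wpM2r ?expR_ge0//.
      have [t1|t1] := leP t 1.
        apply: (@le_trans _ _ (t `^ 0)); last by rewrite powRr0 lerDl ltW.
        by apply: ger_powR; rewrite ?t0// subr_ge0.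
      apply: (@le_trans _ _ (t `^ 1)).
        by apply: ler_powR; [exact: ltW|move: s2; clear; lra].
      by rewrite powRr1 ?ltW// ltrDr.
  move: h; rewrite oppr0 expR0 A0 => h.
  have : 0 <= (2 + x) * expR (- x) by rewrite mulr_ge0 ?expR_ge0// addr_ge0.
  by move: h; clear; lra.
have ub : has_ubound (range A) by exists 2 => _ [x _ <-].
exists A, (sup (range A)); split; first split=> //.
- by move=> b b0; have [] := hA _ b0.
- exact: nondecreasing_cvgr.
apply/andP; split; last first.
  by apply: ge_sup; [exists (A 0), 0|move=> _ [x _ <-]].
apply: (@le_trans _ _ (A 2)); last by apply: ub_le_sup => //; exists 2.
have h : A 1 - expR (-2) * 1 <= A 2 - expR (-2) * 2.
  apply: (@le_of_deriv _ (fun t => A t - expR (-2) * t) (fun t => gamma_fun s t - expR (-2))) => //.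
  - by rewrite ler1n.
  - have [c2 _] := hA 2 (ltr0n _ 2).
    by have cA := contI_sub c2 ler01 (lexx _); ctn.
  - move=> t /andP[t1 _]; have h1 := dA t (lt_trans ltr01 t1).
    by der; rewrite /=; ring.
  - move=> t /andP[t1 t2]; rewrite subr_ge0 /gamma_fun -[leLHS]mul1r.
    apply: ler_pM => //; rewrite ?expR_ge0//.
      rewrite -[leLHS](powRr0 t); apply: ler_powR; first exact: ltW.
      by rewrite subr_ge0.
    by rewrite ler_expR lerN2 ltW.
have := Age0 1 ler01; have : 0 <= expR (-2 : R) by exact: expR_ge0.
by move: h; clear; lra.
Qed.

End GammaIntegral.

(** * Recursion and bounds for Gamma; the beta integral *)

Section BetaIntegral.
Context {R : realType}.

Lemma gamma_prim_exists (s : R) : 1 <= s -> exists A l, gamma_prim s A l /\ 0 < l.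
Proof.
move=> s1; set n := Num.truncn s; have : s <= 2 + n%:R.
  by have := ltW (truncnS_gt s); rewrite -natr1; clear; lra.
move: n => n; elim: n s s1 => [|n ih] s s1 sn.
  have s2 : 1 <= s <= 2 by rewrite s1 -[leRHS]addr0.
  have [A [l [hA /andP[hl _]]]] := gamma_prim_base s2.
  by exists A, l; split=> //; apply: lt_le_trans hl; exact: expR_gt0.
have [s2|s2] := leP s 2.
  have s12 : 1 <= s <= 2 by rewrite s1.
  have [A [l [hA /andP[hl _]]]] := gamma_prim_base s12.
  by exists A, l; split=> //; apply: lt_le_trans hl; exact: expR_gt0.
have h1 : 1 <= s - 1 by move: s2; clear; lra.
have h2 : s - 1 <= 2 + n%:R by move: sn; rewrite -natr1; clear; lra.
have [A [l [hA hl]]] := ih _ h1 h2.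
have := gamma_prim_succ h1 hA; rewrite subrK => hS.
by eexists; eexists; split; [exact: hS|rewrite mulr_gt0//; exact: lt_le_trans h1].
Qed.

Lemma Gamma_gt0 (s : R) : 1 <= s -> 0 < Gamma s.
Proof. by move=> s1; have [A [l [hA hl]]] := gamma_prim_exists s1; rewrite (gamma_prim_val s1 hA). Qed.

Lemma Gamma_succ (s : R) : 1 <= s -> Gamma (s + 1) = s * Gamma s.
Proof.
move=> s1; have [A [l [hA hl]]] := gamma_prim_exists s1.
rewrite (gamma_prim_val s1 hA); apply: gamma_prim_val (gamma_prim_succ s1 hA).
by move: s1; clear; lra.
Qed.

Lemma Gamma_bounds (s : R) : 1 <= s <= 2 -> expR (-2) <= Gamma s <= 2.
Proof.
move=> s12; have [A [l [hA hl]]] := gamma_prim_base s12.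
by case/andP: s12 => s1 _; rewrite (gamma_prim_val s1 hA).
Qed.

(** At most two steps of the recursion lead back to [[1, 2]], each with a factor at most [3]:
    [18 = 2 * 3 * 3]. *)
Lemma Gamma_le18 (s : R) : 2 <= s <= 4 -> Gamma s <= 18.
Proof.
have step (u c : R) : 1 <= u <= 3 -> Gamma u <= c -> Gamma (u + 1) <= 3 * c.
  move=> /andP[u1 u3] h; rewrite Gamma_succ// ler_pM//; last exact: ltW (Gamma_gt0 u1).
  by rewrite (le_trans _ u1).
move=> /andP[s2 s4]; have e : s = (s - 1) + 1 by rewrite subrK.
have [s3|s3] := leP s 3.
  have : Gamma (s - 1) <= 2 by have /andP[] : expR (-2) <= Gamma (s - 1) <= 2 by apply: Gamma_bounds; move: s2 s3; clear; lra.
  by move/step; rewrite subrK => h; apply: le_trans (h _) _; move: s2 s3; clear; lra.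
have h2 : Gamma (s - 1 - 1) <= 2 by have /andP[] : expR (-2) <= Gamma (s - 1 - 1) <= 2 by apply: Gamma_bounds; move: s4 s3; clear; lra.
have h3 : Gamma (s - 1) <= 3 * 2.
  by have := step _ _ _ h2; rewrite subrK; apply; move: s4 s3; clear; lra.
have := step _ _ _ h3; rewrite subrK => h; apply: (le_trans (h _)).
  by move: s4 s3; clear; lra.
by clear; lra.
Qed.

(** The integral over [[-1, 1]] is encoded as the increment of an antiderivative. Recursions between
    integrals then reduce to differentiating an explicit function, and the witness serves directly
    as the [Y] of [jsol]. *)
Definition has_int (f : R -> R) (T : R) := exists Y : R -> R,
  [/\ contI (-1) 1 Y, forall x : R, -1 < x < 1 -> is_derive x 1 Y (f x) & Y 1 - Y (-1) = T].

Lemma has_int_exists (f : R -> R) : contI (-1) 1 f -> exists T, has_int f T.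
Proof.
move=> cf; have h : (-1 : R) < 1 by clear; lra.
have [cY dY] := antideriv_exists h cf.
by eexists; eexists; split; [exact: cY|exact: dY|reflexivity].
Qed.

Definition wt (a b x : R) := ((1 - x) / 2) `^ a * ((1 + x) / 2) `^ b.

Lemma wt_mirror (a b x : R) : wt b a (- x) = wt a b x.
Proof. by rewrite /wt opprK mulrC. Qed.

Lemma has_int_ext (f g : R -> R) T : (forall x, -1 < x < 1 -> f x = g x) -> has_int f T -> has_int g T.
Proof.
move=> e [Y [cY dY hT]]; exists Y; split=> // x xI.
by apply: (is_derive_eq (dY x xI)); exact: e.
Qed.

Lemma has_int_mirror (f : R -> R) T : has_int f T -> has_int (fun x => f (- x)) T.
Proof.
move=> [Y [cY dY hT]]; exists (fun x => - Y (- x)); split.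
- by apply: contI_opp; exact: contI_opp_arg.
- move=> x xI; have xI' : -1 < - x < 1 by move: xI; clear; lra.
  by apply: (is_derive_eq (deriv_opp (deriv_opp_arg (dY _ xI')))); rewrite opprK.
- by rewrite !opprK addrC.
Qed.

Lemma contI_half (a b r : R) (s : bool) : -1 <= a -> b <= 1 -> 0 <= r ->
  contI a b (fun x => ((1 + (-1) ^+ s * x) / 2) `^ r).
Proof.
move=> a1 b1 r0; apply: (@contI_comp _ a b 0 1 (fun t => t `^ r)).
- move=> x; case: s; rewrite ?expr0 ?expr1; move: a1 b1; clear; lra.
- by apply: contI_deriv => x _; eexists; der.
- exact: contI_powR.
Qed.

Lemma contI_wt (a b : R) : 0 <= a -> 0 <= b -> contI (-1) 1 (wt a b).
Proof.
move=> a0 b0; apply: contI_mul.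
  have := @contI_half (-1) 1 a true (lexx _) (lexx _) a0.
  by under eq_fun do rewrite expr1 mulN1r.
have := @contI_half (-1) 1 b false (lexx _) (lexx _) b0.
by under eq_fun do rewrite expr0 mul1r.
Qed.

Lemma deriv_wt (a b x : R) : -1 < x < 1 ->
  is_derive x 1 (wt a b) (wt a b x * (- a / (1 - x) + b / (1 + x))).
Proof.
move=> xI; have [h1 h2] : 0 < (1 - x) / 2 /\ 0 < (1 + x) / 2 by move: xI; clear; lra.
have [k1 k2] : 1 - x != 0 /\ 1 + x != 0.
  by split; apply/eqP; move: xI; clear; lra.
have d1 : is_derive x 1 (fun x => (1 - x) / 2) (- (1 / 2)) by der; rewrite /=; field.
have d2 : is_derive x 1 (fun x => (1 + x) / 2) (1 / 2) by der; rewrite /=; field.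
have D1 := deriv_comp d1 (is_derive1_powR a h1); have D2 := deriv_comp d2 (is_derive1_powR b h2).
apply: (is_derive_eq (deriv_mul D1 D2)); rewrite /wt.
have e (u r : R) : 0 < u -> u `^ (r - 1) = u `^ r / u.
  by move=> u0; rewrite powRB ?(gt_eqF u0) ?implybT// powRr1// ltW.
by rewrite !e//; field; rewrite k1 k2.
Qed.

Lemma wt_succ_l (a b x : R) : 0 <= a -> -1 < x < 1 -> wt (a + 1) b x = (1 - x) / 2 * wt a b x.
Proof.
move=> a0 xI; have h1 : 0 < (1 - x) / 2 by move: xI; clear; lra.
by rewrite /wt powRD ?(gt_eqF h1) ?implybT// powRr1 ?ltW//; ring.
Qed.

Lemma wt_succ_r (a b x : R) : 0 <= b -> -1 < x < 1 -> wt a (b + 1) x = (1 + x) / 2 * wt a b x.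
Proof.
move=> a0 xI; have h1 : 0 < (1 + x) / 2 by move: xI; clear; lra.
by rewrite /wt powRD ?(gt_eqF h1) ?implybT// powRr1 ?ltW//; ring.
Qed.

Lemma wt_end (a b : R) : 0 < a -> 0 < b -> wt a b 1 = 0 /\ wt a b (-1) = 0.
Proof.
move=> a0 b0; rewrite /wt !subrr !mul0r !powR0 ?gt_eqF//.
by rewrite mul0r mulr0.
Qed.

(** Integration by parts: the derivative of [wt (a + 1) (b + 1)] is a combination of [wt a b] and
    [wt (a + 1) b], and this boundary term vanishes at both ends. *)
Lemma beta_succ (a b T : R) : 0 <= a -> 0 <= b -> has_int (wt a b) T ->
  has_int (wt (a + 1) b) ((a + 1) / (a + b + 2) * T).
Proof.
move=> a0 b0 [Y [cY dY hT]].
have a1 : 0 < a + 1 by rewrite ltr_wpDl. have b1 : 0 < b + 1 by rewrite ltr_wpDl.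
have s0 : 0 < a + b + 2 by rewrite ltr_wpDl// addr_ge0.
have cw := contI_wt (ltW a1) (ltW b1).
exists (fun x => 2 / (a + b + 2) * (wt (a + 1) (b + 1) x + (a + 1) / 2 * Y x)); split.
- by ctn.
- move=> x xI; have hY := dY x xI; have hw := deriv_wt (a + 1) (b + 1) xI.
  have [k1 k2] : 1 - x != 0 /\ 1 + x != 0.
    by split; apply/eqP; move: xI; clear; lra.
  der; rewrite /= wt_succ_l// wt_succ_r// (wt_succ_l b a0 xI).
  by field; rewrite k1 k2 gt_eqF.
- by have [-> ->] := wt_end a1 b1; rewrite -hT; field; rewrite gt_eqF.
Qed.

Lemma beta_bound : exists2 C : R, 0 < C & forall a b : R, 0 <= a -> 0 <= b ->
  exists2 T, has_int (wt a b) T & T <= C * (Gamma (a + 1) * Gamma (b + 1) / Gamma (a + b + 2)).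
Proof.
set e := expR (- 2 : R); have e0 : 0 < e by exact: expR_gt0.
(* For exponents in [[0, 1]] the weight is at most [1], so [T <= 2]; moreover
   [Gamma (a + b + 2) <= 18], and the two other factors are at least [e]. Hence [2 * 18 / e^2]. *)
pose C := 36 / e ^+ 2; have C0 : 0 < C by rewrite divr_gt0// exprn_gt0.
have step (a b : R) : 0 <= a -> 0 <= b ->
  (exists2 T, has_int (wt a b) T & T <= C * (Gamma (a + 1) * Gamma (b + 1) / Gamma (a + b + 2))) ->
  (exists2 T, has_int (wt (a + 1) b) T & T <= C * (Gamma (a + 1 + 1) * Gamma (b + 1) / Gamma (a + 1 + b + 2))).
  move=> a0 b0 [T hT hb]; exists ((a + 1) / (a + b + 2) * T); first exact: beta_succ.
  have a1 : 1 <= a + 1 by rewrite lerDr. have s1 : 1 <= a + b + 2 by move: a0 b0; clear; lra.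
  have -> : a + 1 + b + 2 = a + b + 2 + 1 by ring.
  rewrite (Gamma_succ a1) (Gamma_succ s1).
  have G0 := Gamma_gt0 s1; have s0 : 0 < a + b + 2 := lt_le_trans ltr01 s1.
  have h : 0 <= (a + 1) / (a + b + 2) by rewrite divr_ge0 ?(ltW s0)// (le_trans _ a1).
  apply: (le_trans (ler_wpM2l h hb)); rewrite le_eqVlt; apply/orP; left; apply/eqP.
  move: G0 s0; clear; move: (Gamma (a + b + 2)) (Gamma (a + 1)) (Gamma (b + 1)) => g1 g2 g3 g10 s0.
  by field; rewrite (gt_eqF g10) (gt_eqF s0).
have sym (a b : R) :
  (exists2 T, has_int (wt a b) T & T <= C * (Gamma (a + 1) * Gamma (b + 1) / Gamma (a + b + 2))) ->
  (exists2 T, has_int (wt b a) T & T <= C * (Gamma (b + 1) * Gamma (a + 1) / Gamma (b + a + 2))).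
  move=> [T /has_int_mirror hT hb]; exists T; last by rewrite (addrC b a) (mulrC (Gamma (b + 1))).
  by apply: has_int_ext hT => x _; rewrite wt_mirror.
have base (a b : R) : 0 <= a <= 1 -> 0 <= b <= 1 ->
  exists2 T, has_int (wt a b) T & T <= C * (Gamma (a + 1) * Gamma (b + 1) / Gamma (a + b + 2)).
  move=> /andP[a0 a1] /andP[b0 b1].
  have [T [Y [cY dY hT]]] := has_int_exists (contI_wt a0 b0).
  exists T; first by exists Y.
  have T2 : T <= 2.
    have : 1 * (-1) - Y (-1) <= 1 * 1 - Y 1.
      apply: (@le_of_deriv R (fun x => 1 * x - Y x) (fun x => 1 - wt a b x) (-1) 1).
      - by clear; lra.
      - by ctn.
      - by move=> x xI; have hY := dY x xI; der; rewrite /=; ring.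
      - move=> x xI; rewrite subr_ge0 /wt -[leRHS]mulr1.
        have h1 : 0 < (1 - x) / 2 <= 1 by move: xI; clear; lra.
        have h2 : 0 < (1 + x) / 2 <= 1 by move: xI; clear; lra.
        apply: ler_pM; rewrite ?powR_ge0//.
          by rewrite -[leRHS](powRr0 ((1 - x) / 2)); apply: ger_powR.
        by rewrite -[leRHS](powRr0 ((1 + x) / 2)); apply: ger_powR.
    by rewrite -hT; clear; lra.
  have /andP[Ga _] : e <= Gamma (a + 1) <= 2 by apply: Gamma_bounds; move: a0 a1; clear; lra.
  have /andP[Gb _] : e <= Gamma (b + 1) <= 2 by apply: Gamma_bounds; move: b0 b1; clear; lra.
  have G18 : Gamma (a + b + 2) <= 18 by apply: Gamma_le18; move: a0 a1 b0 b1; clear; lra.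
  have G0 : 0 < Gamma (a + b + 2) by apply: Gamma_gt0; move: a0 b0; clear; lra.
  apply: (le_trans T2); rewrite mulrA ler_pdivlMr//.
  move: Ga Gb G18 e0 C0; rewrite /C; clear.
  move: e (Gamma (a + b + 2)) (Gamma (a + 1)) (Gamma (b + 1)) => e g1 g2 g3 Ga Gb G18 e0 C0.
  have h1 : e * e <= g2 * g3 by apply: ler_pM => //; exact: ltW.
  have h2 := ler_wpM2l (ltW C0) h1.
  have e2 : 36 / e ^+ 2 * (e * e) = 36 by field; rewrite gt_eqF.
  by move: h2 G18; rewrite e2; clear; lra.
have ext (b : R) : 0 <= b ->
  (forall a : R, 0 <= a <= 1 -> exists2 T, has_int (wt a b) T & T <= C * (Gamma (a + 1) * Gamma (b + 1) / Gamma (a + b + 2))) ->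
  forall a : R, 0 <= a -> exists2 T, has_int (wt a b) T & T <= C * (Gamma (a + 1) * Gamma (b + 1) / Gamma (a + b + 2)).
  move=> b0 h a a0; set n := Num.truncn a; have : a <= n.+1%:R by rewrite ltW// truncnS_gt.
  move: n => n; elim: n a a0 => [|n ih] a a0 an; first by apply: h; rewrite a0.
  have [a1|a1] := leP a 1; first by apply: h; rewrite a0.
  rewrite -(subrK 1 a); apply: step => //; first by rewrite subr_ge0 ltW.
  by apply: ih; [rewrite subr_ge0 ltW|rewrite lerBlDr natr1].
(* The first exponent is brought into [[0, 1]], the reflection exchanges the two, and then the other
   one is reduced in the same way. *)
exists C => // a b a0 b0; apply: (ext _ b0) => // a' a'I; apply: sym.
have a'0 : 0 <= a' by case/andP: a'I.
by apply: (ext _ a'0) => // b' b'I; exact: base.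
Qed.

End BetaIntegral.

(** * Jacobi polynomials *)

Section JacobiPolynomials.
Context {R : realType}.

Lemma pochhammer_recr (a : R) k : pochhammer a k.+1 = pochhammer a k * (a + k%:R).
Proof. by rewrite /pochhammer big_nat_recr. Qed.

Lemma pochhammer_recl (a : R) k : pochhammer a k.+1 = a * pochhammer (a + 1) k.
Proof.
rewrite /pochhammer big_nat_recl// addr0; congr (_ * _).
by apply: eq_bigr => i _; rewrite -natr1; ring.
Qed.

Lemma pochhammer_gt0 (a : R) k : 0 < a -> 0 < pochhammer a k.
Proof.
move=> a0; elim: k => [|k ih]; first by rewrite /pochhammer big_geq.
by rewrite pochhammer_recr mulr_gt0// ltr_wpDr.
Qed.

Lemma pochhammer_neg (n k : nat) : (n < k)%N -> pochhammer (- n%:R : R) k = 0.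
Proof.
elim: k => // k ih; rewrite ltnS leq_eqVlt => /predU1P[->|/ih].
  by rewrite pochhammer_recr addNr mulr0.
by rewrite pochhammer_recr => ->; rewrite mul0r.
Qed.

Definition jcoef (n : nat) (a b : R) (k : nat) : R :=
  pochhammer (- n%:R) k * pochhammer (n%:R + a + b + 1) k / (pochhammer (a + 1) k * k`!%:R).

Definition jpoly (n : nat) (a b : R) : {poly R} := \poly_(k < n.+1) jcoef n a b k.

Lemma jpolyE n a b k : (jpoly n a b)`_k = jcoef n a b k.
Proof.
rewrite coef_poly; case: ifPn => //; rewrite -leqNgt => nk.
by rewrite /jcoef pochhammer_neg// !mul0r.
Qed.

Lemma hypergeometric_jpoly n (a b z : R) :
  hypergeometric2F1 (- n%:R) (n%:R + a + b + 1) (a + 1) z = (jpoly n a b).[z].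
Proof.
rewrite /hypergeometric2F1; apply: lim_near_cst => //.
near=> m; have nm : (n.+1 <= m)%N by near: m; exact: nbhs_infty_ge.
rewrite /series /= (big_cat_nat _ nm)//= [X in _ + X]big_nat_cond [X in _ + X]big1 ?addr0; last first.
  by move=> i /andP[/andP[ni _] _]; rewrite pochhammer_neg// !mul0r.
by rewrite big_mkord /jpoly horner_poly.
Unshelve. all: by end_near. Qed.

(** The ratio of consecutive coefficients, cleared of denominators; read coefficient by coefficient
    it is the hypergeometric differential equation. *)
Lemma jcoef_succ n (a b : R) k : 0 <= a ->
  jcoef n a b k.+1 * ((k.+1)%:R * (k%:R + a + 1)) =
  jcoef n a b k * ((k%:R - n%:R) * (n%:R + a + b + 1 + k%:R)).
Proof.
move=> a0; have a1 : 0 < a + 1 by rewrite ltr_wpDl.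
rewrite /jcoef !pochhammer_recr factS natrM.
have p0 := pochhammer_gt0 k a1; have f0 : 0 < k`!%:R :> R by rewrite ltr0n fact_gt0.
have k1 : 0 < k.+1%:R :> R by rewrite ltr0n.
have ak : 0 < a + 1 + k%:R by rewrite ltr_wpDr.
move: (pochhammer _ _) (pochhammer _ _) => u w.
move: p0 f0 k1 ak; rewrite -natr1; move: (pochhammer _ _) (k`!%:R) (k%:R) => p f kk p0 f0 k1 ak.
by field; rewrite !gt_eqF.
Qed.

(** Taking the first factor out of each Pochhammer symbol shifts all three parameters by one, which
    is the effect of differentiation on the series. *)
Lemma jcoef_ladder n (a b : R) k : 0 <= a ->
  jcoef n.+1 a b k.+1 * k.+1%:R =
  - (n.+1%:R * (n.+1%:R + a + b + 1) / (a + 1)) * jcoef n (a + 1) (b + 1) k.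
Proof.
move=> a0; have a1 : 0 < a + 1 by rewrite ltr_wpDl.
have a2 : 0 < a + 1 + 1 by rewrite ltr_wpDl// ltW.
rewrite /jcoef !pochhammer_recl factS natrM.
have -> : - n.+1%:R + 1 = - n%:R :> R by rewrite -natr1; ring.
have -> : n.+1%:R + a + b + 1 + 1 = n%:R + (a + 1) + (b + 1) + 1 :> R by rewrite -natr1; ring.
have p0 := pochhammer_gt0 k a2; have f0 : 0 < k`!%:R :> R by rewrite ltr0n fact_gt0.
have k1 : 0 < k.+1%:R :> R by rewrite ltr0n.
move: (pochhammer (- _) _) (pochhammer (_ + _ + _ + _) _) => u w.
move: p0 f0 k1; move: (pochhammer _ _) (k`!%:R) (k.+1%:R) => p f kk p0 f0 k1.
by field; rewrite !gt_eqF.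
Qed.

Lemma jpoly_ode n (a b z : R) : 0 <= a ->
  z * (1 - z) * (jpoly n a b)^`()^`().[z] + ((a + 1) - (a + b + 2) * z) * (jpoly n a b)^`().[z]
   + n%:R * (n%:R + a + b + 1) * (jpoly n a b).[z] = 0.
Proof.
move=> a0; set F := jpoly n a b.
have : 'X * (1 - 'X) * F^`()^`() + ((a + 1)%:P - (a + b + 2)%:P * 'X) * F^`()
   + (n%:R * (n%:R + a + b + 1))%:P * F = 0.
  have -> : 'X * (1 - 'X) * F^`()^`() + ((a + 1)%:P - (a + b + 2)%:P * 'X) * F^`()
   + (n%:R * (n%:R + a + b + 1))%:P * F =
     F^`()^`() * 'X - F^`()^`() * 'X * 'X + ((a + 1)%:P * F^`() - (a + b + 2)%:P * (F^`() * 'X))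
     + (n%:R * (n%:R + a + b + 1))%:P * F by ring.
  apply/polyP => k; rewrite !(coefD, coefN, coefCM, coefMX, coef0, coef_deriv).
  have mn (x : R) m : x *+ m = x * m%:R by rewrite mulr_natr.
  case: k => [|k] /=; last case: k => [|k] /=; rewrite ?coef_deriv !jpolyE !(mn (jcoef _ _ _ _)) ?(mn (_ * _)).
  - by have := jcoef_succ n b 0 a0; clear; lra.
  - by have := jcoef_succ n b 1 a0; clear; lra.
  - have := jcoef_succ n b k.+2 a0; rewrite -!natr1; clear.
    by move: (jcoef _ _ _ _) (jcoef _ _ _ _) (k%:R) (n%:R) => u w kk nn h; lra.
by move/(congr1 (fun p => p.[z])); rewrite !(hornerE, hornerM, hornerD, hornerN, hornerC, hornerX).
Qed.

Lemma jpoly_ladder n (a b : R) : 0 <= a ->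
  (jpoly n.+1 a b)^`() = (- (n.+1%:R * (n.+1%:R + a + b + 1) / (a + 1)))%:P * jpoly n (a + 1) (b + 1).
Proof.
move=> a0; apply/polyP => k; rewrite coef_deriv coefCM !jpolyE.
by rewrite -(jcoef_ladder n b k a0) mulr_natr.
Qed.

Lemma jpoly0 (a b : R) : jpoly 0 a b = 1.
Proof.
apply/polyP => k; rewrite jpolyE coef1; case: k => [|k].
  by rewrite /jcoef /pochhammer !big_geq// fact0 !mulr1 divr1.
by rewrite /jcoef pochhammer_neg// !mul0r.
Qed.

Definition jnorm (n : nat) (a : R) : R := Gamma (n%:R + a + 1) / (Gamma (a + 1) * Gamma (n%:R + 1)).
Definition jac1 (n : nat) (a b x : R) := - jnorm n a / 2 * (jpoly n a b)^`().[(1 - x) / 2].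
Definition jac2 (n : nat) (a b x : R) := jnorm n a / 4 * (jpoly n a b)^`()^`().[(1 - x) / 2].

Lemma jacobiE n (a b x : R) : jacobi n a b x = jnorm n a * (jpoly n a b).[(1 - x) / 2].
Proof. by rewrite /jacobi hypergeometric_jpoly. Qed.

Lemma deriv_poly_half (p : {poly R}) (x : R) :
  is_derive x 1 (fun x => p.[(1 - x) / 2]) (- (1/2) * p^`().[(1 - x) / 2]).
Proof.
have d1 : is_derive x 1 (fun x => (1 - x) / 2) (- (1 / 2)) by der; rewrite /=; field.
exact: (deriv_comp d1 (is_derive_poly p _)).
Qed.

Lemma deriv_jacobi n (a b x : R) : is_derive x 1 (jacobi n a b) (jac1 n a b x).
Proof.
have h := deriv_poly_half (jpoly n a b) x.
have e : (fun x => jnorm n a * (jpoly n a b).[(1 - x) / 2]) =1 jacobi n a b.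
  by move=> z; rewrite jacobiE.
apply: (deriv_ext e); apply: (is_derive_eq (deriv_mul (deriv_cst (jnorm n a) x) h)).
by rewrite /jac1; field.
Qed.

Lemma deriv_jac1 n (a b x : R) : is_derive x 1 (jac1 n a b) (jac2 n a b x).
Proof.
have h := deriv_poly_half (jpoly n a b)^`() x.
apply: (is_derive_eq (deriv_mul (deriv_cst (- jnorm n a / 2) x) h)).
by rewrite /jac2; field.
Qed.

Lemma jacobi_ode n (a b x : R) : 0 <= a ->
  (1 - x ^+ 2) * jac2 n a b x + (b - a - (a + b + 2) * x) * jac1 n a b x
   + n%:R * (n%:R + a + b + 1) * jacobi n a b x = 0.
Proof.
move=> a0; have h := jpoly_ode n b ((1 - x) / 2) a0.
rewrite /jac1 /jac2 jacobiE.
by have := congr1 (fun t => jnorm n a * t) h; rewrite mulr0; clear; lra.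
Qed.

(** The classical derivative formula. The normalising Gamma factors at [(n + 1, a)] and [(n, a + 1)]
    share the same numerator and differ by [(a + 1) / (n + 1)], which cancels against the factor
    from the series. *)
Lemma jacobi_ladder n (a b x : R) : 0 <= a ->
  jac1 n.+1 a b x = (n.+1%:R + a + b + 1) / 2 * jacobi n (a + 1) (b + 1) x.
Proof.
move=> a0; rewrite /jac1 jpoly_ladder// hornerM hornerC jacobiE /jnorm.
have a1 : 1 <= a + 1 by rewrite lerDr.
have n1 : 1 <= n%:R + 1 :> R by rewrite lerDr.
have -> : n%:R + (a + 1) + 1 = n.+1%:R + a + 1 :> R by rewrite -natr1; ring.
have -> : n.+1%:R + 1 = n%:R + 1 + 1 :> R by rewrite -natr1.
rewrite (Gamma_succ a1) (Gamma_succ n1) natr1 -/n.+1.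
have g1 := Gamma_gt0 a1; have g2 := Gamma_gt0 n1.
have a10 := lt_le_trans ltr01 a1; have n10 := lt_le_trans ltr01 n1.
move: g1 g2; rewrite -natr1; move: (Gamma _) (Gamma (a + 1)) (Gamma (n%:R + 1)) (_.[_]) => G1 G2 G3 u g1 g2.
by field; rewrite !gt_eqF.
Qed.

Lemma jacobi0 (a b x : R) : 0 <= a -> jacobi 0 a b x = (Gamma 1)^-1.
Proof.
move=> a0; rewrite jacobiE jpoly0 hornerC mulr1 /jnorm !add0r.
have a1 : 1 <= a + 1 by rewrite lerDr.
by rewrite invfM mulrA divff ?mul1r// gt_eqF ?Gamma_gt0.
Qed.

End JacobiPolynomials.

(** * The weighted square norm, and g as a solution of the differential equation *)

Section Normalization.
Context {R : realType}.

Lemma contI_jacobi n (a b : R) : contI (-1) 1 (jacobi n a b).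
Proof. by apply: contI_deriv => x _; eexists; exact: deriv_jacobi. Qed.

Lemma contI_jac1 n (a b : R) : contI (-1) 1 (jac1 n a b).
Proof. by apply: contI_deriv => x _; eexists; exact: deriv_jac1. Qed.

(** In self-adjoint form the equation says that [4 wt (a + 1) (b + 1) P'] has derivative
    [- la wt a b P]. Integrating it against [P] expresses the norm of [P] through that of [P'],
    which is a multiple of the polynomial of degree [n] with both parameters raised; the boundary
    term vanishes. *)
Lemma mass_succ n (a b T : R) : 0 <= a -> 0 <= b ->
  has_int (fun x => wt (a + 1) (b + 1) x * jacobi n (a + 1) (b + 1) x ^+ 2) T ->
  has_int (fun x => wt a b x * jacobi n.+1 a b x ^+ 2) ((n.+1%:R + a + b + 1) / n.+1%:R * T).
Proof.
move=> a0 b0 [Y [cY dY hT]].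
have a1 : 0 < a + 1 by rewrite ltr_wpDl. have b1 : 0 < b + 1 by rewrite ltr_wpDl.
have [m hm] : exists m : R, m = n.+1%:R by eexists.
have m0 : 0 < m by rewrite hm ltr0n.
have s0 : 0 < m + a + b + 1 by rewrite ltr_wpDl// !addr_ge0// ltW.
pose la := m * (m + a + b + 1); have la0 : 0 < la by rewrite mulr_gt0.
have cw := contI_wt (ltW a1) (ltW b1).
have cP := @contI_jacobi n.+1 a b; have cP1 := @contI_jac1 n.+1 a b.
rewrite -hm.
exists (fun x => la^-1 * ((m + a + b + 1) ^+ 2 * Y x
   - 4 * (wt (a + 1) (b + 1) x * (jacobi n.+1 a b x * jac1 n.+1 a b x)))); split.
- by ctn.
- move=> x xI; have hY := dY x xI; have hw := deriv_wt (a + 1) (b + 1) xI.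
  have hP := deriv_jacobi n.+1 a b x; have hP1 := deriv_jac1 n.+1 a b x.
  have [k1 k2] : 1 - x != 0 /\ 1 + x != 0.
    by split; apply/eqP; move: xI; clear; lra.
  have hl := jacobi_ladder n b x a0; have ho := jacobi_ode n.+1 b x a0; rewrite -hm in hl ho.
  have ew : wt (a + 1) (b + 1) x = (1 - x ^+ 2) / 4 * wt a b x.
    by rewrite (wt_succ_l _ a0 xI)// wt_succ_r//; field.
  der; rewrite /= ew.
  have -> : jacobi n (a + 1) (b + 1) x = jac1 n.+1 a b x / ((m + a + b + 1) / 2).
    by rewrite hl; field; rewrite gt_eqF.
  move: ho; clear - k1 k2 la0 m0 s0.
  move: (jac1 n.+1 a b x) (jac2 n.+1 a b x) (jacobi n.+1 a b x) (wt a b x) => J1 J2 P w ho.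
  have p0 : 1 - x ^+ 2 != 0.
    have -> : 1 - x ^+ 2 = (1 - x) * (1 + x) by ring.
    exact: mulf_neq0.
  have -> : J2 = - ((b - a - (a + b + 2) * x) * J1 + m * (m + a + b + 1) * P) / (1 - x ^+ 2).
    by apply: (mulIf p0); rewrite divfK// mulrC; move: ho; clear; lra.
  rewrite /la; field.
  by rewrite k1 k2 p0 !gt_eqF.
- have [-> ->] := wt_end a1 b1; rewrite -hT /la; field.
  by rewrite !gt_eqF.
Qed.

Lemma mass_bound : exists2 C : R, 0 < C & forall n (a b : R), 0 <= a -> 0 <= b ->
  exists2 T, has_int (fun x => wt a b x * jacobi n a b x ^+ 2) T &
  T <= C * (Gamma (n%:R + a + 1) * Gamma (n%:R + b + 1) /
    (Gamma (n%:R + a + b + 1) * Gamma (n%:R + 1) * (2 * n%:R + a + b + 1))).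
Proof.
have [C C0 hC] := @beta_bound R.
have G1 : 0 < Gamma (1 : R) by exact: Gamma_gt0.
(* [Gamma 1] is carried as a positive number: the square of [jacobi 0] contributes two inverse
   powers, one of which is the factor [Gamma (n + 1)] of the bound at [n = 0]. *)
exists (C / Gamma 1); first by rewrite divr_gt0.
elim=> [|n ih] a b a0 b0.
  have [T [Y [cY dY hT]] hb] := hC a b a0 b0.
  exists (T / Gamma 1 ^+ 2).
    exists (fun x => (Gamma 1 ^+ 2)^-1 * Y x); split.
    - by ctn.
    - move=> x xI; have hY := dY x xI; der; rewrite /= jacobi0// exprVn; ring.
    - by rewrite -hT; ring.
  have s1 : 1 <= a + b + 1 by rewrite lerDr addr_ge0.
  have e : a + b + 2 = a + b + 1 + 1 by ring.
  rewrite e (Gamma_succ s1) in hb.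
  rewrite !add0r mulr0 add0r.
  have G2 := Gamma_gt0 s1; have s0 := lt_le_trans ltr01 s1.
  have i0 : 0 <= (Gamma (1 : R) ^+ 2)^-1 by rewrite invr_ge0 sqr_ge0.
  have := ler_wpM2r i0 hb.
  move: G1 G2 s0; clear; move: (Gamma 1) (Gamma (a + b + 1)) (Gamma (a + 1)) (Gamma (b + 1)) => g1 g2 g3 g4 g10 g20 s0.
  have -> : C * (g3 * g4 / ((a + b + 1) * g2)) / g1 ^+ 2 = C / g1 * (g3 * g4 / (g2 * g1 * (a + b + 1))).
    by field; rewrite !gt_eqF.
  by [].
have a10 : 0 <= a + 1 by rewrite addr_ge0. have b10 : 0 <= b + 1 by rewrite addr_ge0.
have [T hT hb] := ih (a + 1) (b + 1) a10 b10.
exists ((n.+1%:R + a + b + 1) / n.+1%:R * T); first exact: mass_succ.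
have n0 : 0 < n.+1%:R :> R by rewrite ltr0n.
have s1 : 1 <= n.+1%:R + a + b + 1 by rewrite lerDr !addr_ge0.
have n1 : 1 <= n%:R + 1 :> R by rewrite lerDr.
have e1 : n%:R + (a + 1) + 1 = n.+1%:R + a + 1 by rewrite -natr1; ring.
have e2 : n%:R + (b + 1) + 1 = n.+1%:R + b + 1 by rewrite -natr1; ring.
have e3 : n%:R + (a + 1) + (b + 1) + 1 = n.+1%:R + a + b + 1 + 1 by rewrite -natr1; ring.
(* [2 n + a + b + 1] is invariant under the shift of all three parameters, so the factor [1 / N] of
   the beta integral survives the induction unchanged. *)
have e4 : 2 * n%:R + (a + 1) + (b + 1) + 1 = 2 * n.+1%:R + a + b + 1 by rewrite -natr1; ring.
have e5 : n.+1%:R + 1 = n%:R + 1 + 1 :> R by rewrite -natr1.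
rewrite e1 e2 e3 e4 (Gamma_succ s1) in hb; rewrite e5 (Gamma_succ n1).
have G2 := Gamma_gt0 s1; have G3 := Gamma_gt0 n1.
have s0 := lt_le_trans ltr01 s1; have n10 := lt_le_trans ltr01 n1.
have q0 : 0 <= (n.+1%:R + a + b + 1) / n.+1%:R by rewrite divr_ge0 ?ltW.
have t0 : 0 < 2 * n.+1%:R + a + b + 1 by move: a0 b0 n0; clear; lra.
apply: (le_trans (ler_wpM2l q0 hb)).
move: G1 G2 G3 s0 n10 n0 t0; rewrite -natr1; clear.
move: n%:R (Gamma _) (Gamma _) (Gamma 1) (Gamma (n%:R + 1 + a + b + 1)) (Gamma (n%:R + 1)).
move=> m g4 g5 g1 g2 g3 g10 g20 g30 s0 n10 n0 t0.
rewrite le_eqVlt; apply/orP; left; apply/eqP.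
by field; rewrite !gt_eqF.
Qed.

Lemma wt_half_sqr (a b x : R) : -1 < x < 1 -> wt (a / 2) (b / 2) x ^+ 2 = wt a b x.
Proof.
move=> xI; have [h1 h2] : 0 < (1 - x) / 2 /\ 0 < (1 + x) / 2 by move: xI; clear; lra.
have e (u r : R) : 0 < u -> u `^ (r / 2) ^+ 2 = u `^ r.
  by move=> u0; rewrite expr2 -powRD ?(gt_eqF u0) ?implybT//; congr (_ `^ _); field.
by rewrite /wt exprMn !e.
Qed.

(** The second function is [(1 - x^2) y']: multiplied by [1 - x^2], the logarithmic derivative of
    the square root of the weight becomes the polynomial [b/2 (1 - x) - a/2 (1 + x)]. Its end values
    [- a] and [b] give the boundary conditions, also for a zero exponent, where the weight factor is
    [1] at the end point. *)
Lemma jacobi_jsol n (a b : R) Y T : 0 <= a -> 0 <= b ->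
  let k := (Gamma (n%:R + 1) * Gamma (n%:R + a + b + 1) /
     (Gamma (n%:R + a + 1) * Gamma (n%:R + b + 1))) in
  contI (-1) 1 Y ->
  (forall x : R, -1 < x < 1 -> is_derive x 1 Y (wt a b x * jacobi n a b x ^+ 2)) ->
  Y 1 - Y (-1) = T ->
  jsol a b (2 * n%:R + a + b + 1) (jacobi_g n a b)
    (fun x => k `^ (1 / 2) * (wt (a / 2) (b / 2) x *
       ((1 - x ^+ 2) * jac1 n a b x + (b / 2 * (1 - x) - a / 2 * (1 + x)) * jacobi n a b x)))
    (fun x => k * Y x).
Proof.
move=> a0 b0 k cY dY hT.
have k0 : 0 < k.
  by rewrite divr_gt0// mulr_gt0// Gamma_gt0// lerDr ?addr_ge0.
have [kk hk] : exists kk, kk = k `^ (1 / 2) by eexists.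
have kk2 : kk ^+ 2 = k.
  rewrite hk expr2 -powRD ?(gt_eqF k0) ?implybT//.
  have -> : 1 / 2 + 1 / 2 = 1 :> R by field.
  by rewrite powRr1// ltW.
have gE : jacobi_g n a b =1 (fun x => kk * (wt (a / 2) (b / 2) x * jacobi n a b x)).
  by move=> x; rewrite /jacobi_g -/k -hk /wt; ring.
have {gE}-> : jacobi_g n a b = (fun x => kk * (wt (a / 2) (b / 2) x * jacobi n a b x)) by exact/funext.
rewrite -hk.
have a2 : 0 <= a / 2 by rewrite divr_ge0. have b2 : 0 <= b / 2 by rewrite divr_ge0.
have cw := contI_wt a2 b2.
have cP := @contI_jacobi n a b; have cP1 := @contI_jac1 n a b.
have hne (x : R) : -1 < x < 1 -> 1 - x != 0 /\ 1 + x != 0.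
  by move=> xI; split; apply/eqP; move: xI; clear; lra.
have n0 : 0 <= n%:R :> R by [].
split.
- exact: a0.
- exact: b0.
- by move: n0 a0 b0; clear; lra.
- by ctn.
- by ctn.
- by ctn.
- move=> x xI; have hw := deriv_wt (a / 2) (b / 2) xI; have hP := deriv_jacobi n a b x.
  have [k1 k2] := hne x xI.
  der; rewrite /=.
  have -> : 1 - x ^+ 2 = (1 - x) * (1 + x) by ring.
  by field; rewrite k1 k2.
- move=> x xI; have hw := deriv_wt (a / 2) (b / 2) xI; have hP := deriv_jacobi n a b x.
  have hP1 := deriv_jac1 n a b x; have [k1 k2] := hne x xI.
  have ho := jacobi_ode n b x a0.
  der; rewrite /=.
  move: ho; rewrite /Wt /Wh; clear - k1 k2.
  move: (jac1 n a b x) (jac2 n a b x) (jacobi n a b x) (wt (a / 2) (b / 2) x) => J1 J2 P w ho.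
  have e : 1 - x ^+ 2 = (1 - x) * (1 + x) by ring.
  have p0 : 1 - x ^+ 2 != 0 by rewrite e mulf_neq0.
  have -> : J2 = - ((b - a - (a + b + 2) * x) * J1 + n%:R * (n%:R + a + b + 1) * P) / (1 - x ^+ 2).
    by apply: (mulIf p0); rewrite divfK// mulrC; move: ho; clear; lra.
  by field; rewrite k1 k2 p0.
- move=> x xI; have hY := dY x xI; der; rewrite /= -(wt_half_sqr a b xI) -kk2; ring.
- by rewrite expr1n !subrr; field.
- by rewrite sqrrN expr1n !subrr; field.
Qed.

Lemma powR4K (u : R) : 0 <= u -> (u `^ (1 / 4)) ^+ 4 = u.
Proof.
move=> u0; rewrite -powR_mulrn ?powR_ge0// -powRrM.
have -> : 1 / 4 * 4%:R = 1 :> R by field.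
by rewrite powRr1.
Qed.

End Normalization.

(** * The uniform bound, from the estimate of p y^4 and the size of the mass *)

Theorem theorem1p1 (R : realType) :
  exists C : R, 0 < C /\
    forall (x a b : R) (n : nat), -1 <= x <= 1 -> 0 <= a -> 0 <= b ->
      `| (1 - x ^+ 2) `^ (1 / 4) * jacobi_g n a b x |
        <= C * (2 * n%:R + a + b + 1) `^ (- (1 / 4)).
Proof.
have [C1 C10 hC1] := @jsol_bound R; have [C2 C20 hC2] := @mass_bound R.
have CC : 0 < C1 * C2 ^+ 2 by rewrite mulr_gt0// exprn_gt0.
(* The mass of [g] is at most [C2 / N] and enters squared, so the fourth power of the left side is
   at most [C1 (C2 / N)^2 N = C1 C2^2 / N]. *)
exists ((C1 * C2 ^+ 2) `^ (1 / 4)); split; first by rewrite powR_gt0.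
move=> x a b n xI a0 b0.
have [T [Y [cY dY hT]] hb] := hC2 n a b a0 b0.
have S := jacobi_jsol a0 b0 cY dY hT.
have := hC1 _ _ _ _ _ _ S x xI; rewrite -mulrBr hT.
set k := (Gamma (n%:R + 1) * _ / _) in S *; set N := 2 * n%:R + a + b + 1 in S hb *.
have N0 : 0 < N := lt_le_trans ltr01 (jsol_N1 S).
have T0 : 0 <= k * T.
  have le11 : (-1 : R) <= 1 by clear; lra.
  rewrite -hT mulrBr subr_ge0.
  exact: (mass_mono S (lexx _) le11 (lexx _)).
(* The normalisation [k] of [g] is exactly the inverse of the Gamma quotient in the mass bound, so
   only [1 / N] remains. *)
have kT : k * T <= C2 / N.
  have k0 : 0 <= k.
    by rewrite divr_ge0// mulr_ge0// ltW// Gamma_gt0// lerDr ?addr_ge0.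
  apply: (le_trans (ler_wpM2l k0 hb)); rewrite le_eqVlt; apply/orP; left; apply/eqP.
  have g1 : 0 < Gamma (n%:R + 1 : R) by rewrite Gamma_gt0// lerDr.
  have g2 : 0 < Gamma (n%:R + a + b + 1) by rewrite Gamma_gt0// lerDr !addr_ge0.
  have g3 : 0 < Gamma (n%:R + a + 1) by rewrite Gamma_gt0// lerDr addr_ge0.
  have g4 : 0 < Gamma (n%:R + b + 1) by rewrite Gamma_gt0// lerDr addr_ge0.
  rewrite /k; move: g1 g2 g3 g4 N0; clear.
  move: (Gamma _) (Gamma _) (Gamma _) (Gamma _) N => u1 u2 u3 u4 M g1 g2 g3 g4 N0.
  by field; rewrite !gt_eqF.
move=> hy.
have p0 : 0 <= 1 - x ^+ 2.
  case/andP: xI => xx1 xx2; have -> : 1 - x ^+ 2 = (1 - x) * (1 + x) by ring.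
  by rewrite mulr_ge0//; move: xx1 xx2; clear; lra.
rewrite -(@ler_pXn2r _ 4)// ?nnegrE ?mulr_ge0 ?powR_ge0//.
rewrite -normrX (exprMn 4 _ (jacobi_g _ _ _ _)) (exprMn 4 _ (N `^ _)) powRN exprVn !powR4K ?(ltW CC) ?(ltW N0)//.
rewrite ger0_norm; last by apply: mulr_ge0 => //; exact: exprn_even_ge0.
apply: (le_trans hy).
have h1 : (k * T) ^+ 2 <= (C2 / N) ^+ 2.
  by rewrite ler_pXn2r// nnegrE// divr_ge0 ?ltW.
have h2 : 0 <= C1 * N by rewrite mulr_ge0 ?ltW.
have := ler_wpM2l h2 h1.
have -> : C1 * N * (C2 / N) ^+ 2 = C1 * C2 ^+ 2 / N by field; rewrite gt_eqF.
by rewrite mulrAC.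
Qed.
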